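(* Let $\mathbf{G}=\mathrm{U}(V)$ be a quasi-split unitary group attached to the ramified quadratic extension $E/K$, and let $\mathbf{T}\subset\mathbf{G}$ be a maximal, relatively unramified, anisotropic torus whose stable class corresponds to $\sigma\in W^I$. Let $\sigma=\sigma_1\cdots\sigma_j$ be the decomposition of $\sigma$ into disjoint negative cycles, let $r_i$ be the length of $\sigma_i$, and put $s_i=2r_i$. (1) If $\dim V=2m+1$ is odd, then $\mathbf{T}\cong\prod_{i=1}^j\mathbf{T}_{s_i}\times\mathrm{U}_1(E/K)$ as tori over $K$. (2) If $\dim V=2m$ is even, then $\mathbf{T}\cong\prod_{i=1}^j\mathbf{T}_{s_i}$ as tori over $K$.
   Context: $K/\mathbb{Q}_p$ is a finite extension, $p\neq2$; $E/K$ is a ramified quadratic extension, $\mathrm{Gal}(E/K)=\{1,\tau\}$; $I$ is the inertia group of $K$ and $K^{u}$ the maximal unramified extension. $V$ is a Hermitian space over $E$ and $\mathbf{G}=\mathrm{U}(V)$ is quasi-split; $\mathbf{S}$ is the centralizer of a maximal $K$-split torus (a maximal torus). Put $J=\{\pm1,\dots,\pm m\}$ if $\dim V=2m$ and $J=\{0,\pm1,\dots,\pm m\}$ if $\dim V=2m+1$. $X^*(\mathbf{S})$ has a basis $\{\chi_i\}_{i\in J}$ with roots $\chi_i-\chi_j$, Galois acting through $\mathrm{Gal}(E/K)$ by $\tau(\chi_i)=-\chi_{-i}$; the Weyl group of $\mathbf{S}$ is $W=\mathrm{Perm}(J)$, and $W^I$ is the centralizer of $i\mapsto-i$. Two maximal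 $K$-tori of $\mathbf{G}$ are stably conjugate if an element of $\mathbf{G}(\bar K)$ conjugates the $K$-points of one to those of the other. A maximal $K$-torus is relatively unramified if it becomes isomorphic to $\mathbf{S}$ over $K^{u}$. Stable classes of relatively unramified maximal tori are in bijection with $H^1(\mathrm{Gal}(K^{u}/K),W^I)$; the class corresponding to $\sigma\in W^I$ is that of the cocycle sending Frobenius to $\sigma$, and its tori have character group $X^*(\mathbf{S})$ with inertia acting as on $X^*(\mathbf{S})$ and a Frobenius fixing $E$ acting by $\sigma$. A cycle of $\sigma\in W^I$ on nonzero indices has the form $i_1\mapsto\pm i_2\mapsto\cdots\mapsto\pm i_r\mapsto\pm i_1$ with $|i_1|,\dots,|i_r|$ distinct; $r$ is its length; it is positive if $\sigma^r(i_1)=i_1$ and negative if $\sigma^r(i_1)=-i_1$. The torus is anisotropic exactly when all cycles are negative. For $s=2r$: $K_r$, $K_s$, $E_s$ are the unramified extensions of $K$, $K$, $E$ of degrees $r$, $s$, $s$; $\sigma_s\in\mathrm{Gal}(E_s/K)$ is the element of order $s$ fixing $E$ and inducing Frobenius on $K_s$; $\tau_s$ is the nontrivial element fixing $K_s$; $\eta_s=\tau_s\sigma_s^r$; $L_r$ is the fixed field of $\eta_s$ in $E_s$. $\mathrm{U}_1(F'/F)$ denotes the norm-one torus of a quadratic extension $F'/F$, and $\mathbf{T}_s=\mathrm{Res}_{L_r/K}\mathrm{U}_1(E_s/L_r)$. *)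

(* Defs.v *)
From HB Require Import structures.
From mathcomp Require Import all_boot all_order all_algebra all_fingroup.
From mathcomp Require Import all_solvable all_field.
From mathcomp Require Import sesquilinear.
From mathcomp.multinomials Require Import mpoly.

Set Implicit Arguments.
Unset Strict Implicit.
Unset Printing Implicit Defensive.

Import Order.TTheory GRing.Theory Num.Theory.
Local Open Scope ring_scope.

(* [Qp] is the field of p-adic numbers: the completion of [rat] for the p-adic
   absolute value (whose values are rational numbers). *)
Record padic_abs (p : nat) (Qp : fieldType) := PadicAbs {
  pabs : Qp -> rat;
  pabs_ge0 : forall x, 0 <= pabs x;
  pabs_eq0 : forall x, pabs x = 0 <-> x = 0;
  pabsM : forall x y, pabs (x * y) = pabs x * pabs y;
  pabsD : forall x y, pabs (x + y) <= Num.max (pabs x) (pabs y);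
  pabs_nat : forall n : nat, (0 < n)%N -> pabs n%:R = p%:R ^- logn p n;
  pabs_dense : forall (x : Qp) (e : rat), 0 < e ->
    exists a : rat, pabs (x - ratr a) < e;
  pabs_complete : forall u : nat -> Qp,
    (forall e : rat, 0 < e -> exists n0 : nat, forall m n : nat,
       (n0 <= m)%N -> (n0 <= n)%N -> pabs (u m - u n) < e) ->
    exists l : Qp, forall e : rat, 0 < e -> exists n0 : nat, forall n : nat,
      (n0 <= n)%N -> pabs (u n - l) < e
}.

Section Integers.
Context (p : nat) (Qp : fieldType) (v : padic_abs p Qp) (K : fieldExtType Qp).

(* For an algebraic extension [i : K -> F]: the valuation ring of [F] (the
   integral closure of Z_p) and its maximal ideal. *)
Definition vring (F : fieldType) (i : K -> F) (x : F) : Prop :=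
  exists2 P : {poly Qp},
    P \is monic /\ (forall k, pabs v P`_k <= 1) &
    root (map_poly (fun c : Qp => i c%:A) P) x.

Definition vmax (F : fieldType) (i : K -> F) (x : F) : Prop :=
  vring i x /\ (x = 0 \/ ~ vring i x^-1).

Definition residue_card (q : nat) : Prop :=
  exists t : 'I_q -> K, (forall k, vring idfun (t k)) /\
    forall x : K, vring idfun x -> exists! k, vmax idfun (x - t k).

(* [B/A] is unramified: the maximal ideal of [A] generates that of [B] (the
   residue fields are finite, so the residue extension is separable). *)
Definition unramified (L : fieldExtType K) (A B : {subfield L}) : Prop :=
  forall x : L, x \in B -> vmax (in_alg L) x ->
  exists a y : L, [/\ a \in A, vmax (in_alg L) a, y \in B,
                      vring (in_alg L) y & x = a * y].

End Integers.

(* Linear algebraic groups in characteristic 0 are given by their points over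
   an algebraically closed field [C]; [F] is always a subfield of [C]. *)

Section AlgebraicGroups.
Context (C : closedFieldType).
Implicit Type F : C -> Prop.

Definition anyC : C -> Prop := fun=> True.

Definition subG N (H G : 'M[C]_N -> Prop) : Prop := forall g, H g -> G g.

(* The affine coordinates of GL_N: the entries and the inverse determinant. *)
Definition gl_coord N (g : 'M[C]_N) (k : 'I_(N * N + 1)) : C :=
  row_mx (mxvec g) ((\det g)^-1)%:M 0 k.

Definition mpoly_over F n (P : {mpoly C[n]}) : Prop := forall m, F P@_m.

Definition is_subgroup N (G : 'M[C]_N -> Prop) : Prop :=
  [/\ subG G (fun g => g \in unitmx), G 1%:M,
      (forall g h, G g -> G h -> G (g *m h)) &
      (forall g, G g -> G (invmx g))].

(* Since char C = 0, F is perfect, so a group cut out by equations over F is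
   a (smooth) group defined over F. *)
Definition closed_group F N (G : 'M[C]_N -> Prop) : Prop :=
  is_subgroup G /\
  exists2 Eqs : {mpoly C[N * N + 1]} -> Prop,
    (forall P, Eqs P -> mpoly_over F P) &
    (forall g, G g <->
       g \in unitmx /\ forall P, Eqs P -> P.@[gl_coord g] = 0).

Definition regular F N (G : 'M[C]_N -> Prop) (f : 'M[C]_N -> C) : Prop :=
  exists2 P : {mpoly C[N * N + 1]}, mpoly_over F P &
    forall g, G g -> f g = P.@[gl_coord g].

Definition group_mor F N M (G : 'M[C]_N -> Prop) (H : 'M[C]_M -> Prop)
    (f : 'M[C]_N -> 'M[C]_M) : Prop :=
  [/\ (forall g, G g -> H (f g)),
      (forall g g', G g -> G g' -> f (g *m g') = f g *m f g') &
      (forall i j, regular F G (fun g => f g i j))].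

Definition group_iso F N M (G : 'M[C]_N -> Prop) (H : 'M[C]_M -> Prop) : Prop :=
  exists (f : 'M[C]_N -> 'M[C]_M) (f' : 'M[C]_M -> 'M[C]_N),
  [/\ group_mor F G H f, group_mor F H G f',
      (forall g, G g -> f' (f g) = g) & (forall h, H h -> f (f' h) = h)].

Definition prod_group N M (G : 'M[C]_N -> Prop) (H : 'M[C]_M -> Prop) :
    'M[C]_(N + M) -> Prop :=
  fun x => exists g h, [/\ G g, H h & x = block_mx g 0 0 h].

Definition bigprod_group j (N : 'I_j -> nat)
    (G : forall k, 'M[C]_(N k) -> Prop) : 'M[C]_(\sum_k N k) -> Prop :=
  fun x => exists2 g : forall k, 'M[C]_(N k),
    (forall k, G k (g k)) & x = \mxdiag_k g k.

Definition Gm d : 'M[C]_d -> Prop := fun g => g \in unitmx /\ is_diag_mx g.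

Definition torus F N (T : 'M[C]_N -> Prop) : Prop :=
  closed_group F T /\ exists d, group_iso anyC T (@Gm d).

Definition split_torus F N (T : 'M[C]_N -> Prop) : Prop :=
  closed_group F T /\ exists d, group_iso F T (@Gm d).

Definition maximal_for N (P : ('M[C]_N -> Prop) -> Prop)
    (G H : 'M[C]_N -> Prop) : Prop :=
  [/\ P H, subG H G &
      forall H', P H' -> subG H' G -> subG H H' -> subG H' H].

Definition maximal_torus F N (G T : 'M[C]_N -> Prop) : Prop :=
  maximal_for (@torus F N) G T.

Definition maximal_split_torus F N (G A : 'M[C]_N -> Prop) : Prop :=
  maximal_for (@split_torus F N) G A.

Definition centralizer N (G A : 'M[C]_N -> Prop) : 'M[C]_N -> Prop :=
  fun g => G g /\ forall a, A a -> g *m a = a *m g.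

Definition character F N (T : 'M[C]_N -> Prop) (chi : 'M[C]_N -> C) : Prop :=
  [/\ regular F T chi, (forall t, T t -> chi t != 0) &
      (forall t u, T t -> T u -> chi (t *m u) = chi t * chi u)].

Definition anisotropic F N (T : 'M[C]_N -> Prop) : Prop :=
  forall chi, character F T chi -> forall t, T t -> chi t = 1.

Definition character_basis N (S : 'M[C]_N -> Prop) n
    (chi : 'I_n -> 'M[C]_N -> C) : Prop :=
  (forall i, character anyC S (chi i)) /\
  forall psi, character anyC S psi ->
    exists! a : {ffun 'I_n -> int},
      forall s, S s -> psi s = \prod_i chi i s ^ a i.

Definition connected N (G : 'M[C]_N -> Prop) : Prop :=
  forall H, closed_group anyC H -> subG H G ->
    (exists reps : seq 'M[C]_N, forall g, G g ->
       exists2 r, r \in reps & G r /\ H (invmx r *m g)) ->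
    subG G H.

Definition derived N (G : 'M[C]_N -> Prop) : 'M[C]_N -> Prop :=
  fun g => forall H, is_subgroup H ->
    (forall a b, G a -> G b -> H (a *m b *m invmx a *m invmx b)) -> H g.

Definition solvable_group N (G : 'M[C]_N -> Prop) : Prop :=
  exists k, subG (iter k (@derived N) G) (fun g => g = 1%:M).

Definition borel N (G B : 'M[C]_N -> Prop) : Prop :=
  maximal_for (fun H : 'M[C]_N -> Prop =>
    [/\ closed_group anyC H, connected H & solvable_group H]) G B.

Definition quasi_split F N (G : 'M[C]_N -> Prop) : Prop :=
  exists2 B, borel G B & closed_group F B.

End AlgebraicGroups.

Section Galois.
Context (p : nat) (Qp : fieldType) (v : padic_abs p Qp) (K : fieldExtType Qp).
Context (Kbar : closedFieldType) (iK : {rmorphism K -> Kbar}).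

Definition rat_over : Kbar -> Prop := fun x => exists c, x = iK c.

Definition in_GalK (gam : {rmorphism Kbar -> Kbar}) : Prop :=
  bijective gam /\ forall c, gam (iK c) = iK c.

(* The maximal unramified extension: the union of the finite unramified
   subextensions of Kbar / K. *)
Definition Kur : Kbar -> Prop := fun x =>
  exists (L : fieldExtType K) (i : {rmorphism L -> Kbar}),
    [/\ forall c : K, i c%:A = iK c, unramified v 1%AS {:L}%AS &
        exists y, x = i y].

Definition inertia (gam : {rmorphism Kbar -> Kbar}) : Prop :=
  in_GalK gam /\ forall x, Kur x -> gam x = x.

Definition frobenius (gam : {rmorphism Kbar -> Kbar}) : Prop :=
  in_GalK gam /\
  exists2 q, residue_card v K q &
    forall x, vring v iK x -> vmax v iK (gam x - x ^+ q).

End Galois.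

Section NormOne.
Context (Qp : fieldType) (K : fieldExtType Qp).
Context (Kbar : closedFieldType) (iK : {rmorphism K -> Kbar}).

(* The matrix (acting on row vectors) of a K-linear endomorphism of L. *)
Definition lin_mat (L : fieldExtType K) (f : 'End(L)) : 'M[Kbar]_(\dim {:L}) :=
  map_mx iK (passmx.mxof (vbasis {:L}) (vbasis {:L}) f).

(* Res_{M/K} U_1(L/M), as a subgroup of the group of K-automorphisms of L.
   The matrices commuting with all multiplications by elements of L form
   L \otimes_K Kbar, on which x in Gal(L/M) acts by conjugation; the last
   condition is the equation N_{L/M} = 1 (compare [galNorm]). *)
Definition resU1 (L : splittingFieldType K) (M : {subfield L}) :
    'M[Kbar]_(\dim {:L}) -> Prop := fun g =>
  [/\ g \in unitmx,
      (forall a : L, g *m lin_mat (amulr a) = lin_mat (amulr a) *m g) &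
      \big[mulmx/1%:M]_(x in ('Gal({:L} / M))%g)
        (invmx (lin_mat (gal_repr x)) *m g *m lin_mat (gal_repr x)) = 1%:M].

End NormOne.

(* The fields and automorphisms entering T_s, for s = 2r.  [Es_emb] is the
   inclusion of E in E_s; as Gal(E_s/K) is abelian, the order of composition in
   the definition of eta_s is irrelevant. *)
Record Ts_datum (p : nat) (Qp : fieldType) (v : padic_abs p Qp)
    (K : fieldExtType Qp) (E : splittingFieldType K) (r : nat) := TsDatum {
  Es : splittingFieldType K;
  Es_emb : 'AHom(E, Es);
  Es_unr : unramified v (Es_emb @: {:E})%AS {:Es}%AS;
  Es_deg : \dim_(Es_emb @: {:E})%AS {:Es} = r.*2;
  Ks : {subfield Es};
  Ks_unr : unramified v 1%AS Ks;
  Ks_deg : \dim Ks = r.*2;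
  sigma_s : gal_of {:Es};
  sigma_s_gal : sigma_s \in ('Gal({:Es} / (Es_emb @: {:E})))%g;
  sigma_s_order : #[sigma_s]%g = r.*2;
  sigma_s_frob : exists2 q, residue_card v K q &
    forall x, x \in Ks -> vring v (in_alg Es) x ->
      vmax v (in_alg Es) (sigma_s x - x ^+ q);
  tau_s : gal_of {:Es};
  tau_s_gal : tau_s \in ('Gal({:Es} / Ks))%g;
  tau_s_neq1 : tau_s != 1%g
}.

Section Ts.
Context (p : nat) (Qp : fieldType) (v : padic_abs p Qp) (K : fieldExtType Qp).
Context (E : splittingFieldType K) (r : nat) (D : Ts_datum v E r).

Definition eta_s : gal_of {:Es D} := (tau_s D * sigma_s D ^+ r)%g.

Definition L_r : {subfield Es D} := (fixedField <[eta_s]>%g)%AS.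

Definition Ts (Kbar : closedFieldType) (iK : {rmorphism K -> Kbar}) :
    'M[Kbar]_(\dim {:Es D}) -> Prop := resU1 iK L_r.

End Ts.

Arguments Ts {p Qp v K E r} D {Kbar} iK _.

Section Unitary.
Context (Qp : fieldType) (K : fieldExtType Qp) (E : splittingFieldType K).
Context (Kbar : closedFieldType) (iK : {rmorphism K -> Kbar}).
Context (V : vectType E) (h : V -> V -> E).

(* A basis of V as a vector space over K. *)
Definition Kbasis N (w : 'I_N -> V) : Prop :=
  forall x : V, exists! c : 'cV[K]_N, x = \sum_i (c i 0)%:A *: w i.

Context (N : nat) (w : 'I_N -> V).

(* [A] is the matrix (acting on column vectors) of multiplication by [e]. *)
Definition scal_mat (e : E) (A : 'M[K]_N) : Prop :=
  forall j, e *: w j = \sum_i (A i j)%:A *: w i.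

Definition form_mat (l : 'Hom(E, K^o)) : 'M[Kbar]_N :=
  \matrix_(i, j) iK (l (h (w i) (w j))).

(* E \otimes_K Kbar-linearity of an endomorphism of V \otimes_K Kbar. *)
Definition E_linear (X : 'M[Kbar]_N) : Prop :=
  forall (e : E) (A : 'M[K]_N), scal_mat e A ->
    X *m map_mx iK A = map_mx iK A *m X.

(* U(V) inside the group of K-automorphisms of V: the E-linear automorphisms g
   with h(gx, gy) = h(x, y), an equation in E \otimes_K Kbar which is tested
   on the K-linear forms l of E. *)
Definition unitary_group : 'M[Kbar]_N -> Prop := fun g =>
  [/\ g \in unitmx, E_linear g &
      forall l, g^T *m form_mat l *m g = form_mat l].

Definition unitary_lie : 'M[Kbar]_N -> Prop := fun X =>
  E_linear X /\ forall l, X^T *m form_mat l + form_mat l *m X = 0.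

Definition root_of (S : 'M[Kbar]_N -> Prop) (alpha : 'M[Kbar]_N -> Kbar) :
    Prop :=
  [/\ character (@anyC Kbar) S alpha, exists2 s, S s & alpha s != 1 &
      exists X, [/\ unitary_lie X, X != 0 &
        forall s, S s -> s *m X *m invmx s = alpha s *: X]].

(* The index set J is coded by 'I_n with n = dim V, in increasing order: the
   involution i |-> -i of J is [rev_ord], whose only fixed point, if any, is
   the index 0.  The characters are written multiplicatively, and
   (gam chi)(gam s) = gam (chi s). *)
Definition weight_basis (iE : {rmorphism E -> Kbar}) (S : 'M[Kbar]_N -> Prop)
    n (chi : 'I_n -> 'M[Kbar]_N -> Kbar) : Prop :=
  [/\ character_basis S chi,
      (forall alpha, root_of S alpha <->
         character (@anyC Kbar) S alpha /\
         exists i j, i != j /\ forall s, S s -> alpha s = chi i s / chi j s),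
      (forall gam : {rmorphism Kbar -> Kbar}, in_GalK iK gam ->
         (forall e, gam (iE e) = iE e) -> forall i s, S s ->
         gam (chi i s) = chi i (map_mx gam s)) &
      (forall gam : {rmorphism Kbar -> Kbar}, in_GalK iK gam ->
         ~ (forall e, gam (iE e) = iE e) -> forall i s, S s ->
         gam (chi i s) = (chi (rev_ord i) (map_mx gam s))^-1)].

End Unitary.

(* [n] normalizes [S] and its image in W = Perm(J) is [sg], where W acts on
   X^*(S) by (n . chi)(s) = chi (n^-1 s n). *)
Definition weyl_image (C : closedFieldType) N (S : 'M[C]_N -> Prop) d
    (chi : 'I_d -> 'M[C]_N -> C) (n : 'M[C]_N) (sg : 'S_d) : Prop :=
  (forall s, S s <-> S (invmx n *m s *m n)) /\
  forall i s, S s -> chi i (invmx n *m s *m n) = chi (sg i) s.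

(* The stable class of T corresponds to sg: for some g in G(Kbar) with
   T = g S g^-1, the cocycle gam |-> g^-1 gam(g) with values in W = N(S)/S is
   trivial on inertia and sends Frobenius to sg. *)
Definition stable_class_of (p : nat) (Qp : fieldType) (v : padic_abs p Qp)
    (K : fieldExtType Qp) (Kbar : closedFieldType) (iK : {rmorphism K -> Kbar})
    N (G S : 'M[Kbar]_N -> Prop) d (chi : 'I_d -> 'M[Kbar]_N -> Kbar)
    (T : 'M[Kbar]_N -> Prop) (sg : 'S_d) : Prop :=
  exists g, [/\ G g,
    (forall t, T t <-> S (invmx g *m t *m g)),
    (forall gam, inertia v iK gam -> S (invmx g *m map_mx gam g)) &
    (forall gam, frobenius v iK gam ->
       weyl_image S chi (invmx g *m map_mx gam g) sg)].

Definition in_WI d (sg : 'S_d) : Prop :=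
  forall i, sg (rev_ord i) = rev_ord (sg i).

(* A negative cycle i_1 |-> ... |-> i_r |-> -i_1 of length r, with
   i_(a+1) = c^a(i_1): the first three conditions say that the |i_a| are
   nonzero and distinct. *)
Definition negative_cycle d (c : 'S_d) (r : nat) : Prop :=
  exists i1 : 'I_d,
  [/\ (0 < r)%N /\ rev_ord i1 != i1,
      (forall a b, (a < r)%N -> (b < r)%N ->
         iter a c i1 = iter b c i1 \/ iter a c i1 = rev_ord (iter b c i1) ->
         a = b),
      iter r c i1 = rev_ord i1,
      in_WI c &
      (forall x, (forall a, (a < r)%N ->
          x <> iter a c i1 /\ x <> rev_ord (iter a c i1)) -> c x = x)].

(* The cycles of sg on the nonzero indices are the c k.  The last condition
   says that none is missing: a nonzero index fixed by all of them would be a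
   positive cycle of length 1. *)
Definition negative_cycle_decomposition d (sg : 'S_d) j (c : 'I_j -> 'S_d)
    (r : 'I_j -> nat) : Prop :=
  [/\ sg = (\prod_k c k)%g,
      (forall k, negative_cycle (c k) (r k)),
      (forall k l, k != l -> forall x, c k x = x \/ c l x = x) &
      (forall x, rev_ord x != x -> exists k, c k x != x)].

(* Main.v *)
(* The element g of the stable class datum carries the characters chi_l of S to
   characters psi_l of T.  The automorphisms of Kbar over K which are a Frobenius
   or trivial on the residue field have K as common fixed field, so a Kbar-iso
   commuting with them is defined over K.  Such an automorphism gam maps psi_l to
   psi_(sigma^a l), composed with l |-> -l and inversion if gam moves E, where
   a = 1 or 0.  On the other side, the points of T_s over Kbar are the families
   (y_rho), rho in Gal(E_s/K) = <sigma_s> x <tau_s>, with y_rho y_(eta_s rho) = 1,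
   and gam permutes the coordinates by sigma_s^a, times tau_s if gam moves E: on
   K_s this holds modulo the maximal ideal, hence exactly as K_s / K is
   unramified.  If i0 lies in a negative cycle of length r, the orbit of i0 under
   sigma has s = 2r elements and sigma^r i0 = - i0, so that
   y_(sigma_s^b) = psi_(sigma^b i0) is compatible with both sides.  The index 0,
   for dim V odd, accounts for U_1(E/K) in the same way. *)

Require Import Defs.
From HB Require Import structures.
From mathcomp Require Import all_boot all_order all_algebra all_fingroup.
From mathcomp Require Import all_solvable all_field.
From mathcomp Require Import generic_quotient ring_quotient sesquilinear.
From mathcomp.multinomials Require Import mpoly.
From mathcomp Require boolp filter.
From mathcomp Require Import ring zify.

Set Implicit Arguments.
Unset Strict Implicit.
Unset Printing Implicit Defensive.

Import Order.TTheory GRing.Theory Num.Theory.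
Local Open Scope ring_scope.

(** * Hensel's lemma *)

(** The stable class datum constrains the cocycle only on inertia and on Frobenius elements, and
    [Kbar] is given without any Galois theory. That such automorphisms have fixed field K is
    therefore built from the ground up. Hensel's lemma shows that the integral closure of Z_p in
    [Kbar] is local; automorphisms of [Kbar] are glued from finite data by compactness;
    homomorphisms from the integers to the residue field are lifted to automorphisms. Inertia is
    defined through [Kur], while lifting controls only residues. The bridge is rigidity: two
    embeddings of an unramified extension that are congruent modulo the maximal ideal coincide.
    Rigidity also makes sigma_s and tau_s commute. Descent has its own obstacle: commuting with
    automorphisms is a property of functions on the group, whereas being defined over K asks for
    polynomials over K. Averaging over those conjugates of a polynomial that represent the same
    function settles it. *)

Section PadicAbs.
Context (p : nat) (p_prime : prime p) (Qp : fieldType) (v : padic_abs p Qp).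
Local Notation abs := (pabs v).
Local Notation eps := (p%:R^-1 : rat).

Lemma pabs0 : abs 0 = 0.
Proof. by apply/pabs_eq0. Qed.

Lemma pabs1 : abs 1 = 1.
Proof. by rewrite -[1]/(1%:R) pabs_nat // logn1 expr0 invr1. Qed.

Lemma pabsN x : abs (- x) = abs x.
Proof.
rewrite -mulN1r pabsM; suff -> : abs (-1) = 1 by rewrite mul1r.
apply/eqP; rewrite -(eqrXn2 (n := 2)) ?pabs_ge0 // expr1n expr2 -pabsM.
by rewrite mulrNN mulr1 pabs1.
Qed.

Lemma pabs_neq0 x : x != 0 -> 0 < abs x.
Proof.
move=> x0; rewrite lt_neqAle pabs_ge0 andbT eq_sym.
by apply: contraNneq x0 => /pabs_eq0 ->.
Qed.

Lemma pabsV x : abs x^-1 = (abs x)^-1.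
Proof.
have [->|x0] := eqVneq x 0; first by rewrite invr0 pabs0 invr0.
have := pabs_neq0 x0 => /lt0r_neq0 ax0; apply: (mulfI ax0).
by rewrite -pabsM !divff // pabs1.
Qed.

Lemma pabsD_le B x y : abs x <= B -> abs y <= B -> abs (x + y) <= B.
Proof.
by move=> hx hy; apply: le_trans (pabsD _ _ _) _; rewrite ge_max hx hy.
Qed.

Lemma pabsD_lt B x y : abs x < B -> abs y < B -> abs (x + y) < B.
Proof.
by move=> hx hy; apply: le_lt_trans (pabsD _ _ _) _; rewrite gt_max hx hy.
Qed.

Lemma pabs_sum_le B (I : Type) (s : seq I) (P : pred I) (F : I -> Qp) :
  0 <= B -> (forall i, P i -> abs (F i) <= B) ->
  abs (\sum_(i <- s | P i) F i) <= B.
Proof.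
move=> B0 h; elim/big_rec: _ => [|i x Pi hx]; first by rewrite pabs0.
exact: pabsD_le (h _ Pi) hx.
Qed.

Lemma eps_gt0 : 0 < eps.
Proof. by rewrite invr_gt0 ltr0n prime_gt0. Qed.

Lemma eps_lt1 : eps < 1.
Proof. by rewrite invf_lt1 ?ltr1n ?prime_gt1 // ltr0n prime_gt0. Qed.

Lemma epsX_small (e : rat) : 0 < e -> exists k, eps ^+ k < e.
Proof.
move=> e0; have [k hk] : exists k : nat, e^-1 < k%:R.
  by exists (Num.bound e^-1); rewrite archi_boundP // invr_ge0 ltW.
exists k; rewrite exprVn invf_plt ?posrE ?exprn_gt0 ?ltr0n ?prime_gt0 //.
apply: (lt_trans hk); rewrite -natrX ltr_nat.
exact: ltn_expl (prime_gt1 p_prime).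
Qed.

Lemma pabs_eps : abs p%:R = eps.
Proof. by rewrite pabs_nat ?prime_gt0 // logn_prime // eqxx expr1. Qed.

Lemma pabs_int (m : int) : m != 0 -> abs m%:~R = eps ^+ logn p `|m|.
Proof.
move=> m0; rewrite exprVn -(pabs_nat v); last by rewrite absz_gt0.
by case: (intP m) m0 => // n _; rewrite ?mulrNz ?pabsN abszN.
Qed.

Lemma padic_char0 : has_char0 Qp.
Proof.
move=> n; rewrite !inE; apply/negbTE/negP => /andP[n_pr /eqP n0].
have := pabs_nat v (prime_gt0 n_pr); rewrite n0 pabs0 => /esym/eqP.
by rewrite invr_eq0 expf_eq0 pnatr_eq0 (gtn_eqF (prime_gt0 p_prime)) andbF.
Qed.

(** A rational close enough to x has the same absolute value, and nonzero rationals have powers of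
    [eps] as absolute values. *)
Lemma pabs_discrete x : abs x < 1 -> abs x <= eps.
Proof.
have [->|x0 x1] := eqVneq x 0; first by rewrite pabs0 ltW ?eps_gt0.
have [a ha] := pabs_dense v x (pabs_neq0 x0).
have Ea : abs (ratr a) = abs x.
  apply/le_anti/andP; split.
    by rewrite -(subrKC x (ratr a)) -opprB pabsD_le // pabsN ltW.
  rewrite leNgt; apply/negP => hlt.
  by have := pabsD_lt ha hlt; rewrite subrK ltxx.
have a0 : a != 0.
  by apply: contraTneq (pabs_neq0 x0) => a0; rewrite -Ea a0 /ratr (numq_int 0) mul0r pabs0 ltxx.
move: x1; rewrite -Ea /ratr pabsM pabsV !pabs_int ?denq_neq0 ?numq_eq0 //.
set i := logn _ _; set j := logn _ _.
have ee := eps_gt0; rewrite ltr_pdivrMr ?exprn_gt0 // mul1r => hij.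
have lt_ji : (j < i)%N.
  rewrite ltnNge; apply/negP => le_ij; move: hij; apply/negP; rewrite -leNgt.
  by apply: ler_wiXn2l => //; apply: ltW => //; apply: eps_lt1.
rewrite ler_pdivrMr ?exprn_gt0 // -exprS.
by apply: ler_wiXn2l => //; apply: ltW => //; apply: eps_lt1.
Qed.

Lemma eps_pow0 x (k0 : nat) : (forall k, (k0 <= k)%N -> abs x <= eps ^+ k) -> x = 0.
Proof.
move=> h; apply/eqP/negPn/negP => x0.
have [k hk] := epsX_small (pabs_neq0 x0).
have := lt_le_trans hk (h (maxn k k0) (leq_maxr _ _)); apply/negP.
rewrite -leNgt; apply: ler_wiXn2l (leq_maxl _ _).
  by rewrite ltW ?eps_gt0.
by rewrite ltW ?eps_lt1.
Qed.

(** A bound on the Gauss norm, which is ultrametric and submultiplicative. *)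
Definition pbound (B : rat) (P : {poly Qp}) := forall k, abs P`_k <= B.

Lemma pbound_ge0 B P : pbound B P -> 0 <= B.
Proof. by move/(_ 0%N); apply: le_trans (pabs_ge0 _ _). Qed.

Lemma pboundD B P Q : pbound B P -> pbound B Q -> pbound B (P + Q).
Proof. by move=> hP hQ k; rewrite coefD pabsD_le. Qed.

Lemma pboundN B P : pbound B P -> pbound B (- P).
Proof. by move=> hP k; rewrite coefN pabsN. Qed.

Lemma pboundB B P Q : pbound B P -> pbound B Q -> pbound B (P - Q).
Proof. by move=> hP hQ; apply: pboundD => //; apply: pboundN. Qed.

Lemma pboundW A B P : A <= B -> pbound A P -> pbound B P.
Proof. by move=> AB hP k; apply: le_trans AB. Qed.

Lemma pboundM A B P Q : pbound A P -> pbound B Q -> pbound (A * B) (P * Q).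
Proof.
move=> hP hQ k; have A0 := pbound_ge0 hP; have B0 := pbound_ge0 hQ.
rewrite coefM pabs_sum_le ?mulr_ge0 // => i _.
by rewrite pabsM ler_pM ?pabs_ge0.
Qed.

(** Each step of the long division by a monic g subtracts g times a monomial whose coefficient is
    the current leading one; nothing is inverted, so the Gauss norm never grows. *)
Lemma pbound_divp B g P : g \is monic -> pbound 1 g -> pbound B P ->
  pbound B (P %/ g) /\ pbound B (P %% g).
Proof.
move=> gm hg hP; have B0 := pbound_ge0 hP; have g0 := monic_neq0 gm.
suff [q [r [Pqr szr hq hr]]] : exists q r,
    [/\ P = q * g + r, (size r < size g)%N, pbound B q & pbound B r].
  by have [<- <-] := divp_modpP Pqr szr.
have hc (Q : {poly Qp}) : pbound B Q -> pbound B (lead_coef Q *: 'X^(size Q - size g)).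
  move=> hQ k; rewrite coefZ coefXn pabsM.
  case: eqP => _; rewrite ?pabs1 ?pabs0 ?mulr1 ?mulr0 //; exact: hQ.
have [n] := ubnP (size P); elim: n => // n IHn in P hP *; rewrite ltnS => szP.
have [small|big] := ltnP (size P) (size g).
  exists 0, P; rewrite mul0r add0r; split=> // k.
  by rewrite coef0 pabs0.
set c := lead_coef P *: 'X^(size P - size g).
have [||q [r [E sr hq hr]]] := IHn (P - c * g).
- by apply: pboundB => //; rewrite -[B]mulr1; apply: pboundM => //; apply: hc.
- apply: leq_trans szP.
  have P0 : P != 0 by rewrite -size_poly_gt0 (leq_trans _ big) // size_poly_gt0.
  have lP0 : lead_coef P != 0 by rewrite lead_coef_eq0.
  have sg0 : (0 < size g)%N by rewrite size_poly_gt0.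
  have szcg : size (c * g) = size P.
    rewrite size_Mmonic ?scaler_eq0 ?(negPf lP0) ?polyXn_eq0 //.
      by rewrite size_scale // size_polyXn; lia.
    by rewrite -size_poly_eq0 size_polyXn.
  rewrite -[in X in (_ < X)%N](prednK (n := size P)) ?size_poly_gt0 // ltnS.
  apply/leq_sizeP => k; rewrite leq_eqVlt => /predU1P[<-|hk].
    rewrite coefB -lead_coefE; apply/eqP; rewrite subr_eq0; apply/eqP.
    by rewrite -szcg -lead_coefE lead_coefM lead_coefZ lead_coefXn (monicP gm) !mulr1.
  have hk' : (size P <= k)%N by lia.
  by rewrite coefB !nth_default ?subrr ?szcg.
exists (c + q), r; rewrite mulrDl -addrA -E addrC subrK; split=> //.
by apply: pboundD => //; apply: hc.
Qed.

(** The sizes being bounded, the limit is taken coefficientwise; the ultrametric inequality carries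
    the estimate on consecutive terms to the limit without loss. *)
Lemma pbound_limit (u : nat -> {poly Qp}) s :
  (forall k, (size (u k) <= s)%N) ->
  (forall k, pbound (eps ^+ k.+1) (u k.+1 - u k)) ->
  exists2 P : {poly Qp}, (size P <= s)%N &
    forall k, pbound (eps ^+ k.+1) (P - u k).
Proof.
move=> hs hu.
have e0 := eps_gt0; have e1 := eps_lt1.
have huv k m : (k <= m)%N -> pbound (eps ^+ k.+1) (u m - u k).
  elim: m => [|m IHm]; first by rewrite leqn0 => /eqP-> i; rewrite subrr coef0 pabs0 exprn_ge0 // ltW.
  rewrite leq_eqVlt => /predU1P[->|].
    by move=> i; rewrite subrr coef0 pabs0 exprn_ge0 // ltW.
  rewrite ltnS => km; rewrite -(subrKA (u m)); apply: pboundD; last exact: IHm.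
  by apply: pboundW (hu m); apply: ler_wiXn2l; rewrite ?ltW.
have lim i : exists l, forall k, abs (l - (u k)`_i) <= eps ^+ k.+1.
  have [|l hl] := @pabs_complete _ _ v (fun k => (u k)`_i).
    move=> e /epsX_small[k hk]; exists k => m n km kn.
    apply: le_lt_trans hk; rewrite -(subrKA (u k)`_i) pabsD_le //.
      rewrite -coefB; apply: le_trans (huv _ _ km i) _.
      by apply: ler_wiXn2l; rewrite ?ltW.
    rewrite -opprB pabsN -coefB; apply: le_trans (huv _ _ kn i) _.
    by apply: ler_wiXn2l; rewrite ?ltW.
  exists l => k; have ek0 : 0 < eps ^+ k.+1 by rewrite exprn_gt0.
  have [n0 hn0] := hl _ ek0; pose m := maxn n0 k.
  rewrite -(subrKA (u m)`_i) pabsD_le //.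
    by rewrite -opprB pabsN ltW // hn0 // leq_maxl.
  by rewrite -coefB huv // leq_maxr.
have [l hl] := boolp.choice lim.
exists (\poly_(i < s) l i); first exact: size_poly.
move=> k i; rewrite coefB coef_poly; case: ltnP => // si.
by rewrite nth_default ?subr0 ?pabs0 ?exprn_ge0 ?ltW // (leq_trans (hs k)).
Qed.

(* Writing f = (g0 + r) (1 + q) with g0 the truncation of f in degree <= e, the
   pair (q, r) is a fixed point of (q, r) |-> divmod (f - g0 - r q) by g0, a
   contraction since q and r are divisible by p. *)
Lemma hensel_factor (f : {poly Qp}) e :
  pbound 1 f -> f`_e = 1 -> (e < size f)%N ->
  (forall k, (e < k)%N -> abs f`_k < 1) ->
  exists g h : {poly Qp}, [/\ f = g * h, size g = e.+1 & (size h <= size f - e)%N].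
Proof.
move=> hf fe ef hk; have e0 := eps_gt0; have e1 := eps_lt1.
pose g0 := take_poly e.+1 f.
have szg0 : size g0 = e.+1.
  apply/eqP; rewrite eqn_leq size_take_poly /= ltnNge; apply/negP => /leq_sizeP/(_ e (leqnn _)).
  by rewrite coef_take_poly ltnSn fe => /eqP; rewrite oner_eq0.
have g0m : g0 \is monic.
  by rewrite monicE lead_coefE szg0 coef_take_poly ltnSn fe.
have hg0 : pbound 1 g0.
  by move=> k; rewrite coef_take_poly; case: ifP => _ //; rewrite pabs0.
have hfg : pbound eps (f - g0).
  move=> k; rewrite coefB coef_take_poly ltnS; case: leqP => ke.
    by rewrite subrr pabs0 ltW.
  by rewrite subr0 pabs_discrete // hk.
pose step (s : {poly Qp} * {poly Qp}) := let P := f - g0 - s.2 * s.1 in (P %/ g0, P %% g0).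
pose st k := iter k step (0, 0).
have st_b k : pbound eps (st k).1 /\ pbound eps (st k).2.
  elim: k => [|k [h1 h2]]; first by split=> i; rewrite coef0 pabs0 ltW.
  apply: pbound_divp => //; apply: pboundB => //.
  apply: (@pboundW (eps * eps)); last exact: pboundM.
  by rewrite ler_piMl ?ltW.
have st_s k : (size (st k).1 <= size f - e)%N /\ (size (st k).2 <= e)%N.
  elim: k => [|k [h1 h2]]; first by rewrite size_poly0.
  have szP : (size (f - g0 - (st k).2 * (st k).1)%R <= size f)%N.
    rewrite (leq_trans (size_polyD _ _)) // geq_max size_polyN; apply/andP; split.
      by rewrite (leq_trans (size_polyD _ _)) // geq_max size_polyN leqnn szg0.
    rewrite (leq_trans (size_polyMleq _ _)) // (leq_trans (leq_pred _)) //.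
    by rewrite -(subnKC (ltnW ef)) leq_add.
  split; rewrite /= -/(st k).
    by rewrite size_divp ?monic_neq0 // szg0 /= leq_sub2r.
  by rewrite -ltnS -szg0 ltn_modp monic_neq0.
have step_d m (a b : {poly Qp} * {poly Qp}) : pbound eps a.2 -> pbound eps b.1 ->
    pbound (eps ^+ m) (a.1 - b.1) -> pbound (eps ^+ m) (a.2 - b.2) ->
    pbound (eps ^+ m.+1) ((step a).1 - (step b).1) /\
    pbound (eps ^+ m.+1) ((step a).2 - (step b).2).
  move=> ha hb h1 h2; rewrite -!(divpN, modpN) -!(divpD, modpD).
  set P := (P in P %/ _).
  suff hP : pbound (eps ^+ m.+1) P by apply: pbound_divp.
  have -> : P = - (a.2 * (a.1 - b.1) + (a.2 - b.2) * b.1) by rewrite /P; ring.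
  apply: pboundN; apply: pboundD; first by rewrite exprS; apply: pboundM.
  by rewrite exprSr; apply: pboundM.
have st_d k : pbound (eps ^+ k.+1) ((st k.+1).1 - (st k).1) /\
              pbound (eps ^+ k.+1) ((st k.+1).2 - (st k).2).
  elim: k => [|k [h1 h2]]; first by rewrite !subr0 expr1; apply: (st_b 1%N).
  exact: step_d (st_b k.+1).2 (st_b k).1 h1 h2.
have [q szq hq] := pbound_limit (fun k => (st_s k).1) (fun k => (st_d k).1).
have [r szr hr] := pbound_limit (fun k => (st_s k).2) (fun k => (st_d k).2).
exists (g0 + r), (1 + q); split.
- apply/eqP; rewrite eq_sym -subr_eq0; apply/eqP/polyP => i; rewrite coef0.
  apply: (@eps_pow0 _ 2) => -[|[|k]] // _; move: i.
  have E : (st k.+1).1 * g0 + (st k.+1).2 = f - g0 - (st k).2 * (st k).1 by rewrite -divp_eq.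
  have hqb : pbound eps q by have := hq 0%N; rewrite subr0 expr1.
  (* The error is at most eps^(k+2): the first two terms measure the distance of q and r to stage
     k+1, and the quadratic ones, at stage k only, gain a factor eps from q or from r_k. *)
  have -> : (g0 + r) * (1 + q) - f = (q - (st k.+1).1) * g0 + (r - (st k.+1).2)
     + ((r - (st k).2) * q + (st k).2 * (q - (st k).1)).
    move: E; set A := st k.+1; set B := st k => E.
    have -> : f = A.1 * g0 + A.2 + g0 + B.2 * B.1 by rewrite E; ring.
    by ring.
  apply: pboundD; first apply: pboundD => //.
    by rewrite -[eps ^+ _]mulr1; apply: pboundM.
  apply: pboundD.
    by rewrite exprSr; apply: pboundM.
  by rewrite exprS; apply: pboundM => //; case: (st_b k).
- rewrite size_polyDl // szg0 ltnS //.
- rewrite (leq_trans (size_polyD _ _)) // geq_max szq size_poly1 subn_gt0 ef //.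
Qed.
End PadicAbs.

(** * The valuation ring of an algebraic extension of Q_p *)

Section ValuationTransport.
Context (p : nat) (Qp : fieldType) (v : padic_abs p Qp) (K : fieldExtType Qp).
Context (F F' : fieldType) (i : K -> F) (i' : K -> F') (u : {rmorphism F -> F'}).
Hypothesis ui : forall c, u (i c) = i' c.

Lemma vring_mor x : vring v i x <-> vring v i' (u x).
Proof.
suff E (P : {poly Qp}) : root (map_poly (fun c : Qp => i c%:A) P) x =
    root (map_poly (fun c : Qp => i' c%:A) P) (u x).
  by split=> -[P hP hr]; exists P => //; rewrite ?E // -E.
rewrite -(fmorph_root u); congr root; apply/polyP => k.
rewrite coef_map /=; have [h|h] := ltnP k (size P).
  by rewrite !coef_poly h ui.
by rewrite !coef_poly ltnNge h /= rmorph0.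
Qed.

Lemma vmax_mor x : vmax v i x <-> vmax v i' (u x).
Proof.
rewrite /vmax -vring_mor -fmorphV -vring_mor.
split=> -[hx [x0|xV]]; split=> //; [left|right|left|right] => //.
  by rewrite x0 rmorph0.
by apply/eqP; rewrite -(fmorph_eq0 u); apply/eqP.
Qed.

End ValuationTransport.

Section Zp.
Context (p : nat) (Qp : fieldType) (v : padic_abs p Qp).

Definition Zp_pred : {pred Qp} := [pred x | pabs v x <= 1].

Fact Zp_subring_closed : subring_closed Zp_pred.
Proof.
split=> [|x y|x y]; rewrite !inE; first by rewrite pabs1.
  by move=> hx hy; rewrite pabsD_le // pabsN.
by move=> hx hy; rewrite pabsM mulr_ile1 ?pabs_ge0.
Qed.

HB.instance Definition _ := GRing.isSubringClosed.Build Qp Zp_pred Zp_subring_closed.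

Record Zp_int := ZpInt { Zp_val :> Qp; _ : Zp_val \in Zp_pred }.
HB.instance Definition _ := [isSub for Zp_val].
HB.instance Definition _ := [Choice of Zp_int by <:].
HB.instance Definition _ := [SubChoice_isSubComNzRing of Zp_int by <:].

End Zp.

Section ValuationRing.
Context (p : nat) (p_prime : prime p) (Qp : fieldType) (v : padic_abs p Qp).
Context (K : fieldExtType Qp) (C : closedFieldType) (iK : {rmorphism K -> C}).
Hypothesis C_alg : forall x : C, algebraicOver iK x.

Local Notation abs := (pabs v).
Local Notation eps := (p%:R^-1 : rat).
Local Notation vr := (vring v iK).
Local Notation vm := (vmax v iK).

Definition Qp_emb : Qp -> C := fun c => iK c%:A.

Fact Qp_emb_zmod : zmod_morphism Qp_emb.
Proof. by move=> x y; rewrite /Qp_emb scalerBl rmorphB. Qed.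
Fact Qp_emb_monoid : monoid_morphism Qp_emb.
Proof. by split=> [|x y]; rewrite /Qp_emb ?scale1r ?rmorph1 // -rmorphM mulr_algl scalerA. Qed.
HB.instance Definition _ := GRing.isZmodMorphism.Build Qp C Qp_emb Qp_emb_zmod.
HB.instance Definition _ := GRing.isMonoidMorphism.Build Qp C Qp_emb Qp_emb_monoid.

Lemma alg_over_Qp x : algebraicOver Qp_emb x.
Proof.
have [P P0 rP] := C_alg x.
suff: integralOver Qp_emb x by case=> Q Qm rQ; exists Q => //; apply: monic_neq0.
apply: (@integral_root _ _ Qp_emb (map_poly iK P)) => //; first by rewrite map_poly_eq0.
move=> y /(nthP 0)[k _ <-]; rewrite coef_map /=.
have [Q Qm rQ] := alg_integral (P`_k : K); exists Q => //.
rewrite -(fmorph_root iK) in rQ; congr (is_true (root _ _)): rQ.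
by rewrite -map_poly_comp.
Qed.

(** Over the ring type [Zp_int] the bound on coefficients becomes integrality, so that the closure
    properties of integral elements apply. *)
Lemma vringP x : vr x <-> integralOver (Qp_emb \o val : {rmorphism Zp_int v -> C}) x.
Proof.
split=> [[P [Pm hP] rP]|[Q Qm rQ]].
  pose Q : {poly Zp_int v} := \poly_(i < size P) insubd 0 P`_i.
  have E : map_poly val Q = P.
    apply/polyP => k; rewrite coef_map coef_poly; case: ltnP => hk /=.
      by rewrite insubdK // inE hP.
    by rewrite nth_default.
  exists Q; last by rewrite map_poly_comp E.
  apply/monicP; apply: val_inj; rewrite -lead_coef_map_inj //; last exact: val_inj.
  by rewrite /= E (monicP Pm).
exists (map_poly val Q); first split.
- exact: monic_map.
- by move=> k; rewrite coef_map /=; have := valP Q`_k; rewrite inE.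
- by move: rQ; rewrite map_poly_comp.
Qed.

Lemma vringD x y : vr x -> vr y -> vr (x + y).
Proof. by rewrite !vringP; apply: integral_add. Qed.
Lemma vringN x : vr x -> vr (- x).
Proof. by rewrite !vringP; apply: integral_opp. Qed.
Lemma vringB x y : vr x -> vr y -> vr (x - y).
Proof. by rewrite !vringP; apply: integral_sub. Qed.
Lemma vringM x y : vr x -> vr y -> vr (x * y).
Proof. by rewrite !vringP; apply: integral_mul. Qed.
Lemma vring0 : vr 0.
Proof. by rewrite !vringP; apply: integral0. Qed.
Lemma vring1 : vr 1.
Proof. by rewrite !vringP; apply: integral1. Qed.
Lemma vringX n x : vr x -> vr (x ^+ n).
Proof. by move=> hx; elim: n => [|n IH]; [apply: vring1 | rewrite exprS; apply: vringM]. Qed.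
Lemma vring_nat n : vr n%:R.
Proof. by rewrite vringP; apply: integral_nat. Qed.
Lemma vringMn n x : vr x -> vr (x *+ n).
Proof. by move=> hx; rewrite -mulr_natr; apply: vringM (vring_nat n). Qed.
Lemma vring_sum (I : Type) (s : seq I) (P : pred I) (f : I -> C) :
  (forall i, P i -> vr (f i)) -> vr (\sum_(i <- s | P i) f i).
Proof. by move=> h; elim/big_ind: _ => //; [apply: vring0 | apply: vringD]. Qed.

Lemma p_neq0 : p%:R != 0 :> C.
Proof.
have := padic_char0 p_prime v p; rewrite !inE p_prime /= => /negbT.
by apply: contra; rewrite -(rmorph_nat Qp_emb) fmorph_eq0.
Qed.

(** Z_p is integrally closed: if |c| > 1, the leading term of a monic integral equation for c
    dominates all the others. *)
Lemma vring_Qp (c : Qp) : vr (Qp_emb c) <-> abs c <= 1.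
Proof.
split=> [[P [Pm hP] rP]|hc]; last first.
  exists ('X - c%:P); last first.
    by rewrite (_ : map_poly _ _ = 'X - (Qp_emb c)%:P) ?root_XsubC // -[RHS]map_polyXsubC.
  split=> [|k]; first exact: monicXsubC.
  rewrite coefB coefX coefC pabsD_le ?pabsN //; case: eqP => _; rewrite ?pabs0 ?pabs1 //.
have {rP} : root P c by rewrite -(fmorph_root Qp_emb).
move=> /rootP; rewrite horner_coef; set n := size P.
have n0 : (0 < n)%N by rewrite size_poly_gt0 monic_neq0.
rewrite -(prednK n0) big_ord_recr /= -lead_coefE (monicP Pm) mul1r => /eqP.
rewrite addrC addr_eq0 => /eqP E; rewrite leNgt; apply/negP => c1.
set m := n.-1 in E; have absX k : abs (c ^+ k) = abs c ^+ k.
  by elim: k => [|k IH]; rewrite ?pabs1 // !exprS pabsM IH.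
have c0 : 0 < abs c by apply: lt_trans c1.
have [m0|m0] := posnP m.
  by move: E; rewrite m0 big_ord0 expr0 oppr0 => /eqP; rewrite oner_eq0.
have : abs (c ^+ m) <= abs c ^+ m.-1.
  rewrite E pabsN pabs_sum_le ?exprn_ge0 ?ltW // => k _; rewrite pabsM absX.
  rewrite -[leRHS]mul1r ler_pM ?pabs_ge0 ?exprn_ge0 ?pabs_ge0 //.
  by apply: (ler_weXn2l (ltW c1)); have := ltn_ord k; lia.
by rewrite absX -[X in _ ^+ X <= _](prednK m0) exprS -ler_pdivlMr ?exprn_gt0 // divff ?lt0r_neq0 ?exprn_gt0 // leNgt c1.
Qed.

Lemma pV_not_vring : ~ vr p%:R^-1.
Proof.
rewrite -(rmorph_nat Qp_emb) -fmorphV vring_Qp pabsV pabs_eps // invrK.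
by rewrite leNgt ltr1n prime_gt1.
Qed.

(** Once f is divided by this coefficient, e is its degree modulo p; choosing the last index of
    maximal absolute value gives the strict inequalities that [hensel_factor] wants beyond e. *)
Lemma last_argmax (f : {poly Qp}) : f != 0 -> exists e,
  [/\ (e < size f)%N, f`_e != 0, forall k, abs f`_k <= abs f`_e
    & forall k, (e < k)%N -> abs f`_k < abs f`_e].
Proof.
move=> f0; have sf : (0 < size f)%N by rewrite size_poly_gt0.
pose i0 : 'I_(size f) := Ordinal sf; pose F (i : 'I_(size f)) := abs f`_i.
case: (@arg_maxP _ rat 'I_(size f) i0 xpredT F) => // m _ hm.
case: (@arg_maxnP _ m (fun i => F i == F m) (fun i => i : nat)) => [|e /eqP he hmax].
  exact: eqxx.
have hk k : abs f`_k <= F e.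
  case: (ltnP k (size f)) => hk; last by rewrite nth_default // pabs0 pabs_ge0.
  by rewrite he; apply: (hm (Ordinal hk)).
have fe0 : f`_e != 0.
  apply: contra_neq f0 => e0; apply/polyP => k; rewrite coef0; apply/eqP.
  apply: contraT => /(pabs_neq0 v); rewrite ltNge => /negP[].
  by apply: le_trans (hk k) _; rewrite /F e0 pabs0.
exists e; split=> // k ek.
rewrite lt_neqAle hk andbT; apply/negP => /eqP E.
case: (ltnP k (size f)) => hks; last first.
  by have := pabs_neq0 v fe0; rewrite -E nth_default // pabs0 ltxx.
have := hmax (Ordinal hks); rewrite {1}/F /= E -/(F e) he eqxx => /(_ isT).
by rewrite leqNgt ek.
Qed.

(* Newton polygon dichotomy: by [hensel_factor] the coefficients of maximal
   absolute value of a minimal polynomial cannot end strictly inside it. *)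
Lemma vring_alt x : x != 0 -> vr x \/
  exists P : {poly Qp}, [/\ P \is monic, root (map_poly Qp_emb P) x^-1,
    forall k, (k < (size P).-1)%N -> abs P`_k <= eps &
    forall Q, Q != 0 -> root (map_poly Qp_emb Q) x -> (size P <= size Q)%N].
Proof.
move=> x0.
pose kills n := boolp.asbool (exists Q : {poly Qp},
   [/\ Q != 0, root (map_poly Qp_emb Q) x & size Q = n]).
have ex : exists n, kills n.
  have [Q Q0 rQ] := alg_over_Qp x; exists (size Q).
  by apply/boolp.asboolP; exists Q.
case: (ex_minnP ex) => n /boolp.asboolP[f [f0 rf szf]] min.
have {min ex} min Q : Q != 0 -> root (map_poly Qp_emb Q) x -> (size f <= size Q)%N.
  by move=> Q0 rQ; rewrite szf; apply: min; apply/boolp.asboolP; exists Q.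
have [e [ef fe0 hle hlt]] := last_argmax f0.
pose g := (f`_e)^-1 *: f.
have afe := pabs_neq0 v fe0.
have szg : size g = size f by rewrite size_scale // invr_eq0.
have ge : g`_e = 1 by rewrite coefZ mulVf.
have hg k : abs g`_k <= 1.
  by rewrite coefZ pabsM pabsV mulrC ler_pdivrMr // mul1r.
have hglt k : (e < k)%N -> abs g`_k < 1.
  by move=> ek; rewrite coefZ pabsM pabsV mulrC ltr_pdivrMr // mul1r hlt.
have rg : root (map_poly Qp_emb g) x.
  by rewrite linearZ /= rootZ ?fmorph_eq0 ?invr_eq0.
have [e1|e1] := eqVneq e (size f).-1.
  left; exists g => //; split=> //.
  by rewrite monicE lead_coefE szg -e1 ge.
right; have [e0|e0] := posnP e; last first.
  have [|g1 [h1 [E sg1 sh1]]] := @hensel_factor _ p_prime _ v g e hg ge _ hglt.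
    by rewrite szg.
  have g10 : g1 != 0 by rewrite -size_poly_gt0 sg1.
  have h10 : h1 != 0.
    by apply/eqP => h10; move/eqP: ge; rewrite E h10 mulr0 coef0 eq_sym oner_eq0.
  move: rg; rewrite E rmorphM rootM => /orP[r1|r1].
    by have := min _ g10 r1; rewrite sg1; move: e1 ef; lia.
  by have := min _ h10 r1; move: sh1; rewrite szg; move: e0 ef; lia.
(* Here e = 0. The reversed polynomial vanishes at x^-1 and is monic since g_0 = 1; its other
   coefficients have absolute value less than 1, hence at most [eps]. *)
exists (\poly_(i < size f) g`_((size f).-1 - i)).
have sP : size (\poly_(i < size f) g`_((size f).-1 - i)) = size f.
  by rewrite size_poly_eq // subnn -e0 ge oner_eq0.
have sf0 : (0 < size f)%N by rewrite size_poly_gt0.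
split.
- rewrite monicE lead_coefE sP coef_poly prednK // leqnn subnn -e0 ge //.
- rewrite /root horner_coef size_map_poly sP.
  suff -> : \sum_(i < size f) (map_poly Qp_emb (\poly_(i < size f) g`_((size f).-1 - i)))`_i * x^-1 ^+ i
     = x ^- (size f).-1 * (map_poly Qp_emb g).[x].
    by rewrite (rootP rg) mulr0.
  rewrite horner_coef size_map_poly szg mulr_sumr (reindex_inj rev_ord_inj) /=.
  apply: eq_bigr => i _; have hi := ltn_ord i.
  rewrite !coef_map /= coef_poly ifT; last by lia.
  rewrite mulrCA; congr (Qp_emb g`_ _ * _).
    have aux a b : (b < a -> a.-1 - (a - b.+1) = b)%N by lia.
    exact: aux.
  have aux a b : (b < a -> a.-1 = a - b.+1 + b)%N by lia.
  by rewrite exprVn (aux _ _ hi) exprD invfM -mulrA mulVf ?expf_neq0 // mulr1.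
- move=> k; rewrite sP => hk; rewrite coef_poly; case: ltnP => [_|]; last by lia.
  by apply: pabs_discrete => //; apply: hglt; lia.
- by move=> Q Q0 rQ; rewrite sP; apply: min.
Qed.

(** The equation writes x^n, with n the degree of P, as a combination of lower powers of x with
    coefficients divisible by p. *)
Lemma eps_monic_pow (P : {poly Qp}) x : P \is monic -> root (map_poly Qp_emb P) x ->
  (forall k, (k < (size P).-1)%N -> abs P`_k <= eps) -> vr x ->
  vr (x ^+ (size P).-1 / p%:R).
Proof.
move=> Pm rP hP hx; move/rootP: rP; rewrite horner_coef size_map_poly.
have n0 : (0 < size P)%N by rewrite size_poly_gt0 monic_neq0.
rewrite -(prednK n0) big_ord_recr /= coef_map /= -lead_coefE (monicP Pm) rmorph1 mul1r.
move/eqP; rewrite addrC addr_eq0 => /eqP ->.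
rewrite mulNr mulr_suml; apply: vringN; apply: vring_sum => k _.
rewrite mulrAC; apply: vringM (vringX _ hx).
rewrite coef_map -(rmorph_nat Qp_emb) -fmorph_div vring_Qp pabsM pabsV pabs_eps //.
have e0 := eps_gt0 p_prime; rewrite ler_pdivrMr // mul1r hP //.
Qed.

(** The maximal ideal is the radical of p: if x is a nonzero nonunit, x^-1 is not integral, and
    [vring_alt] gives x an equation to which [eps_monic_pow] applies. From this form, unlike from
    the definition by inverses, stability under addition follows by the binomial formula. *)
Lemma vmaxP x : vr x -> (vm x <-> exists d, vr (x ^+ d / p%:R)).
Proof.
move=> hx; split=> [[_ [->|hV]]|[d hd]].
- by exists 1%N; rewrite expr1 mul0r; apply: vring0.
- have x0 : x != 0 by apply/eqP => E; apply: hV; rewrite E invr0; apply: vring0.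
  case: (@vring_alt x^-1); rewrite ?invr_eq0 // invrK => -[P [Pm rP hP _]].
  by exists (size P).-1; apply: eps_monic_pow.
split=> //; have [->|x0] := eqVneq x 0; first by left.
right=> hV; apply: pV_not_vring.
have -> : p%:R^-1 = (x ^+ d / p%:R) * x^-1 ^+ d by rewrite exprVn mulrAC divff ?mul1r ?expf_neq0.
exact: vringM hd (vringX _ hV).
Qed.

Lemma vmax_vring x : vm x -> vr x. Proof. by case. Qed.

Lemma vmax0 : vm 0.
Proof. by split; [apply: vring0 | left]. Qed.

Lemma vmax1 : ~ vm 1.
Proof.
case=> _ [/eqP|]; first by rewrite oner_eq0.
by rewrite invr1; apply; apply: vring1.
Qed.

Lemma vmaxD x y : vm x -> vm y -> vm (x + y).
Proof.
move=> mx my; have [hx hy] := (vmax_vring mx, vmax_vring my).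
have [d hd] := (vmaxP hx).1 mx; have [e he] := (vmaxP hy).1 my.
apply/vmaxP; first exact: vringD.
exists (d + e)%N; rewrite exprDn mulr_suml; apply: vring_sum => i _.
rewrite mulrnAl; apply: vringMn.
have [hi|hi] := leqP e i.
  rewrite -mulrA -[in y ^+ _](subnK hi) exprD -mulrA; apply: vringM; first exact: vringX.
  by apply: vringM; first exact: vringX.
rewrite mulrAC; apply: vringM; last exact: vringX.
have -> : (d + e - i = (e - i) + d)%N by lia.
by rewrite exprD -mulrA; apply: vringM => //; apply: vringX.
Qed.

Lemma vmaxM x y : vm x -> vr y -> vm (x * y).
Proof.
move=> mx hy; have hx := vmax_vring mx; have [d hd] := (vmaxP hx).1 mx.
apply/vmaxP; first exact: vringM.
by exists d; rewrite exprMn mulrAC; apply: vringM => //; apply: vringX.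
Qed.

Lemma vmaxN x : vm x -> vm (- x).
Proof. by move=> hx; rewrite -mulrN1; apply: vmaxM => //; apply: vringN; apply: vring1. Qed.

Lemma vmaxB x y : vm x -> vm y -> vm (x - y).
Proof. by move=> hx hy; apply: vmaxD => //; apply: vmaxN. Qed.

Lemma vmax_unit x : vr x -> ~ vm x -> x != 0 /\ vr x^-1.
Proof.
move=> hx nm; have x0 : x != 0 by apply/eqP => E; apply: nm; rewrite E; apply: vmax0.
split=> //; apply: boolp.contrapT => nV; apply: nm; split=> //; right=> //.
Qed.

(* The exponent is [K : Q_p]. *)
Lemma vmax_base_pow : exists n, forall a : K, vm (iK a) -> vr (iK a ^+ n / p%:R).
Proof.
exists (\dim {:K}) => a ma; have ha := vmax_vring ma.
have [->|a0] := eqVneq (iK a) 0.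
  rewrite expr0n (_ : (_ == _) = false) ?mul0r; first exact: vring0.
  by apply/negbTE; rewrite -lt0n adim_gt0.
case: (@vring_alt (iK a)^-1); rewrite ?invr_eq0 // ?invrK.
  by move=> aV; case: ma => _ [/eqP|//]; rewrite (negPf a0).
move=> [P [Pm rP hP szP]].
have le : ((size P).-1 <= \dim {:K})%N.
  have /polyOver1P[Q EQ] := minPolyOver 1%AS a^-1.
  have Q0 : Q != 0 by rewrite -(map_poly_eq0 (in_alg K)) -EQ monic_neq0 // monic_minPoly.
  have rQ : root (map_poly Qp_emb Q) (iK a)^-1.
    rewrite -fmorphV (_ : map_poly _ _ = map_poly iK (map_poly (in_alg K) Q)).
      by rewrite fmorph_root -EQ root_minPoly.
    by rewrite -map_poly_comp.
  have := szP Q Q0 rQ; rewrite -(size_map_poly (in_alg K) Q) -EQ size_minPoly.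
  have : (adjoin_degree 1%AS a^-1 <= \dim {:K})%N.
    rewrite /adjoin_degree dimv1 divn1 prednK ?adim_gt0 // dimvS ?subvf //.
  by lia.
rewrite -(subnK le) exprD -mulrA; apply: vringM; first exact: vringX.
exact: eps_monic_pow.
Qed.

End ValuationRing.

(** * Automorphisms of the algebraic closure *)

Section AbsoluteGalois.
Context (F : fieldType) (C : closedFieldType) (iF : {rmorphism F -> C}).
Hypothesis F_alg : forall x : C, algebraicOver iF x.

Definition fixes_base (gam : C -> C) := forall c, gam (iF c) = iF c.

Lemma poly_roots (P : {poly C}) : P != 0 -> exists r : seq C, forall x, root P x -> x \in r.
Proof.
move=> P0; have [r Er] := closed_field_poly_normal P; exists r => x.
by rewrite {1}Er rootZ ?lead_coef_eq0 // root_prod_XsubC.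
Qed.

Lemma conjugates_ex x : exists r : seq C, forall y,
  (forall P : {poly F}, root (map_poly iF P) x -> root (map_poly iF P) y) -> y \in r.
Proof.
have [P P0 rP] := F_alg x.
have [|r hr] := @poly_roots (map_poly iF P); first by rewrite map_poly_eq0.
by exists r => y hy; apply: hr; apply: hy.
Qed.

(** The axioms of an automorphism over F as far as they can be tested inside s. [pauto_root]
    confines each image to finitely many conjugates, the source of compactness. *)
Record partial_auto (s : seq C) (f : C -> C) : Prop := PartialAuto {
  pauto1 : 1 \in s -> f 1 = 1;
  pautoB : forall x y, x \in s -> y \in s -> x - y \in s -> f (x - y) = f x - f y;
  pautoM : forall x y, x \in s -> y \in s -> x * y \in s -> f (x * y) = f x * f y;
  pauto_base : forall c, iF c \in s -> f (iF c) = iF c;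
  pauto_root : forall x (P : {poly F}), x \in s ->
    root (map_poly iF P) x -> root (map_poly iF P) (f x)
}.

Lemma ultra_finite_range (T : Type) (U : classical_sets.set_system T)
    (UF : filter.UltraFilter U) (g : T -> C) (r : seq C) (A : T -> Prop) :
  U A -> (forall t, A t -> g t \in r) -> exists y, U (fun t => g t = y).
Proof.
elim: r A => [|a r IHr] A UA Ar.
  by have [t /Ar] := filter.filter_ex UA; rewrite in_nil.
have [Ua|Ua] := filter.in_ultra_setVsetC (fun t => g t = a) UF; first by exists a.
apply: (IHr _ (filter.filterI UA Ua)) => t [/Ar]; rewrite in_cons.
by case: eqP => // ga _ nga; case: nga.
Qed.

(* An ultrafilter on the finite subsets glues the partial automorphisms: each x
   has finitely many possible images. *)
Lemma auto_compactness (Pr : C -> C -> Prop) :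
  (forall s : seq C, exists2 f, partial_auto s f & forall x, x \in s -> Pr x (f x)) ->
  exists2 gam : {rmorphism C -> C}, fixes_base gam & forall x, Pr x (gam x).
Proof.
move=> /(_ _)/boolp.cid2-/all_sig2[f hf hPr].
pose Fil : classical_sets.set_system (seq C) :=
  fun A => exists s0 : seq C, forall s, {subset s0 <= s} -> A s.
have FilP : filter.ProperFilter Fil.
  apply: filter.Build_ProperFilter; first by case=> s0 /(_ s0); apply.
  split.
  - by exists [::].
  - move=> A B [sA hA] [sB hB]; exists (sA ++ sB) => s hs; split.
      by apply: hA => x hx; apply: hs; rewrite mem_cat hx.
    by apply: hB => x hx; apply: hs; rewrite mem_cat hx orbT.
  - by move=> A B AB [s0 h]; exists s0 => s /h/AB.
have [U [UU FU]] := filter.ultraFilterLemma FilP.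
have in_U x : U (fun s => x \in s).
  by apply: FU; exists [:: x] => s; apply; rewrite mem_head.
have lim x : exists y, U (fun s => f s x = y).
  have [r hr] := conjugates_ex x.
  apply: (ultra_finite_range UU (in_U x) (r := r)) => s xs.
  by apply: hr => P; apply: (pauto_root (hf s)).
have [g hg] := boolp.choice lim.
have ex (A : seq C -> Prop) : U A -> exists s, A s by move/filter.filter_ex.
have gB : zmod_morphism g.
  move=> x y.
  have [s [[[[[xs ys] xys] gx] gy] gxy]] := ex _ (filter.filterI (filter.filterI (filter.filterI
    (filter.filterI (filter.filterI (in_U x) (in_U y)) (in_U (x - y))) (hg x)) (hg y)) (hg (x - y))).
  by rewrite -gx -gy -gxy (pautoB (hf s)).
have gM : monoid_morphism g.
  split=> [|x y].
    by have [s [s1 <-]] := ex _ (filter.filterI (in_U 1) (hg 1)); apply: (pauto1 (hf s)).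
  have [s [[[[[xs ys] xys] gx] gy] gxy]] := ex _ (filter.filterI (filter.filterI (filter.filterI
    (filter.filterI (filter.filterI (in_U x) (in_U y)) (in_U (x * y))) (hg x)) (hg y)) (hg (x * y))).
  by rewrite -gx -gy -gxy (pautoM (hf s)).
pose gZ := GRing.isZmodMorphism.Build C C g gB.
pose gMM := GRing.isMonoidMorphism.Build C C g gM.
pose gam : {rmorphism C -> C} := HB.pack g gZ gMM.
exists gam => [c|x] /=.
  have [s [sc <-]] := ex _ (filter.filterI (in_U (iF c)) (hg (iF c))).
  exact: (pauto_base (hf s)).
have [s [sx <-]] := ex _ (filter.filterI (in_U x) (hg x)).
exact: hPr.
Qed.

Lemma auto_partial (s : seq C) (gam : {rmorphism C -> C}) :
  fixes_base gam -> partial_auto s gam.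
Proof.
move=> hg; split=> [_|x y _ _ _|x y _ _ _|c _|x P _ rP].
- exact: rmorph1.
- exact: rmorphB.
- exact: rmorphM.
- exact: hg.
suff -> : map_poly iF P = map_poly gam (map_poly iF P) by rewrite fmorph_root.
by rewrite -map_poly_comp; apply: eq_map_poly => c /=; rewrite hg.
Qed.

(** Surjectivity comes from finiteness: the conjugates of y form a finite set, which the injective
    map gam sends into itself. *)
Lemma auto_bij (gam : {rmorphism C -> C}) : fixes_base gam -> bijective gam.
Proof.
move=> hg; have surj y : exists x, gam x == y.
  have [r0 hr0] := conjugates_ex y.
  pose r := undup [seq z <- r0 | boolp.asbool (forall P : {poly F},
     root (map_poly iF P) y -> root (map_poly iF P) z)].
  have rP z : z \in r <-> forall P : {poly F}, root (map_poly iF P) y -> root (map_poly iF P) z.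
    rewrite mem_undup mem_filter; split; first by case/andP => /boolp.asboolP.
    by move=> h; rewrite hr0 // andbT; apply/boolp.asboolP.
  have sub : {subset map gam r <= r}.
    move=> _ /mapP[z /rP hz ->]; apply/rP => P /hz rPz.
    exact: (pauto_root (auto_partial [:: z] hg)) (mem_head _ _) rPz.
  have um : uniq (map gam r) by rewrite map_inj_uniq ?undup_uniq //; apply: fmorph_inj.
  have [_ E] := uniq_min_size um sub (eq_leq (esym (size_map _ _))).
  have : y \in r by apply/rP.
  by rewrite -E => /mapP[x _ ->]; exists x.
exists (fun y => xchoose (surj y)) => [x|y]; last exact/eqP/(xchooseP (surj y)).
by apply: (fmorph_inj gam); apply/eqP/(xchooseP (surj _)).
Qed.

(** Conjugates of a whole tuple, not of its entries separately: one automorphism acts on all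
    coefficients of a polynomial at once, so that products and averages over the orbit are Galois
    invariant. *)
Lemma conj_list (s : seq C) : exists2 Z : seq (seq C), uniq Z &
  forall t, t \in Z <-> exists2 gam : {rmorphism C -> C}, fixes_base gam & t = map gam s.
Proof.
have [Z0 hZ0] : exists Z0 : seq (seq C), forall gam : {rmorphism C -> C},
    fixes_base gam -> map gam s \in Z0.
  elim: s => [|x s [Z0 hZ0]]; first by exists [:: [::]].
  have [r hr] := conjugates_ex x.
  exists [seq y :: l | y <- r, l <- Z0] => gam hg /=.
  apply: allpairs_f; last exact: hZ0.
  by apply: hr => P; apply: (pauto_root (auto_partial [:: x] hg)) (mem_head _ _).
exists (undup [seq t <- Z0 | boolp.asbool (exists2 gam : {rmorphism C -> C}, fixes_base gam & t = map gam s)]).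
  exact: undup_uniq.
move=> t; rewrite mem_undup mem_filter; split; first by case/andP => /boolp.asboolP.
move=> h; apply/andP; split; first exact/boolp.asboolP.
by case: h => gam hg ->; apply: hZ0.
Qed.

Hypothesis char0 : has_char0 F.

Lemma PET_seq (s : seq C) : exists z, forall x, x \in s ->
  exists P : {poly F}, x = (map_poly iF P).[z].
Proof.
elim: s => [|y s [z0 hz0]]; first by exists 0.
have [P P0 rP] := F_alg y; have [Q Q0 rQ] := F_alg z0.
have [n [[a ha] [b hb]]] := pchar0_PET P0 rP Q0 rQ char0.
exists (z0 *+ n - y) => x; rewrite in_cons => /predU1P[->|/hz0[R ->]]; first by exists a.
by exists (R \Po b); rewrite map_comp_poly horner_comp hb.
Qed.

Lemma minpoly_ex z : exists P : {poly F}, [/\ P != 0, root (map_poly iF P) z,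
  forall Q : {poly F}, root (map_poly iF Q) z -> P %| Q & separable_poly P].
Proof.
pose kills n := boolp.asbool (exists Q : {poly F},
   [/\ Q != 0, root (map_poly iF Q) z & size Q = n]).
have ex : exists n, kills n.
  have [Q Q0 rQ] := F_alg z; exists (size Q).
  by apply/boolp.asboolP; exists Q.
case: (ex_minnP ex) => n /boolp.asboolP[P [P0 rP szP]] min.
have {ex} min Q : Q != 0 -> root (map_poly iF Q) z -> (size P <= size Q)%N.
  by move=> Q0 rQ; rewrite szP; apply: min; apply/boolp.asboolP; exists Q.
have dvd Q : root (map_poly iF Q) z -> P %| Q.
  move=> rQ; apply: contraT => nPQ.
  have : (size P <= size (Q %% P)%R)%N.
    apply: min => //; rewrite (divp_eq Q P) rmorphD rmorphM /= in rQ.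
    by move: rQ; rewrite /root hornerD hornerM (rootP rP) mulr0 add0r.
  by rewrite leqNgt ltn_modp P0.
exists P; split=> //; rewrite unlock.
have := dvdp_gcdl P P^`(); set g := gcdp _ _ => /dvdpP[h Ph].
have sP : (1 < size P)%N.
  rewrite ltnNge; apply/negP => /size1_polyC E; move: rP P0; rewrite E map_polyC /=.
  by rewrite rootC fmorph_eq0 polyC_eq0 => ->.
have h0 : h != 0 by apply: contra_neq P0; rewrite Ph => ->; rewrite mul0r.
have g0 : g != 0 by apply: contra_neq P0; rewrite Ph => ->; rewrite mulr0.
have : root (map_poly iF h) z || root (map_poly iF g) z.
  by rewrite -rootM -rmorphM -Ph.
case/orP=> r1.
  have := min _ h0 r1; rewrite {1}Ph size_mul // /coprimep -/g.
  rewrite -size_poly_gt0 in h0; rewrite -size_poly_gt0 in g0.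
  have aux a b : (0 < a -> 0 < b -> (a + b).-1 <= a -> b == 1)%N by lia.
  exact: aux.
have d0 : P^`() = 0.
  apply/eqP; apply: contraT => d0.
  have := dvdp_leq d0 (dvdp_trans (dvd _ r1) (dvdp_gcdr P P^`())).
  by rewrite leqNgt lt_size_deriv.
have : P^`()`_(size P).-2 = 0 by rewrite d0 coef0.
rewrite coef_deriv -mulr_natr => /eqP; rewrite mulf_eq0.
have -> : ((size P).-2.+1 = (size P).-1)%N by case: (size P) sP => [|[]].
rewrite -lead_coefE lead_coef_eq0 (negPf P0) /=.
move: (char0); rewrite pcharf0P => ->; move: sP; by case: (size P) => [|[]].
Qed.

(** If x is outside F, compactness yields an automorphism moving it. On a finite s, take a primitive
    element z for x and s, and send z to another root z' of its minimal polynomial, chosen so that x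
    moves. *)
Lemma fixed_in_base x :
  (forall gam : {rmorphism C -> C}, fixes_base gam -> gam x = x) -> exists c, x = iF c.
Proof.
move=> fx; apply: boolp.contrapT => nx.
suff [gam hg /(_ x)/(_ erefl)] : exists2 gam : {rmorphism C -> C},
    fixes_base gam & forall u, u = x -> gam u <> x by rewrite fx.
apply: (auto_compactness (Pr := fun u w => u = x -> w <> x)) => s.
have [z hz] := PET_seq (x :: s).
have [px Ex] := hz x (mem_head _ _).
have [P [P0 rP dvd sepP]] := minpoly_ex z.
have [r Er] := closed_field_poly_normal (map_poly iF P).
have rootr y : y \in r = root (map_poly iF P) y.
  by rewrite {1}Er rootZ ?lead_coef_eq0 ?map_poly_eq0 // root_prod_XsubC.
have ur : uniq r.
  rewrite -(separable_prod_XsubC r).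
  move: sepP; rewrite -(separable_map iF) Er.
  by rewrite (eqp_separable (q := \prod_(z <- r) ('X - z%:P))) // eqp_scale // lead_coef_eq0 map_poly_eq0.
(* If px took the value x at all roots of P, then px mod P minus the constant x would have more
   roots than its degree allows, hence vanish, and x would be a coefficient from F. *)
have [z' rz' nz'] : exists2 z', z' \in r & (map_poly iF px).[z'] != x.
  apply: boolp.contrapT => nz'; apply: nx.
  pose Q := px %% P.
  have EQ y : y \in r -> (map_poly iF Q).[y] = (map_poly iF px).[y].
    rewrite rootr => ry; rewrite [in RHS](divp_eq px P) rmorphD rmorphM /= hornerD hornerM.
    by rewrite (rootP ry) mulr0 add0r.
  have szP : size P = (size r).+1.
    rewrite -(size_map_poly iF) Er size_scale ?lead_coef_eq0 ?map_poly_eq0 //.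
    exact: size_prod_XsubC.
  have Q0 : map_poly iF Q - x%:P = 0.
    apply/eqP; apply: contraT => n0.
    have : (size r < size (map_poly iF Q - x%:P)%R)%N.
      apply: max_poly_roots => //; apply/allP => y ry.
      rewrite /root !hornerE EQ // subr_eq0; apply: contraT => ny.
      by case: nz'; exists y.
    have szQ : (size Q <= size r)%N by rewrite -ltnS -szP ltn_modp.
    have r0 : (0 < size r)%N.
      have : z \in r by rewrite rootr.
      by case: (r).
    rewrite ltnNge (leq_trans (size_polyD _ _)) // geq_max size_map_poly szQ size_polyN.
    by rewrite (leq_trans (size_polyC_leq1 _)).
  exists Q`_0; have := congr1 (fun R : {poly C} => R`_0) Q0.
  by rewrite coefB coef_map coefC coef0 /= => /eqP; rewrite subr_eq0 => /eqP.
have conj (Q : {poly F}) : root (map_poly iF Q) z -> root (map_poly iF Q) z'.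
  move=> /dvd PQ; rewrite rootr in rz'.
  by apply: root_dvdp rz'; rewrite ?dvdp_map // map_poly_eq0.
have ex u : exists w, u \in s -> exists2 Q : {poly F}, u = (map_poly iF Q).[z] & w = (map_poly iF Q).[z'].
  have [us|nus] := boolP (u \in s); last by exists 0.
  have [Q ->] := hz u (mem_behead (s := x :: s) us).
  by exists (map_poly iF Q).[z']; exists Q.
have [f hf] := boolp.choice ex.
have E u (Q : {poly F}) : u \in s -> u = (map_poly iF Q).[z] -> f u = (map_poly iF Q).[z'].
  move=> /hf[R -> ->] EQ; apply/eqP; rewrite -subr_eq0 -hornerN -hornerD -rmorphB.
  by apply: conj; rewrite /root rmorphB hornerD hornerN EQ subrr.
have hrep u : u \in s -> exists Q : {poly F}, u = (map_poly iF Q).[z].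
  by case/hf=> Q; exists Q.
exists f; first split.
- by move=> s1; rewrite (E 1 1) // rmorph1 hornerC.
- move=> a b sa sb sab; have [[A EA] [B EB]] := (hrep a sa, hrep b sb).
  rewrite (E _ _ sa EA) (E _ _ sb EB) (E _ (A - B)) // rmorphB hornerD hornerN //.
  by rewrite -EA -EB.
- move=> a b sa sb sab; have [[A EA] [B EB]] := (hrep a sa, hrep b sb).
  rewrite (E _ _ sa EA) (E _ _ sb EB) (E _ (A * B)) // rmorphM hornerM //.
  by rewrite -EA -EB.
- by move=> c sc; rewrite (E _ c%:P) // map_polyC hornerC.
- move=> a Q sa rQ; have [A EA] := hrep a sa.
  rewrite (E _ _ sa EA) /root -horner_comp -map_comp_poly; apply: conj.
  by rewrite /root map_comp_poly horner_comp -EA.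
by move=> u us ux; rewrite (E u px us (etrans ux Ex)); apply/eqP.
Qed.

End AbsoluteGalois.

(** * Residue fields, fixed fields and finite subrings *)

Lemma residue_field_ex (R : comNzRingType) (I : pred R) :
  0 \in I -> 1 \notin I -> (forall x y, x \in I -> y \in I -> x - y \in I) ->
  (forall a x, x \in I -> a * x \in I) ->
  (forall x, x \notin I -> exists y, x * y - 1 \in I) ->
  exists (k : fieldType) (red : {rmorphism R -> k}),
    forall x, (red x == 0) = (x \in I).
Proof.
move=> I0 I1 IB IM Imax.
have idc : ring_quotient.idealr_closed I.
  by split=> // a x y hx hy; rewrite -[y]opprK IB ?IM // -sub0r IB.
pose J : ring_quotient.Idealr.type R := HB.pack I (ring_quotient.isIdealr.Build R I idc).
pose Q : comNzRingType := {ideal_quot J}.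
pose pi : R -> Q := (\pi_{ideal_quot J})%qT.
have piE x y : (pi x == pi y) = (x - y \in I).
  by rewrite /pi -ring_quotient.Quotient.idealrBE.
have piB : zmod_morphism pi by move=> x y; rewrite /pi rmorphB.
have piM : monoid_morphism pi by split=> [|x y]; rewrite /pi ?rmorph1 ?rmorphM.
have surj (q : Q) : exists x, q = pi x.
  by exists (generic_quotient.repr q); rewrite /pi generic_quotient.reprK.
have pi0 x : (pi x == 0) = (x \in I).
  by rewrite -[x in RHS]subr0 -piE; have := piB 0 0; rewrite !subrr => ->.
have inv_ex (q : Q) : exists r : Q, q != 0 -> r * q = 1.
  have [x ->] := surj q; have [xI|/Imax[y hy]] := boolP (x \in I).
    by exists 0; rewrite pi0 xI.
  exists (pi y) => _; rewrite -piM.2 -piM.1; apply/eqP.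
  by rewrite piE mulrC.
have [inv0 hinv0] := boolp.choice inv_ex.
pose inv q := if q == 0 then 0 else inv0 q.
have invV (q : Q) : q != 0 -> inv q * q = 1.
  by move=> q0; rewrite /inv (negPf q0) hinv0.
have inv00 : inv 0 = 0 by rewrite /inv eqxx.
pose k : fieldType := HB.pack Q (GRing.ComNzRing_isField.Build Q invV inv00).
pose red : {rmorphism R -> k} := HB.pack (pi : R -> k)
  (GRing.isZmodMorphism.Build R k pi piB) (GRing.isMonoidMorphism.Build R k pi piM).
by exists k, red.
Qed.

Section FixedField.
Context (C : fieldType) (G : {rmorphism C -> C} -> Prop).

Definition fixed_pred : {pred C} :=
  fun x => boolp.asbool (forall gam, G gam -> gam x = x).

Lemma fixed_predP x : x \in fixed_pred <-> forall gam, G gam -> gam x = x.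
Proof. by split=> [/boolp.asboolP|/boolp.asboolP]. Qed.

Fact fixed_divring_closed : divring_closed fixed_pred.
Proof.
split=> [|x y /fixed_predP hx /fixed_predP hy|x y /fixed_predP hx /fixed_predP hy];
  apply/fixed_predP => gam hg.
- exact: rmorph1.
- by rewrite rmorphB hx ?hy.
- by rewrite fmorph_div hx ?hy.
Qed.

HB.instance Definition _ := GRing.isDivringClosed.Build C fixed_pred fixed_divring_closed.

(** A field type in its own right, so that [residue_lift] can be applied over the fixed field in
    place of K, as [frob_inertia_fixed] does. *)
Record fixed_field := FixedField { fixed_val :> C; _ : fixed_val \in fixed_pred }.
HB.instance Definition _ := [isSub for fixed_val].
HB.instance Definition _ := [Choice of fixed_field by <:].
HB.instance Definition _ := [SubChoice_isSubComUnitRing of fixed_field by <:].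
HB.instance Definition _ := [SubComUnitRing_isSubIntegralDomain of fixed_field by <:].
HB.instance Definition _ := [SubIntegralDomain_isSubField of fixed_field by <:].

End FixedField.

Lemma rmorph_inverse (C : fieldType) (gam : {rmorphism C -> C}) :
  bijective gam -> exists del : {rmorphism C -> C}, cancel gam del /\ cancel del gam.
Proof.
case=> g gamK Kgam.
pose del : {rmorphism C -> C} := HB.pack g
  (GRing.isZmodMorphism.Build C C g (can2_zmod_morphism gamK Kgam))
  (GRing.isMonoidMorphism.Build C C g (can2_monoid_morphism gamK Kgam)).
by exists del.
Qed.

(* A finite subring [ks] of a domain: the polynomial X^q - X is invariant under
   the translations by [ks], which makes the power map q additive. *)
Section FiniteSubring.
Context (k : fieldType) (ks : seq k).
Hypotheses (ks_uniq : uniq ks) (ks1 : 1 \in ks)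
  (ksB : forall x y, x \in ks -> y \in ks -> x - y \in ks)
  (ksM : forall x y, x \in ks -> y \in ks -> x * y \in ks).
Local Notation q := (size ks).

Lemma finite_subring_perm (f : k -> k) (s : seq k) : uniq s -> injective f ->
  (forall x, x \in s -> f x \in s) -> perm_eq (map f s) s.
Proof.
move=> us fi fs; apply: uniq_perm; rewrite ?map_inj_uniq //.
apply: (uniq_min_size _ _ (eq_leq (esym (size_map _ _)))).2.
  by rewrite map_inj_uniq.
by move=> _ /mapP[x xs ->]; apply: fs.
Qed.

Lemma finite_subring_size : (1 < q)%N.
Proof.
apply: (@uniq_leq_size _ [:: 0; 1]); first by rewrite /= inE eq_sym oner_eq0.
by move=> x; rewrite !inE => /orP[]/eqP-> //; rewrite -(subrr 1) ksB.
Qed.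

Lemma finite_subring_expr c : c \in ks -> c ^+ q = c.
Proof.
move=> hc; have q1 := finite_subring_size.
have [->|c0] := eqVneq c 0; first by rewrite expr0n; case: (q) q1.
pose s := [seq x <- ks | x != 0].
have us : uniq s by rewrite filter_uniq.
have ps : perm_eq (map ( *%R c) s) s.
  apply: finite_subring_perm => //; first exact: mulfI.
  by move=> x; rewrite !mem_filter mulf_eq0 negb_or c0 => /andP[-> /=]; apply: ksM.
have szs : q = (size s).+1.
  have p0 : perm_eq ks (0 :: s).
    apply: uniq_perm => //; first by rewrite /= us mem_filter eqxx.
    move=> x; rewrite inE mem_filter; case: eqVneq => //= ->.
    by rewrite -(subrr 1) ksB.
  by rewrite (perm_size p0).
have := perm_big _ ps (op := *%R) (x := 1) (P := xpredT) (F := id).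
rewrite big_map /= big_split /= big_const_seq count_predT iter_mulr_1.
rewrite -[RHS]mul1r => /mulIf E; rewrite szs exprSr E ?mul1r //.
by rewrite prodf_seq_neq0; apply/allP => x; rewrite mem_filter => /andP[].
Qed.

Lemma finite_subring_prod (y : k) : y ^+ q - y = \prod_(c <- ks) (y - c).
Proof.
have q1 := finite_subring_size.
have szP : size ('X^q - 'X : {poly k}) = q.+1.
  by rewrite size_polyDl size_polyXn // size_polyN size_polyX ltnS.
have /(congr1 (horner^~ y)) : 'X^q - 'X = \prod_(c <- ks) ('X - c%:P) :> {poly k}.
  rewrite [LHS](@all_roots_prod_XsubC _ _ ks) //.
  - rewrite lead_coefDl ?lead_coefXn ?scale1r // size_polyN size_polyX size_polyXn //.
  - apply/allP => c hc; rewrite /root !hornerE finite_subring_expr // subrr //.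
  - by rewrite uniq_rootsE.
by rewrite !hornerE horner_prod => ->; apply: eq_bigr => c _; rewrite !hornerE.
Qed.

Lemma finite_subring_mem (y : k) : y ^+ q = y -> y \in ks.
Proof.
move/eqP; rewrite -subr_eq0 finite_subring_prod prodf_seq_eq0 => /hasP[c hc].
by rewrite subr_eq0 => /eqP->.
Qed.

Lemma finite_subring_transl (y c : k) : c \in ks -> (y + c) ^+ q = y ^+ q + c.
Proof.
move=> hc; suff E : (y + c) ^+ q - (y + c) = y ^+ q - y.
  by rewrite -[LHS](subrK (y + c)) E addrA subrK.
have ps : perm_eq (map (fun d => d - c) ks) ks.
  apply: finite_subring_perm => //; first exact: addIr.
  by move=> x hx; apply: ksB.
rewrite !finite_subring_prod -[RHS](perm_big _ ps) big_map /=.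
by apply: eq_bigr => d _; rewrite opprB addrA.
Qed.

(** The polynomial (X + y)^q - X^q - y^q has degree less than q and vanishes on the q elements of
    [ks], by [finite_subring_transl]. *)
Lemma finite_subring_exprD (x y : k) : (x + y) ^+ q = x ^+ q + y ^+ q.
Proof.
have q1 := finite_subring_size.
pose G : {poly k} := ('X + y%:P) ^+ q - 'X^q - (y ^+ q)%:P.
suff G0 : G = 0.
  have := congr1 (horner^~ x) G0; rewrite /G !hornerE.
  by move/eqP; rewrite -addrA -opprD subr_eq0 => /eqP.
apply/eqP; apply: contraT => G0.
have mon : ('X + y%:P) ^+ q \is monic.
  by rewrite monic_exp // -[y]opprK polyCN monicXsubC.
have szm : size (('X + y%:P) ^+ q) = q.+1.
  by rewrite -[y]opprK polyCN size_exp_XsubC.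
have szG : (size G <= q)%N.
  apply/leq_sizeP => i; rewrite leq_eqVlt => /predU1P[<-|hi].
    rewrite !coefB coefXn eqxx coefC (gtn_eqF (ltnW q1)) subr0.
    by move: mon; rewrite monicE lead_coefE szm => /eqP ->; rewrite subrr.
  rewrite !coefB coefXn coefC (gtn_eqF hi) (gtn_eqF (leq_ltn_trans _ hi)) //.
  by rewrite nth_default ?szm // !subr0.
suff hr : all (root G) ks by have := max_poly_roots G0 hr ks_uniq; rewrite ltnNge szG.
apply/allP => c hc; rewrite /root /G !hornerE.
by rewrite [c + y]addrC finite_subring_transl // (finite_subring_expr hc) addrK subrr.
Qed.

(** Translation by -1 permutes [ks], so subtracting q from the sum of its elements does not change
    it. *)
Lemma finite_subring_char : q%:R = 0 :> k.
Proof.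
have ps : perm_eq (map (fun d => d - 1) ks) ks.
  apply: finite_subring_perm => //; first exact: addIr.
  by move=> x hx; apply: ksB.
have := perm_big _ ps (op := +%R) (x := 0) (P := xpredT) (F := id).
rewrite big_map /= big_split /= big_const_seq count_predT iter_addr_0.
by rewrite -[RHS]addr0 => /addrI/eqP; rewrite mulNrn oppr_eq0 => /eqP.
Qed.

End FiniteSubring.

(** * Residue fields, Frobenius and inertia *)

Section ResidueField.
Context (p : nat) (p_prime : prime p) (Qp : fieldType) (v : padic_abs p Qp).
Context (K : fieldExtType Qp) (C : closedFieldType) (iK : {rmorphism K -> C}).
Hypothesis C_alg : forall x : C, algebraicOver iK x.

Local Notation vr := (vring v iK).
Local Notation vm := (vmax v iK).

Definition vring_pred : {pred C} := fun x => boolp.asbool (vr x).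

Fact vring_subring_closed : subring_closed vring_pred.
Proof.
split=> [|x y /boolp.asboolP hx /boolp.asboolP hy|x y /boolp.asboolP hx /boolp.asboolP hy];
  apply/boolp.asboolP.
- exact: vring1.
- exact: vringB.
- exact: vringM.
Qed.

HB.instance Definition _ := GRing.isSubringClosed.Build C vring_pred vring_subring_closed.

Record vint := VInt { vint_val :> C; _ : vint_val \in vring_pred }.
HB.instance Definition _ := [isSub for vint_val].
HB.instance Definition _ := [Choice of vint by <:].
HB.instance Definition _ := [SubChoice_isSubComNzRing of vint by <:].

HB.instance Definition _ := GRing.isZmodMorphism.Build vint C vint_val (rmorphB (val : {rmorphism vint -> C})).
HB.instance Definition _ := GRing.isMonoidMorphism.Build vint C vint_val
  (rmorph1 (val : {rmorphism vint -> C}), rmorphM (val : {rmorphism vint -> C})).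

Lemma vintP (x : vint) : vr (val x).
Proof. by apply/boolp.asboolP/(valP x). Qed.

Lemma vint_ex x : vr x -> exists y : vint, val y = x.
Proof. by move=> /boolp.asboolP hx; exists (VInt hx). Qed.

Lemma vring_auto (gam : {rmorphism C -> C}) x :
  fixes_base iK gam -> vr x <-> vr (gam x).
Proof. by move=> hg; apply: vring_mor. Qed.

Lemma vmax_auto (gam : {rmorphism C -> C}) x :
  fixes_base iK gam -> vm x <-> vm (gam x).
Proof. by move=> hg; apply: vmax_mor. Qed.

Lemma residue_map_ex : exists (k : fieldType) (red : {rmorphism vint -> k}),
  forall x, red x = 0 <-> vm (val x).
Proof.
pose I : pred vint := fun x => boolp.asbool (vm (val x)).
have IP x : (x \in I) <-> vm (val x) by split=> /boolp.asboolP.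
have [|||a x|x nx|k [red hred]] := @residue_field_ex vint I.
- by apply/IP; apply: vmax0.
- by apply/negP => /IP /vmax1; apply.
- by move=> x y /IP hx /IP hy; apply/IP; rewrite rmorphB; apply: vmaxB.
- by move=> /IP hx; apply/IP; rewrite rmorphM mulrC; apply: vmaxM => //; apply: vintP.
- have nm : ~ vm (val x) by move/IP; apply/negP.
  have [x0 /vint_ex[y Ey]] := vmax_unit (vintP x) nm.
  exists y; apply/IP; rewrite rmorphB rmorphM rmorph1 /= Ey divff // subrr.
  exact: vmax0.
by exists k, red => x; rewrite -IP -hred; split=> /eqP.
Qed.

Section Lift.
Context (F : fieldType) (iF : {rmorphism F -> C}).
Hypotheses (F_alg : forall x : C, algebraicOver iF x) (char0 : has_char0 F).
Hypothesis KF : forall c : K, exists c' : F, iK c = iF c'.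
Context (k : fieldType) (red u : {rmorphism vint -> k}).
Hypothesis red_u : forall x : vint, (exists c, val x = iF c) -> u x = red x.

Lemma fixes_baseW (gam : {rmorphism C -> C}) : fixes_base iF gam -> fixes_base iK gam.
Proof. by move=> hg c; have [c' ->] := KF c. Qed.

(* Expanding the product W of the X - sum_i t_i Y^i over the conjugates t of a
   finite tuple s of integers, its coefficients lie in F, so u and the
   reduction agree on W, and one of its factors vanishes at u(s). *)
Lemma residue_lift_finite (s : seq vint) :
  exists2 gam : {rmorphism C -> C}, fixes_base iF gam &
    exists2 t : seq vint, map val t = map gam (map val s) & map red t = map u s.
Proof.
have [Z uZ hZ] := conj_list F_alg (map val s).
pose lift (t : seq C) : seq vint := map (insubd 0) t.
have liftK t : t \in Z -> map val (lift t) = t.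
  move=> /hZ[gam hg ->]; rewrite -map_comp map_id_in // => y /mapP[z /mapP[x _ ->] ->] /=.
  by rewrite insubdK //; apply/boolp.asboolP; exact: (vring_auto _ (fixes_baseW hg)).1 (vintP x).
pose W : {poly {poly vint}} := \prod_(t <- Z) ('X - (Poly (lift t))%:P).
have EW : map_poly (map_poly val) W = \prod_(t <- Z) ('X - (Poly t)%:P) :> {poly {poly C}}.
  rewrite rmorph_prod; apply: eq_big_seq => t tZ.
  by rewrite rmorphB /= map_polyX map_polyC /= map_Poly liftK.
have coefW i j : exists c, val (W`_i)`_j = iF c.
  apply: (fixed_in_base F_alg char0) => gam hg.
  have -> : val (W`_i)`_j = ((map_poly (map_poly val) W)`_i)`_j :> C.
    by rewrite coef_map /= coef_map.
  rewrite EW; set V := \prod_(t <- Z) _.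
  suff {2}<- : map_poly (map_poly gam) V = V by rewrite coef_map /= coef_map.
  rewrite /V rmorph_prod.
  have ps : perm_eq (map (map gam) Z) Z.
    apply: uniq_perm; rewrite ?map_inj_uniq //; try exact/inj_map/fmorph_inj.
    apply: (uniq_min_size _ _ (eq_leq (esym (size_map _ _)))).2.
      by rewrite map_inj_uniq //; apply/inj_map/fmorph_inj.
    move=> _ /mapP[t /hZ[del hd ->] ->]; apply/hZ.
    by exists (gam \o del : {rmorphism C -> C}); [move=> c /=; rewrite hd hg | rewrite -map_comp].
  rewrite -[RHS](perm_big _ ps) big_map; apply: eq_bigr => t _.
  by rewrite rmorphB /= map_polyX map_polyC /= map_Poly.
have EuW : map_poly (map_poly u) W = map_poly (map_poly red) W.
  by apply/polyP => i; rewrite !coef_map /=; apply/polyP => j; rewrite !coef_map /= red_u.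
have sZ : map val s \in Z.
  by apply/hZ; exists (idfun : {rmorphism C -> C}); rewrite ?map_id.
have W0 : W.[Poly s] = 0.
  rewrite horner_prod; apply/eqP; rewrite (big_rem _ sZ) /= !hornerE.
  suff -> : lift (map val s) = s by rewrite subrr mul0r.
  by rewrite /lift -map_comp map_id_in // => x _; apply: valKd.
have := congr1 (map_poly u) W0; rewrite -horner_map /= EuW rmorph0 map_Poly.
rewrite rmorph_prod horner_prod => /eqP; rewrite prodf_seq_eq0 => /hasP[t tZ] /=.
rewrite rmorphB /= map_polyX map_polyC /= map_Poly !hornerE subr_eq0 => /eqP E.
have [gam hg Et] := (hZ t).1 tZ.
exists gam => //; exists (lift t); first by rewrite liftK.
have sz : size (map red (lift t)) = size (map u s).
  by rewrite !size_map Et !size_map.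
apply: (@eq_from_nth _ 0) => // i hi.
by have := congr1 (fun P : {poly k} => P`_i) E; rewrite !coef_Poly => ->.
Qed.

(** Compactness glues the finite lifts. Over K, with u the q-th power of the reduction, this yields
    a Frobenius; over a fixed field, with u the residue action of an arbitrary automorphism, it
    yields one with the same residue action that fixes that field. *)
Lemma residue_lift : exists2 gam : {rmorphism C -> C}, fixes_base iF gam &
  forall x y : vint, val y = gam (val x) -> red y = u x.
Proof.
suff [gam hg hP] : exists2 gam : {rmorphism C -> C}, fixes_base iF gam &
    forall a, forall x y : vint, val x = a -> val y = gam a -> red y = u x.
  by exists gam => // x y; apply: hP.
apply: (auto_compactness F_alg
  (Pr := fun a b => forall x y : vint, val x = a -> val y = b -> red y = u x)) => s.
pose s' : seq vint := pmap insub s.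
have [gam hg [t Et Eu]] := residue_lift_finite s'.
exists gam; first exact: auto_partial.
move=> a as_ x y xa ya.
have xs : x \in s' by rewrite mem_pmap_sub xa.
have hi : (index x s' < size s')%N by rewrite index_mem.
have szt : size t = size s' by rewrite -(size_map val t) Et !size_map.
have Ey : y = nth 0 t (index x s').
  apply: val_inj; rewrite ya -(nth_map 0 0) ?szt // Et !(nth_map 0) ?size_map //.
  by rewrite nth_index // xa.
by rewrite Ey -(nth_map 0 0) ?szt // Eu (nth_map 0) // nth_index.
Qed.

End Lift.
End ResidueField.

Section FrobeniusInertia.
Context (p : nat) (p_prime : prime p) (Qp : fieldType) (v : padic_abs p Qp).
Context (K : fieldExtType Qp) (C : closedFieldType) (iK : {rmorphism K -> C}).
Hypothesis C_alg : forall x : C, algebraicOver iK x.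

Local Notation vr := (vring v iK).
Local Notation vm := (vmax v iK).
Local Notation eps := (p%:R^-1 : rat).
Local Notation vint := (vint v iK).
Local Notation Qp_emb := (Qp_emb iK).

(** The form of inertia that lifting can produce: it mentions residues instead of [Kur]. Such
    automorphisms are inertial by [residue_trivial_inertia]. *)
Definition residue_trivial (gam : {rmorphism C -> C}) : Prop :=
  in_GalK iK gam /\ forall x, vr x -> vm (gam x - x).

Lemma base_char0 : has_char0 K.
Proof.
move=> n; have := padic_char0 p_prime v n.
by rewrite -(fmorph_pchar (in_alg K)).
Qed.

(** A monic equation of degree d for x becomes one for p^M x when the coefficient of degree i is
    multiplied by p^(M(d - i)); a large M makes all coefficients integral, the leading one remaining
    1. *)
Lemma vring_arch x : exists M, vr (p%:R ^+ M * x).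
Proof.
have [Q Q0 rQ] := alg_over_Qp C_alg x.
pose f := (lead_coef Q)^-1 *: Q; set d := (size f).-1.
have lQ : lead_coef Q != 0 by rewrite lead_coef_eq0.
have fm : f \is monic by rewrite monicE lead_coefZ mulVf.
have rf : root (map_poly Qp_emb f) x.
  by rewrite linearZ /= rootZ // fmorph_eq0 invr_eq0.
have f0 : (0 < size f)%N by rewrite size_poly_gt0 monic_neq0.
have [M hM] : exists M, forall i : 'I_(size f), pabs v f`_i * eps ^+ M <= 1.
  have ex (i : 'I_(size f)) : exists M, pabs v f`_i * eps ^+ M <= 1.
    have [->|fi0] := eqVneq f`_i 0; first by exists 0%N; rewrite pabs0 mul0r.
    have a0 := pabs_neq0 v fi0.
    have [|M hM] := @epsX_small _ p_prime (pabs v f`_i)^-1; first by rewrite invr_gt0.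
    by exists M; rewrite mulrC -ler_pdivlMr // div1r ltW.
  have [M hM] := boolp.choice ex; exists (\max_i M i)%N => i.
  apply: le_trans (hM i); apply: ler_wpM2l; first exact: pabs_ge0.
  apply: ler_wiXn2l (leq_bigmax i); first by rewrite ltW // eps_gt0.
  by rewrite ltW // eps_lt1.
exists M; pose g := \poly_(i < size f) (f`_i * p%:R ^+ (M * (d - i))).
have sg : size g = size f.
  by rewrite size_poly_eq // -/d subnn muln0 mulr1 -lead_coefE (monicP fm) oner_eq0.
exists g; first split.
- by rewrite monicE lead_coefE sg coef_poly prednK // leqnn -/d subnn muln0 mulr1 -lead_coefE (monicP fm).
- move=> i; rewrite coef_poly; case: ltnP => hi; last by rewrite pabs0.
  rewrite pabsM; have -> m : pabs v (p%:R ^+ m) = eps ^+ m.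
    elim: m => [|m IHm]; first by rewrite pabs1.
    by rewrite !exprS pabsM IHm pabs_eps.
  have [di|di] := posnP (d - i).
    have -> : i = (size f).-1.
      by apply/eqP; rewrite eqn_leq -/d -ltnS prednK // hi -subn_eq0 di.
    by rewrite -/d subnn muln0 mulr1 -lead_coefE (monicP fm) pabs1.
  apply: le_trans (hM (Ordinal hi)) => /=; apply: ler_wpM2l; first exact: pabs_ge0.
  apply: ler_wiXn2l; [by rewrite ltW // eps_gt0|by rewrite ltW // eps_lt1|].
  by rewrite leq_pmulr.
have -> : map_poly (fun c : Qp => iK c%:A) g = map_poly Qp_emb g by [].
rewrite /root horner_coef size_map_poly sg.
suff -> : \sum_(i < size f) (map_poly Qp_emb g)`_i * (p%:R ^+ M * x) ^+ i =
    p%:R ^+ (M * d) * (map_poly Qp_emb f).[x] by rewrite (rootP rf) mulr0.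
rewrite horner_coef size_map_poly mulr_sumr; apply: eq_bigr => i _.
rewrite !coef_map /= coef_poly ltn_ord rmorphM rmorphXn rmorph_nat exprMn.
have hi : (i <= d)%N by rewrite -ltnS prednK.
rewrite -[in RHS](subnK hi) mulnDr exprD -!exprM; ring.
Qed.

(** If x is nonzero, some p^M / x is integral; writing x as p^(M+1) times an integer would then make
    1/p integral. *)
Lemma vring_inf_div x : (forall k, exists2 z, vr z & x = p%:R ^+ k * z) -> x = 0.
Proof.
move=> h; apply/eqP; apply: contraT => x0.
have [M hM] := vring_arch x^-1; have [z hz Ez] := h M.+1.
case: (pV_not_vring p_prime (v := v) (iK := iK)).
have p0 := p_neq0 p_prime v iK.
suff -> : p%:R^-1 = (p%:R ^+ M * x^-1) * z by apply: vringM.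
apply: (mulfI p0); rewrite mulfV // -[LHS](divff x0) {1}Ez exprS; ring.
Qed.

Lemma residue_field_list q (hq : residue_card v K q) (k : fieldType) (red : {rmorphism vint -> k}) :
  (forall x, red x = 0 <-> vm (val x)) -> exists ks : seq k,
  [/\ uniq ks, size ks = q &
    forall y, y \in ks <-> exists (x : vint) (c : K), val x = iK c /\ red x = y].
Proof.
move=> redP; have [t [ht tuniq]] := hq.
have vrK c : vring v idfun c <-> vr (iK c) by apply: (@vring_mor p Qp v K K C idfun iK iK).
have vmK c : vmax v idfun c <-> vm (iK c) by apply: (@vmax_mor p Qp v K K C idfun iK iK).
have ex i : exists x : vint, val x = iK (t i) by apply: vint_ex; apply/vrK.
have [tO htO] := boolp.choice ex.
have redE x y : red x = red y <-> vm (val x - val y).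
  rewrite -(rmorphB val) -redP rmorphB; split=> [->|/eqP]; first exact: subrr.
  by rewrite subr_eq0 => /eqP.
exists [seq red (tO i) | i <- enum 'I_q]; split.
- rewrite map_inj_uniq ?enum_uniq // => i j /redE.
  rewrite !htO -rmorphB -vmK => hij.
  have [l [_ hl]] := tuniq _ (ht i).
  by rewrite -(hl j hij) (hl i) // subrr vmK rmorph0; apply: vmax0.
- by rewrite size_map size_enum_ord.
- move=> y; split=> [/mapP[i _ ->]|[x [c [Ex <-]]]]; first by exists (tO i), (t i).
  have hc : vring v idfun c by rewrite vrK -Ex; apply: vintP.
  have [i [hi _]] := tuniq _ hc; apply/mapP; exists i; first by rewrite mem_enum.
  by apply/redE; rewrite Ex htO -rmorphB -vmK.
Qed.

(** [frobenius] and every [Ts_datum] quantify over their own residue cardinality; this identifies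
    them all. *)
Lemma residue_card_inj q q' : residue_card v K q -> residue_card v K q' -> q = q'.
Proof.
have [k [red redP]] := residue_map_ex p_prime v C_alg.
move=> /residue_field_list/(_ _ _ redP)[ks [uks <- hks]].
move=> /residue_field_list/(_ _ _ redP)[ks' [uks' <- hks']].
apply: perm_size; apply: uniq_perm => // x; apply/idP/idP.
  by move/hks/hks'.
by move/hks'/hks.
Qed.

Section ResidueCard.
Context (q : nat) (hq : residue_card v K q).

(** The residue field of K is a subring of size q in the residue field of [Kbar], and its elements
    are exactly the roots of X^q - X. *)
Lemma residue_frob (k : fieldType) (red : {rmorphism vint -> k}) :
  (forall x, red x = 0 <-> vm (val x)) ->
  [/\ forall x y : k, (x + y) ^+ q = x ^+ q + y ^+ q, q%:R = 0 :> k &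
    forall x : vint, red x ^+ q = red x <->
      exists (y : vint) (c : K), val y = iK c /\ red x = red y].
Proof.
move=> redP; have [ks [uks sks hks]] := residue_field_list hq redP.
have ks1 : 1 \in ks by apply/hks; exists 1, 1; rewrite !rmorph1.
have ksB x y : x \in ks -> y \in ks -> x - y \in ks.
  move=> /hks[a [c [Ea <-]]] /hks[b [d [Eb <-]]]; apply/hks.
  exists (a - b), (c - d); split; last exact: rmorphB.
  by rewrite [RHS]rmorphB -Ea -Eb; apply: (rmorphB (val : {rmorphism vint -> C})).
have ksM x y : x \in ks -> y \in ks -> x * y \in ks.
  move=> /hks[a [c [Ea <-]]] /hks[b [d [Eb <-]]]; apply/hks.
  exists (a * b), (c * d); split; last exact: rmorphM.
  by rewrite [RHS]rmorphM -Ea -Eb; apply: (rmorphM (val : {rmorphism vint -> C})).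
rewrite -sks; split=> [x y||x].
- exact: finite_subring_exprD.
- exact: finite_subring_char.
split=> [/(finite_subring_mem uks ks1 ksB ksM)/hks[y [c [Ey <-]]]|[y [c [Ey ->]]]].
  by exists y, c.
by apply: finite_subring_expr => //; apply/hks; exists y, c.
Qed.

Lemma frobenius_ex : exists gam, frobenius v iK gam.
Proof.
have [k [red redP]] := residue_map_ex p_prime v C_alg.
have [qD q0 qK] := residue_frob redP.
pose u (x : vint) := red x ^+ q.
have uB : zmod_morphism u.
  by move=> x y; apply/eqP; rewrite eq_sym subr_eq -qD -rmorphD subrK.
have uM : monoid_morphism u.
  by split=> [|x y]; rewrite /u ?rmorph1 ?expr1n // rmorphM exprMn.
pose U : {rmorphism vint -> k} := HB.pack u
  (GRing.isZmodMorphism.Build vint k u uB) (GRing.isMonoidMorphism.Build vint k u uM).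
have [|x [c Ex]|gam hg hU] := @residue_lift _ _ v K C iK K iK C_alg base_char0 _ k red U.
- by move=> c; exists c.
- by apply/qK; exists x, c.
exists gam; split; first by split=> //; apply: auto_bij hg.
exists q => // x hx.
have [a Ea] := vint_ex hx; have [b Eb] := vint_ex ((vring_auto v x hg).1 hx).
have := hU a b; rewrite Ea Eb => /(_ erefl) E.
rewrite -Eb -Ea -(rmorphXn (val : {rmorphism vint -> C})) -(rmorphB (val : {rmorphism vint -> C})) -redP rmorphB rmorphXn E.
exact: subrr.
Qed.

(* An automorphism acts on the residue field as one fixing the fixed field F,
   whose residue field is that of K, up to an automorphism acting trivially. *)
Lemma frob_inertia_fixed x :
  (forall gam, frobenius v iK gam \/ residue_trivial gam -> gam x = x) ->
  exists c, x = iK c.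
Proof.
move=> fx; apply: (fixed_in_base C_alg base_char0) => gam hg.
pose G gam := frobenius v iK gam \/ residue_trivial gam.
pose F := fixed_field G; pose iF : {rmorphism F -> C} := val.
have KF c : exists c' : F, iK c = iF c'.
  have hc : iK c \in fixed_pred G by apply/fixed_predP => del [[[_ hd] _]|[[_ hd] _]].
  by exists (FixedField hc).
have F_alg y : algebraicOver iF y.
  have [P P0 rP] := C_alg y; have [f hf] := boolp.choice KF.
  have EP : map_poly iF (\poly_(i < size P) f P`_i) = map_poly iK P.
    apply/polyP => i; rewrite !coef_map coef_poly; case: ltnP => hi; first exact/esym/hf.
    rewrite (_ : P`_i = 0); last exact: nth_default.
    exact: etrans (rmorph0 iF) (esym (rmorph0 iK)).
  exists (\poly_(i < size P) f P`_i); last by rewrite EP.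
  by rewrite -(map_poly_eq0 iF) EP map_poly_eq0.
have charF : has_char0 F.
  move=> n; rewrite -[LHS](fmorph_pchar iF) (fmorph_pchar iK).
  exact: base_char0.
have [k [red redP]] := residue_map_ex p_prime v C_alg.
have [qD q0 qK] := residue_frob redP.
have redE (a b : vint) : red a = red b <-> vm (val a - val b).
  rewrite -(rmorphB val) -redP rmorphB; split=> [->|/eqP]; first exact: subrr.
  by rewrite subr_eq0 => /eqP.
have gvr (a : vint) : gam (val a) \in vring_pred v iK.
  by apply/boolp.asboolP; apply: (vring_auto v _ hg).1; apply: vintP.
pose g (a : vint) : vint := VInt (gvr a).
pose u (a : vint) := red (g a).
have uB : zmod_morphism u.
  move=> a b; rewrite /u -rmorphB; congr (red _); apply: val_inj.
  by rewrite rmorphB /= rmorphB.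
have uM : monoid_morphism u.
  split=> [|a b]; last first.
    rewrite /u -rmorphM; congr (red _); apply: val_inj.
    by rewrite rmorphM /= rmorphM.
  rewrite /u (_ : g 1 = 1) ?rmorph1 //; apply: val_inj => /=.
  by rewrite !rmorph1.
pose U : {rmorphism vint -> k} := HB.pack u
  (GRing.isZmodMorphism.Build vint k u uB) (GRing.isMonoidMorphism.Build vint k u uM).
have redU (a : vint) : (exists c, val a = iF c) -> U a = red a.
  move=> [c Ea].
  have [frob hfrob] := frobenius_ex.
  have Efrob : frob (val a) = val a.
    by rewrite Ea; apply: ((fixed_predP G _).1 (valP c)); left.
  (* As [frob] fixes a, the reduction of a equals its q-th power, hence comes from an integer of K;
     gam fixes that integer. *)
  have [b [d [Eb Eab]]] : exists (y : vint) (d : K), val y = iK d /\ red a = red y.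
    apply/qK; rewrite -rmorphXn; apply/redE; rewrite rmorphXn.
    case: hfrob => _ [q' hq' /(_ _ (vintP a))]; rewrite Efrob.
    by rewrite -(residue_card_inj hq hq') -opprB => /(vmaxN p_prime C_alg); rewrite opprK.
  rewrite Eab; apply/redE; rewrite /= Eb -(hg d) -rmorphB.
  by apply: (vmax_auto v _ hg).1; rewrite -Eb; apply/redE.
have [rho hrho hU] := residue_lift F_alg charF KF redU.
have rhoK : fixes_base iK rho by move=> c; have [c' ->] := KF c; apply: hrho.
have [rho' [rhoK' Krho]] := rmorph_inverse (auto_bij F_alg hrho).
have x_fix : x \in fixed_pred G by apply/fixed_predP.
pose iota : {rmorphism C -> C} := gam \o rho'.
have hrho' : fixes_base iK rho' by move=> c; rewrite -[in LHS](rhoK c) rhoK'.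
have -> : gam x = iota x.
  have E : rho x = x := hrho (FixedField x_fix).
  by rewrite /= -{2}E rhoK'.
apply: fx; right; split.
  split; first by apply: (auto_bij C_alg) => c /=; rewrite hrho' hg.
  by move=> c /=; rewrite hrho' hg.
move=> y hy; have hz := (vring_auto v y hrho').1 hy.
have [a Ea] := vint_ex hz; have [b Eb] := vint_ex hy.
have := hU a b; rewrite Ea Eb Krho => /(_ erefl) E.
have <- : val (g a) - val b = iota y - y.
  by rewrite Eb; congr (_ - y); apply: (congr1 gam Ea).
exact: (redE (g a) b).1 (esym E).
Qed.

End ResidueCard.
End FrobeniusInertia.

(** * Rigidity of unramified extensions *)

Section Rigidity.
Context (p : nat) (p_prime : prime p) (Qp : fieldType) (v : padic_abs p Qp).
Context (K : fieldExtType Qp) (C : closedFieldType) (iK : {rmorphism K -> C}).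
Hypothesis C_alg : forall x : C, algebraicOver iK x.
Context (q : nat) (hq : residue_card v K q).

Local Notation vr := (vring v iK).
Local Notation vm := (vmax v iK).
Local Notation vint := (vint v iK).

Lemma auto_finite_order (gam : {rmorphism C -> C}) z :
  fixes_base iK gam -> exists f, iter f.+1 gam z = z.
Proof.
move=> hg; have [r hr] := conjugates_ex C_alg z.
have iter_r i : iter i gam z \in r.
  apply: hr => P rP; elim: i => // i IH /=.
  exact: (pauto_root (auto_partial [:: _] hg)) (mem_head _ _) IH.
have : ~~ uniq [seq iter i gam z | i <- iota 0 (size r).+1].
  apply/negP => us; have := uniq_leq_size us (s2 := r).
  rewrite size_map size_iota ltnn => h; suff : false by [].
  by apply: h => _ /mapP[i _ ->].
case/(uniqPn 0) => i [j [ij]]; rewrite size_map size_iota => hj.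
rewrite !(nth_map 0%N) ?size_iota ?(ltn_trans ij) // !nth_iota ?(ltn_trans ij) //.
rewrite !add0n => E; exists (j - i.+1)%N.
have inj n : injective (iter n gam) by elim: n => // n IH x y /= /fmorph_inj/IH.
apply: (inj i); rewrite -iterD E; congr (iter _ _ _); lia.
Qed.

(** A Frobenius returns to z after finitely many steps, and each step is the q-th power modulo the
    maximal ideal. *)
Lemma residue_pow z : vr z -> exists f, vm (z ^+ (q ^ f.+1) - z).
Proof.
move=> hz; have [gam [[gam_bij hg] [q' hq' hgam]]] := frobenius_ex p_prime C_alg hq.
rewrite -(residue_card_inj p_prime C_alg hq hq') in hgam.
have [f hf] := auto_finite_order z hg; exists f; rewrite -{2}hf.
elim: (f.+1) => [|m IHm] /=; first by rewrite expr1 subrr; apply: vmax0.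
rewrite -opprB; apply: (vmaxN p_prime C_alg).
have -> : gam (iter m gam z) - z ^+ (q ^ m.+1) =
   (gam (z ^+ (q ^ m)) - z ^+ (q ^ m) ^+ q) - gam (z ^+ (q ^ m) - iter m gam z).
  by rewrite rmorphB -exprM -expnSr; ring.
apply: (vmaxB p_prime C_alg); first by apply: hgam; apply: vringX.
exact: (vmax_auto v _ hg).1.
Qed.

(** With Q = q^(f+1), the sum is the quotient of a^Q - b^Q by a - b. Where a and b have the same
    residue it reduces to Q a^(Q-1), and q is zero in the residue field. *)
Lemma vmax_subr_pow a b f : vr a -> vr b -> vm (a - b) ->
  vm (\sum_(i < q ^ f.+1) a ^+ ((q ^ f.+1).-1 - i) * b ^+ i).
Proof.
move=> ha hb hab; have [k [red redP]] := residue_map_ex p_prime v C_alg.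
have [qD q0 qK] := residue_frob hq redP.
have [x Ex] := vint_ex ha; have [y Ey] := vint_ex hb.
have Exy : red x = red y.
  apply/eqP; rewrite -subr_eq0 -rmorphB; apply/eqP/redP.
  have -> // : val (x - y) = a - b.
  by rewrite -Ex -Ey; apply: (rmorphB (val : {rmorphism vint -> C})).
rewrite -Ex -Ey; pose S := \sum_(i < q ^ f.+1) x ^+ ((q ^ f.+1).-1 - i) * y ^+ i.
have -> : \sum_(i < q ^ f.+1) val x ^+ ((q ^ f.+1).-1 - i) * val y ^+ i = val S :> C.
  apply/esym; apply: etrans (rmorph_sum (val : {rmorphism vint -> C}) _ _ _) _.
  by apply: eq_bigr => i _; rewrite rmorphM !rmorphXn.
apply/redP; rewrite rmorph_sum /= (eq_bigr (fun=> red y ^+ (q ^ f.+1).-1)).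
  by rewrite sumr_const card_ord -mulr_natr natrX q0 expr0n mulr0.
move=> i _; rewrite rmorphM !rmorphXn /= Exy -exprD subnK // -ltnS prednK //.
exact: leq_ltn_trans (ltn_ord i).
Qed.

Section Ext.
Context (L : fieldExtType K) (B : {subfield L}) (u u' : {rmorphism L -> C}).
Hypotheses (uK : forall c : K, u c%:A = iK c) (uK' : forall c : K, u' c%:A = iK c).
Hypothesis B_unr : unramified v 1%AS B.
Hypothesis uu' : forall y, y \in B -> vring v (in_alg L) y -> vm (u' y - u y).

(* With d = u' - u and y^Q - y = c w for an integer w of B and c in the maximal
   ideal of K, d(y) is a unit times c d(w), as d(y^Q) is divisible by d(y) times
   a nonunit.  So d(y) is divisible by all powers of p. *)
Lemma unramified_rigid_step n y : (forall a : K, vm (iK a) -> vr (iK a ^+ n / p%:R)) ->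
  y \in B -> vring v (in_alg L) y -> forall k, exists2 z, vr z & (u' y - u y) ^+ n = p%:R ^+ k * z.
Proof.
move=> hn yB hy k.
have vrL x : vring v (in_alg L) x <-> vr (u x) by apply: (@vring_mor p Qp v K L C (in_alg L) iK u).
have vrL' x : vring v (in_alg L) x <-> vr (u' x) by apply: (@vring_mor p Qp v K L C (in_alg L) iK u').
have vmL x : vmax v (in_alg L) x <-> vm (u x) by apply: (@vmax_mor p Qp v K L C (in_alg L) iK u).
elim: k => [|k IHk] in y yB hy *.
  exists ((u' y - u y) ^+ n); last by rewrite mul1r.
  by apply: vringX; apply: vringB; [apply/vrL' | apply/vrL].
have [f hf] := residue_pow ((vrL y).1 hy); pose Q := (q ^ f.+1)%N.
have [||c' [w [/vlineP[c ->] mc wB hw Ew]]] := B_unr (x := y ^+ Q - y).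
- by rewrite rpredB ?rpredX.
- by apply/vmL; rewrite rmorphB rmorphXn.
have {}mc : vm (iK c) by rewrite -uK; apply/vmL.
have [z hz Ez] := IHk w wB hw.
pose S := \sum_(i < Q) u' y ^+ (Q.-1 - i) * u y ^+ i.
have hS : vm S by apply: vmax_subr_pow; [apply/vrL'|apply/vrL|apply: uu'].
have [S0 SV] : S - 1 != 0 /\ vr (S - 1)^-1.
  apply: vmax_unit; first by apply: vringB (vmax_vring hS) (vring1 _ _).
  move=> hS1; apply: (@vmax1 _ _ v _ _ iK).
  by rewrite -(subKr S 1); apply: (vmaxB p_prime C_alg).
have ES : (u' y - u y) * (S - 1) = iK c * (u' w - u w).
  rewrite mulrBr mulr1 -subrXX.
  have -> : iK c * (u' w - u w) = u' (c%:A * w) - u (c%:A * w).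
    by rewrite !rmorphM uK uK' mulrBr.
  by rewrite -Ew !rmorphB !rmorphXn; ring.
have p0 := p_neq0 p_prime v iK.
(* K may be ramified over Q_p, so c need not be divisible by p, but c^n is; this is why n-th powers
   are compared, each step gaining one factor p. *)
exists ((iK c ^+ n / p%:R) * z * (S - 1)^-1 ^+ n).
  by apply: vringM (vringX _ SV); apply: vringM hz; apply: hn.
have -> : u' y - u y = iK c * (u' w - u w) * (S - 1)^-1 by rewrite -ES mulfK.
rewrite !exprMn Ez exprS; set s := _^-1 ^+ n.
by rewrite -{1}(mulfVK p0 (iK c ^+ n)); ring.
Qed.

Lemma unramified_rigid y : y \in B -> u' y = u y.
Proof.
have [n hn] := vmax_base_pow p_prime v C_alg.
have int_case x : x \in B -> vring v (in_alg L) x -> u' x = u x.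
  move=> xB hx; have := vring_inf_div p_prime C_alg (unramified_rigid_step hn xB hx).
  by move/eqP; rewrite expf_eq0 => /andP[_]; rewrite subr_eq0 => /eqP.
move=> yB; have [M hM] := vring_arch p_prime v C_alg (u y).
have p0 := p_neq0 p_prime v iK.
have : u' (p%:R ^+ M * y) = u (p%:R ^+ M * y).
  apply: int_case; first by rewrite rpredM // rpredX // rpredMn // rpred1.
  apply/(@vring_mor p Qp v K L C (in_alg L) iK u uK).
  by rewrite rmorphM rmorphXn rmorph_nat.
rewrite !rmorphM !rmorphXn !rmorph_nat; apply: mulfI.
by rewrite expf_neq0.
Qed.

End Ext.

Lemma residue_trivial_inertia gam : residue_trivial v iK gam -> inertia v iK gam.
Proof.
move=> [hgam hr]; split=> // _ [L [i [iL L_unr [y ->]]]].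
apply: (@unramified_rigid L {:L}%AS i (gam \o i) iL _ L_unr) => [c|x _ hx|].
- by rewrite /= iL hgam.2.
- by apply: hr; apply/(@vring_mor p Qp v K L C (in_alg L) iK i iL).
- exact: memvf.
Qed.

End Rigidity.

(** * Regular functions and characters of tori *)

Section RegularFunctions.
Context (C : closedFieldType).
Local Notation any := (@anyC C).

Section OnGroup.
Context (N : nat) (G : 'M[C]_N -> Prop).
Local Notation reg := (regular any G).

Lemma reg_ext f f' : (forall g, G g -> f g = f' g) -> reg f -> reg f'.
Proof. by move=> ff' [P _ hP]; exists P => // g Gg; rewrite -ff' ?hP. Qed.

Lemma reg_const c : reg (fun=> c).
Proof. by exists c%:MP => // g _; rewrite mevalC. Qed.

Lemma reg_add f f' : reg f -> reg f' -> reg (fun g => f g + f' g).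
Proof.
by move=> [P _ hP] [Q _ hQ]; exists (P + Q) => // g Gg; rewrite mevalD hP ?hQ.
Qed.

Lemma reg_mul f f' : reg f -> reg f' -> reg (fun g => f g * f' g).
Proof.
by move=> [P _ hP] [Q _ hQ]; exists (P * Q) => // g Gg; rewrite mevalM hP ?hQ.
Qed.

Lemma reg_sum (I : Type) (s : seq I) (Q : pred I) (f : I -> 'M[C]_N -> C) :
  (forall i, reg (f i)) -> reg (fun g => \sum_(i <- s | Q i) f i g).
Proof.
move=> h; elim: s => [|i s IHs].
  by apply: reg_ext (reg_const 0) => g _; rewrite big_nil.
case Qi: (Q i).
  by apply: reg_ext (reg_add (h i) IHs) => g _; rewrite big_cons Qi.
by apply: reg_ext IHs => g _; rewrite big_cons Qi.
Qed.

Lemma reg_prod (I : Type) (s : seq I) (Q : pred I) (f : I -> 'M[C]_N -> C) :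
  (forall i, reg (f i)) -> reg (fun g => \prod_(i <- s | Q i) f i g).
Proof.
move=> h; elim: s => [|i s IHs].
  by apply: reg_ext (reg_const 1) => g _; rewrite big_nil.
case Qi: (Q i).
  by apply: reg_ext (reg_mul (h i) IHs) => g _; rewrite big_cons Qi.
by apply: reg_ext IHs => g _; rewrite big_cons Qi.
Qed.

Lemma reg_exp n f : reg f -> reg (fun g => f g ^+ n).
Proof.
move=> hf; elim: n => [|n IHn]; first by apply: reg_ext (reg_const 1).
by apply: reg_ext (reg_mul hf IHn) => g _; rewrite exprS.
Qed.

Lemma reg_entry i j : reg (fun g => g i j).
Proof.
exists 'X_(lshift 1 (mxvec_index i j)) => // g _.
by rewrite mevalXU /gl_coord row_mxEl mxvecE.
Qed.

Lemma reg_detV : reg (fun g => (\det g)^-1).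
Proof.
exists 'X_(rshift (N * N) ord0) => // g _.
by rewrite mevalXU /gl_coord row_mxEr mxE eqxx mulr1n.
Qed.

Definition regular_mx m n (f : 'M[C]_N -> 'M[C]_(m, n)) := forall i j, reg (fun g => f g i j).

Lemma regmx_ext m n (f f' : 'M[C]_N -> 'M[C]_(m, n)) :
  (forall g, G g -> f g = f' g) -> regular_mx f -> regular_mx f'.
Proof. by move=> ff' hf i j; apply: reg_ext (hf i j) => g Gg; rewrite ff'. Qed.

Lemma regmx_const m n (A : 'M[C]_(m, n)) : regular_mx (fun=> A).
Proof. by move=> i j; apply: reg_const. Qed.

Lemma regmx_id : regular_mx id.
Proof. by move=> i j; apply: reg_entry. Qed.

Lemma regmx_mul m n k (f : 'M[C]_N -> 'M[C]_(m, n)) (f' : 'M[C]_N -> 'M[C]_(n, k)) :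
  regular_mx f -> regular_mx f' -> regular_mx (fun g => f g *m f' g).
Proof.
move=> hf hf' i j.
apply: (@reg_ext (fun g => \sum_l f g i l * f' g l j)) => [g _|]; first by rewrite mxE.
by apply: reg_sum => l; apply: reg_mul.
Qed.

Lemma regmx_scale m n (a : 'M[C]_N -> C) (f : 'M[C]_N -> 'M[C]_(m, n)) :
  reg a -> regular_mx f -> regular_mx (fun g => a g *: f g).
Proof.
move=> ha hf i j; apply: (@reg_ext (fun g => a g * f g i j)) => [g _|]; first by rewrite mxE.
exact: reg_mul.
Qed.

Lemma regmx_sum (I : Type) (s : seq I) m n (f : I -> 'M[C]_N -> 'M[C]_(m, n)) :
  (forall i, regular_mx (f i)) -> regular_mx (fun g => \sum_(i <- s) f i g).
Proof.
move=> hf i j; apply: (@reg_ext (fun g => \sum_(l <- s) f l g i j)) => [g _|].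
  by rewrite summxE.
by apply: reg_sum => l; apply: hf.
Qed.

Lemma reg_tr n (f : 'M[C]_N -> 'M[C]_n) : regular_mx f -> reg (fun g => \tr (f g)).
Proof. by move=> hf; apply: reg_sum => i; apply: hf. Qed.

Lemma reg_det n (f : 'M[C]_N -> 'M[C]_n) : regular_mx f -> reg (fun g => \det (f g)).
Proof.
move=> hf; apply: reg_sum => s; apply: reg_mul; first exact: reg_const.
by apply: reg_prod => i; apply: hf.
Qed.

Lemma regmx_inv : subG G (fun g => g \in unitmx) -> regular_mx (fun g => invmx g).
Proof.
move=> GU; apply: (@regmx_ext _ _ (fun g => (\det g)^-1 *: \adj g)).
  by move=> g /GU gU; rewrite /invmx gU.
apply: regmx_scale; first exact: reg_detV.
move=> i j; apply: (@reg_ext (fun g => cofactor g j i)) => [g _|]; first by rewrite mxE.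
apply: reg_mul; first exact: reg_const.
apply: reg_det => k l.
by apply: (@reg_ext (fun g => g (lift j k) (lift i l))) (reg_entry _ _) => g _; rewrite !mxE.
Qed.

Lemma reg_comp M (H : 'M[C]_M -> Prop) (f : 'M[C]_N -> 'M[C]_M) (phi : 'M[C]_M -> C) :
  (forall g, G g -> H (f g)) -> regular_mx f -> reg (fun g => (\det (f g))^-1) ->
  regular any H phi -> reg (fun g => phi (f g)).
Proof.
move=> GH hf hd [P _ hP].
apply: (@reg_ext (fun g => P.@[gl_coord (f g)])) => [g Gg|]; first by rewrite hP //; apply: GH.
rewrite /meval /mmap; apply: reg_sum => m; apply: reg_mul; first exact: reg_const.
apply: reg_prod => k; apply: reg_exp; rewrite -(splitK k).
case: (split k) => [l|l] /=.
  case/mxvec_indexP: l => i j.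
  by apply: (@reg_ext (fun g => f g i j)) => // g _; rewrite /gl_coord row_mxEl mxvecE.
by apply: reg_ext hd => g _; rewrite /gl_coord row_mxEr ord1 mxE eqxx mulr1n.
Qed.

End OnGroup.

Lemma gl_coord_map (gam : {rmorphism C -> C}) N (g : 'M[C]_N) k :
  gl_coord (map_mx gam g) k = gam (gl_coord g k).
Proof.
rewrite /gl_coord -map_mxvec det_map_mx -fmorphV -map_scalar_mx -map_row_mx.
by rewrite mxE.
Qed.

Lemma meval_map (gam : {rmorphism C -> C}) n (P : {mpoly C[n]}) (x : 'I_n -> C) :
  gam P.@[x] = (map_mpoly gam P).@[gam \o x].
Proof.
have -> : map_mpoly gam P = \sum_(m <- msupp P) gam P@_m *: 'X_[m].
  rewrite [P in LHS]mpolyE (raddf_sum (map_mpoly gam)); apply: eq_bigr => m _.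
  by rewrite /= map_mpolyZ map_mpolyX.
rewrite mevalE rmorph_sum (raddf_sum (meval _)); apply: eq_bigr => m _.
rewrite rmorphM rmorph_prod /= mevalZ mevalX.
by congr (_ * _); apply: eq_bigr => i _; rewrite rmorphXn.
Qed.

Lemma closed_group_map (F : fieldType) (iF : {rmorphism F -> C}) N (G : 'M[C]_N -> Prop)
    (gam : {rmorphism C -> C}) :
  closed_group (fun x => exists c, x = iF c) G -> fixes_base iF gam ->
  forall g, G g <-> G (map_mx gam g).
Proof.
move=> [_ [Eqs rat hG]] hg g; rewrite !hG map_unitmx.
suff E P : Eqs P -> P.@[gl_coord (map_mx gam g)] = gam P.@[gl_coord g].
  split=> -[-> h]; split=> // P hP; first by rewrite E // h // rmorph0.
  by apply/eqP; rewrite -(fmorph_eq0 gam) -E // h.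
move=> hP; rewrite meval_map; have -> : map_mpoly gam P = P.
  apply/mpolyP => m; rewrite mcoeff_map_mpoly /=.
  by have [c ->] := rat P hP m; rewrite hg.
by apply: meval_eq => k /=; rewrite gl_coord_map.
Qed.

(* Average the conjugates of a polynomial which represent the same function. *)
Lemma regular_descent (F : fieldType) (iF : {rmorphism F -> C}) (D : {rmorphism C -> C} -> Prop)
    N (G : 'M[C]_N -> Prop) (f : 'M[C]_N -> C) :
  (forall x : C, algebraicOver iF x) -> has_char0 F ->
  (forall x, (forall gam, D gam -> gam x = x) -> exists c, x = iF c) ->
  (forall gam, D gam -> fixes_base iF gam) ->
  (forall gam, D gam -> forall g, G g <-> G (map_mx gam g)) ->
  (forall gam, D gam -> forall g, G g -> f (map_mx gam g) = gam (f g)) ->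
  regular any G f -> regular (fun x => exists c, x = iF c) G f.
Proof.
move=> F_alg char0 fixD baseD GD fD [P _ hP].
pose ms := msupp P; pose s := map (fun m => P@_m) ms.
pose Pt (t : seq C) : {mpoly C[N * N + 1]} := \sum_(i < size ms) t`_i *: 'X_[nth 0%MM ms i].
have Ps : Pt s = P.
  rewrite [RHS]mpolyE (big_nth 0%MM) big_mkord; apply: eq_bigr => i _.
  by rewrite (nth_map 0%MM).
have [Z uZ hZ] := conj_list F_alg s.
pose Z' := [seq t <- Z | boolp.asbool (forall g, G g -> f g = (Pt t).@[gl_coord g])].
have uZ' : uniq Z' by rewrite filter_uniq.
have Z'P t : t \in Z' -> forall g, G g -> f g = (Pt t).@[gl_coord g].
  by rewrite mem_filter => /andP[/boolp.asboolP].
have sZ' : s \in Z'.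
  rewrite mem_filter; apply/andP; split; first by apply/boolp.asboolP; rewrite Ps.
  by apply/hZ; exists (idfun : {rmorphism C -> C}); rewrite ?map_id.
have size_Z t : t \in Z -> size t = size ms.
  by case/hZ => gam _ ->; rewrite !size_map.
have mapPt (gam : {rmorphism C -> C}) t : t \in Z -> Pt (map gam t) = map_mpoly gam (Pt t).
  move=> tZ; rewrite /Pt raddf_sum; apply: eq_bigr => i _ /=.
  by rewrite map_mpolyZ map_mpolyX (nth_map 0) // size_Z.
(* Since f commutes with D, the conjugate by D of a polynomial representing f again represents f; so
   D permutes [Z'], and the average over [Z'] has coefficients fixed by D. *)
have permD gam : D gam -> perm_eq (map (map gam) Z') Z'.
  move=> hgam; have inj : injective (map gam) by apply: inj_map; apply: fmorph_inj.
  apply: uniq_perm; rewrite ?map_inj_uniq //.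
  apply: (uniq_min_size _ _ (eq_leq (esym (size_map _ _)))).2.
    by rewrite map_inj_uniq.
  move=> _ /mapP[t tZ' ->]; have := tZ'; rewrite mem_filter => /andP[_ tZ].
  rewrite mem_filter; apply/andP; split; last first.
    have [del hd ->] := (hZ t).1 tZ; apply/hZ.
    exists (gam \o del : {rmorphism C -> C}); last by rewrite -map_comp.
    by move=> c /=; rewrite hd (baseD _ hgam).
  apply/boolp.asboolP => g Gg.
  have [del [gamK Kgam]] := rmorph_inverse (auto_bij F_alg (baseD _ hgam)).
  have Eg : g = map_mx gam (map_mx del g).
    by apply/matrixP => i j; rewrite !mxE Kgam.
  have Gdg : G (map_mx del g) by rewrite (GD _ hgam) -Eg.
  rewrite {1}Eg (fD _ hgam) // (Z'P _ tZ') // meval_map mapPt //.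
  by apply: meval_eq => k /=; rewrite {2}Eg gl_coord_map.
have nZ' : (size Z')%:R != 0 :> C.
  rewrite -(rmorph_nat iF) fmorph_eq0 (pcharf0P F).1 //.
  by case: (Z') sZ'.
pose Q := (size Z')%:R^-1 *: \sum_(t <- Z') Pt t.
exists Q => [m|g Gg]; last first.
  rewrite mevalZ raddf_sum /= big_seq (eq_bigr (fun=> f g)); last first.
    by move=> t /Z'P/(_ _ Gg).
  by rewrite -big_seq big_const_seq count_predT iter_addr_0 -[f g *+ _]mulr_natl mulKf.
apply: fixD => gam hgam; rewrite mcoeffZ rmorphM fmorphV rmorph_nat; congr (_ * _).
rewrite !raddf_sum /= -[RHS](perm_big _ (permD _ hgam)) big_map /= big_seq [RHS]big_seq.
apply: eq_bigr => t; rewrite mem_filter => /andP[_ tZ].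
by rewrite mapPt // mcoeff_map_mpoly.
Qed.

End RegularFunctions.

(** * Independence of multiplicative functions and characters of diagonal groups *)

Section MultiplicativeFunctions.
Context (C : fieldType) (X : Type) (T : X -> Prop) (op : X -> X -> X).
Hypothesis T_op : forall t u, T t -> T u -> T (op t u).
Let multiplicative_on (f : X -> C) := forall t u, T t -> T u -> f (op t u) = f t * f u.

(** Dedekind's argument: if h and f_i differ at w, subtracting f_i(w) times the relation at t from
    the relation at [op w t] removes the i-th term. It serves for monomials on diagonal matrices and
    for embeddings of fields alike. *)
Lemma mult_function_independent (I : eqType) (l : seq I) (c : I -> C) (f : I -> X -> C) (h : X -> C) t0 :
  T t0 -> h t0 != 0 -> multiplicative_on h -> (forall i, multiplicative_on (f i)) ->
  (forall t, T t -> h t = \sum_(i <- l) c i * f i t) ->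
  exists2 i, i \in l & forall t, T t -> h t = f i t.
Proof.
move=> T0 h0 hM fM; elim: l c => [|i l IHl] c hE.
  by move: h0; rewrite (hE _ T0) big_nil eqxx.
have [?|/boolp.existsNP[w /boolp.not_implyP[Tw /eqP nw]]] :=
  boolp.pselect (forall t, T t -> h t = f i t).
  by exists i; rewrite ?mem_head.
have [|j jl hj] := IHl (fun k => c k * (f k w - f i w) / (h w - f i w)); last first.
  by exists j => //; rewrite in_cons jl orbT.
move=> t Tt; have d0 : h w - f i w != 0 by rewrite subr_eq0.
apply: (mulfI d0); rewrite mulr_sumr mulrBl -hM // hE; last exact: T_op.
rewrite [h t]hE // !big_cons !fM // mulrDr opprD addrACA.
rewrite [f i w * (c i * _)]mulrCA subrr add0r.
rewrite mulr_sumr -sumrB; apply: eq_bigr => k _.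
rewrite fM //; field; exact: d0.
Qed.

End MultiplicativeFunctions.

Section CharactersOfTori.
Context (C : closedFieldType).
Local Notation any := (@anyC C).

Lemma is_subgroup_Gm d : is_subgroup (@Gm C d).
Proof.
have diagM (g h : 'M[C]_d) : is_diag_mx g -> is_diag_mx h -> is_diag_mx (g *m h).
  move=> /diag_mxP[a ->] /diag_mxP[b ->]; rewrite mulmx_diag.
  exact: diag_mx_is_diag.
split=> [g []//||g h [gu gd] [hu hd]|g [gu /diag_mxP[a Ea]]].
- by split; [exact: unitmx1 | rewrite -diag_const_mx diag_mx_is_diag].
- by split; [rewrite unitmx_mul gu | exact: diagM].
split; first by rewrite unitmx_inv.
have a0 i : a 0 i != 0.
  move: gu; rewrite Ea unitmxE det_diag unitfE => /prodf_neq0/(_ i isT) //.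
rewrite Ea (_ : invmx _ = diag_mx (\row_i (a 0 i)^-1)) ?diag_mx_is_diag //.
rewrite -[RHS]mulmx1 -[in RHS](mulmxV gu) Ea mulmxA mulmx_diag.
rewrite (_ : diag_mx _ = 1%:M) ?mul1mx //.
apply/matrixP => i j; rewrite !mxE; case: eqP => // _; rewrite !mulr1n.
by rewrite mulVf.
Qed.

Lemma Gm_entry_neq0 d (g : 'M[C]_d) i : Gm g -> g i i != 0.
Proof.
move=> [gu /diag_mxP[a Ea]]; move: gu; rewrite Ea unitmxE det_diag unitfE.
by move=> /prodf_neq0/(_ i isT); rewrite mxE eqxx mulr1n.
Qed.

Lemma Gm_entryM d (g h : 'M[C]_d) i j : Gm g -> Gm h -> (g *m h) i j = g i j * h i j.
Proof.
move=> [_ /diag_mxP[a ->]] [_ /diag_mxP[b ->]]; rewrite mulmx_diag !mxE.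
by case: eqP; rewrite ?mulr1n ?mulr0n ?mul0r.
Qed.

(** Psi is a linear combination of monomials in the coordinates, which are multiplicative on
    diagonal matrices; by independence it equals one of them. That monomial contains no off-diagonal
    entry, since psi does not vanish at the identity. *)
Lemma Gm_character d (psi : 'M[C]_d -> C) : character any (@Gm C d) psi ->
  exists a : 'I_d -> int, forall g, Gm g -> psi g = \prod_i g i i ^ a i.
Proof.
move=> [[P _ hP] psi0 psiM].
have [Gu G1 GM GV] := is_subgroup_Gm d.
have coordM k (g h : 'M[C]_d) : Gm g -> Gm h -> gl_coord (g *m h) k = gl_coord g k * gl_coord h k.
  move=> Gg Gh; rewrite /gl_coord -(splitK k); case: (split k) => l /=.
    by case/mxvec_indexP: l => i j; rewrite !row_mxEl !mxvecE Gm_entryM.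
  by rewrite !row_mxEr ord1 !mxE eqxx !mulr1n det_mulmx invfM.
have [||||m _ hm] := @mult_function_independent C _ (@Gm C d) mulmx GM _ (msupp P)
   (fun m => P@_m) (fun m g => \prod_k gl_coord g k ^+ m k) psi 1%:M G1.
- exact: psi0.
- exact: psiM.
- move=> m g h Gg Gh; rewrite -big_split; apply: eq_bigr => k _.
  by rewrite coordM // exprMn.
- by move=> g Gg; rewrite hP // mevalE.
pose Mon (f : 'M[C]_d -> C) := exists a : 'I_d -> int, forall g, Gm g -> f g = \prod_i g i i ^ a i.
have Mon1 : Mon (fun=> 1).
  by exists (fun=> 0) => g _; rewrite big1 // => i _; rewrite expr0z.
have MonM f f' : Mon f -> Mon f' -> Mon (fun g => f g * f' g).
  move=> [a ha] [b hb]; exists (fun i => a i + b i) => g Gg.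
  rewrite ha // hb // -big_split; apply: eq_bigr => i _ /=.
  by rewrite expfzDr // Gm_entry_neq0.
have MonX f n : Mon f -> Mon (fun g => f g ^+ n).
  move=> [a ha]; exists (fun i => a i * n) => g Gg.
  by rewrite ha // -prodrXl; apply: eq_bigr => i _; rewrite exprnP exprz_exp.
suff [a ha] : Mon (fun g => \prod_k gl_coord g k ^+ m k) by exists a => g Gg; rewrite hm ?ha.
have Mon_k k : Mon (fun g => gl_coord g k ^+ m k).
  have [mk0|mk0] := posnP (m k).
    by case: Mon1 => a ha; exists a => g Gg; rewrite mk0 expr0; apply: ha.
  apply: MonX; move: mk0; rewrite -(splitK k); case: (split k) => l /=; last first.
    move=> _; exists (fun=> -1) => g Gg.
    rewrite /gl_coord row_mxEr ord1 mxE eqxx mulr1n.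
    have [_ /diag_mxP[a Ea]] := Gg; rewrite Ea det_diag -prodfV.
    by apply: eq_bigr => i _; rewrite mxE eqxx mulr1n.
  case/mxvec_indexP: l => i j mk0.
  have [ij|nij] := eqVneq i j.
    exists (fun l => (l == i)%:Z) => g Gg; rewrite /gl_coord row_mxEl mxvecE -ij.
    rewrite (bigD1 i) //= eqxx expr1z big1 ?mulr1 // => l li.
    by rewrite (negPf li) expr0z.
  have := psi0 _ G1; rewrite hm // (bigD1 (lshift 1 (mxvec_index i j))) //=.
  rewrite /gl_coord row_mxEl mxvecE mxE (negPf nij) mulr0n.
  by rewrite expr0n gtn_eqF // mul0r eqxx.
elim: (index_enum _) => [|k l IHl].
  by case: Mon1 => a ha; exists a => g Gg; rewrite big_nil; apply: ha.
have [a ha] := MonM _ _ (Mon_k k) IHl.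
by exists a => g Gg; rewrite big_cons ha.
Qed.

Lemma group_mor1 N M (G : 'M[C]_N -> Prop) (H : 'M[C]_M -> Prop) f :
  is_subgroup G -> subG H (fun h => h \in unitmx) -> group_mor any G H f -> f 1%:M = 1%:M.
Proof.
move=> [_ G1 _ _] Hu [GH fM _]; have fu := Hu _ (GH _ G1).
by rewrite -[LHS]mul1mx -(mulVmx fu) -mulmxA -fM // mulmx1 mulVmx.
Qed.

Lemma group_mor_detV N M (G : 'M[C]_N -> Prop) (H : 'M[C]_M -> Prop) f :
  is_subgroup G -> subG H (fun h => h \in unitmx) -> group_mor any G H f ->
  regular any G (fun g => (\det (f g))^-1).
Proof.
move=> Gs Hu fmor; have f1 := group_mor1 Gs Hu fmor.
have [Gu G1 GM GV] := Gs; have [GH fM freg] := fmor.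
apply: (@reg_ext _ _ _ (fun g => \det (f (invmx g)))) => [g Gg|].
  have E : f g *m f (invmx g) = 1%:M by rewrite -fM ?mulmxV ?Gu //; apply: GV.
  have := congr1 determinant E; rewrite det_mulmx det1 => Ed.
  have d0 : \det (f g) != 0 by rewrite -unitfE -unitmxE Hu //; apply: GH.
  by apply: (mulfI d0); rewrite Ed divff.
apply: reg_det => i j.
apply: (@reg_comp _ _ _ _ G invmx (fun g => f g i j)) => //.
  exact: regmx_inv.
apply: (@reg_ext _ _ _ (fun g => \det g)) => [g Gg|].
  by rewrite det_inv invrK.
by apply: reg_det; apply: regmx_id.
Qed.

Section TorusParametrization.
Context (N : nat) (S : 'M[C]_N -> Prop) (n : nat) (chi : 'I_n -> 'M[C]_N -> C).
Hypotheses (S_sub : is_subgroup S) (S_torus : exists d, group_iso any S (@Gm C d)).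
Hypothesis chi_basis : character_basis S chi.

(** An isomorphism with a diagonal group writes its diagonal entries as monomials in the chi, with
    exponents A, and the chi as monomials in the entries, with exponents b. Uniqueness of exponents
    in the basis chi gives [Ab], so arbitrary nonzero values y are realized by the point whose
    diagonal entries are the monomials y^A. *)
Lemma torus_parametrization : exists theta : ('I_n -> C) -> 'M[C]_N,
  [/\ forall y, (forall i, y i != 0) -> S (theta y) /\ forall i, chi i (theta y) = y i,
      forall s, S s -> theta (fun i => chi i s) = s &
      forall M (G : 'M[C]_M -> Prop) (y : 'M[C]_M -> 'I_n -> C),
        (forall i, regular any G (fun g => y g i)) ->
        (forall i, regular any G (fun g => (y g i)^-1)) ->
        (forall g i, G g -> y g i != 0) -> regular_mx G (fun g => theta (y g))].
Proof.
have [Su S1 SM SV] := S_sub; have [chi_char chi_span] := chi_basis.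
have chi0 i s : S s -> chi i s != 0 by have [_ h _] := chi_char i; apply: h.
have [d [u [u' [umor u'mor uK u'K]]]] := S_torus.
have [SG uM ureg] := umor; have [GS u'M u'reg] := u'mor.
have [Gu G1 GM GV] := is_subgroup_Gm d.
have u_char a : character any S (fun s => u s a a).
  split=> [|s Ss|s t Ss St]; first exact: ureg.
    exact/Gm_entry_neq0/SG.
  by rewrite uM // Gm_entryM //; apply: SG.
have exA a : exists A : {ffun 'I_n -> int}, forall s, S s -> u s a a = \prod_i chi i s ^ A i.
  by have [A [hA _]] := chi_span _ (u_char a); exists A.
have [A hA] := boolp.choice exA.
have exb i : exists b : 'I_d -> int, forall s, S s -> chi i s = \prod_a u s a a ^ b a.
  have [|b hb] := @Gm_character d (fun g => chi i (u' g)); last first.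
    by exists b => s Ss; rewrite -hb ?uK //; apply: SG.
  have [creg c0 cM] := chi_char i.
  split=> [|g Gg|g h Gg Gh]; last by rewrite u'M // cM //; apply: GS.
    apply: (reg_comp (H := S)) => //; exact: (group_mor_detV (is_subgroup_Gm d) Su u'mor).
  exact/c0/GS.
have [b hb] := boolp.choice exb.
have prod_exp (y : 'I_n -> C) (e : 'I_d -> int) : (forall i, y i != 0) ->
    \prod_a (\prod_l y l ^ A a l) ^ e a = \prod_l y l ^ (\sum_a A a l * e a).
  move=> y0; transitivity (\prod_a \prod_l y l ^ (A a l * e a)).
    apply: eq_bigr => a _.
    rewrite (big_morph (fun x => x ^ e a) (fun x y => expfzMl x y (e a)) (exp1rz _ _)).
    by apply: eq_bigr => l _; rewrite exprz_exp.
  rewrite exchange_big; apply: eq_bigr => l _ /=.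
  by elim/big_rec2: _ => [|a x z _ ->]; rewrite ?expr0z // expfzDr.
have Ab i l : \sum_a A a l * b i a = (l == i)%:Z.
  have [e [_ eu]] := chi_span _ (chi_char i).
  have E1 : e = [ffun l => \sum_a A a l * b i a].
    apply: eu => s Ss; rewrite hb //.
    rewrite (eq_bigr (fun a => (\prod_l chi l s ^ A a l) ^ b i a)); last first.
      by move=> a _; rewrite hA.
    rewrite prod_exp; last by move=> k; apply: chi0.
    by apply: eq_bigr => k _; rewrite ffunE.
  have E2 : e = [ffun l => (l == i)%:Z].
    apply: eu => s Ss; rewrite (bigD1 i) //= ffunE eqxx expr1z big1 ?mulr1 //.
    by move=> k ki; rewrite ffunE (negPf ki) expr0z.
  by have := congr1 (fun h : {ffun _} => h l) (etrans (esym E1) E2); rewrite !ffunE.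
pose D (y : 'I_n -> C) : 'M[C]_d := diag_mx (\row_a \prod_l y l ^ A a l).
have DG y : (forall i, y i != 0) -> Gm (D y).
  move=> y0; split; last exact: diag_mx_is_diag.
  rewrite unitmxE det_diag unitfE; apply/prodf_neq0 => a _; rewrite mxE.
  by apply/prodf_neq0 => l _; apply: expfz_neq0.
exists (fun y => u' (D y)); split.
- move=> y y0; have Gy := DG _ y0; split=> [|i]; first exact: GS.
  rewrite hb; last exact: GS.
  rewrite (eq_bigr (fun a => (\prod_l y l ^ A a l) ^ b i a)); last first.
    by move=> a _; rewrite u'K // !mxE eqxx mulr1n.
  rewrite prod_exp // (bigD1 i) //= Ab eqxx expr1z big1 ?mulr1 // => l li.
  by rewrite Ab (negPf li) expr0z.
- move=> s Ss; rewrite -[RHS]uK //; congr u'; have [_ /diag_mxP[e Ee]] := SG _ Ss.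
  rewrite Ee; congr diag_mx; apply/rowP => a; rewrite mxE -hA // Ee mxE eqxx mulr1n //.
- move=> M G y yreg yVreg y0.
  have expreg l (m : int) : regular any G (fun g => y g l ^ m).
    case: m => m; first exact: reg_exp.
    apply: (@reg_ext _ _ _ (fun g => (y g l)^-1 ^+ m.+1)) => [g _|]; last exact: reg_exp.
    by rewrite exprVn.
  move=> i j; apply: (@reg_comp _ _ _ _ (@Gm C d) (fun g => D (y g)) (fun g => u' g i j)) => //.
  + by move=> g Gg; apply: DG => l; apply: y0.
  + move=> a a'; have [<-|aa] := eqVneq a a'; last first.
      by apply: reg_ext (reg_const _ 0) => g _; rewrite !mxE (negPf aa).
    apply: (@reg_ext _ _ _ (fun g => \prod_l y g l ^ A a l)) => [g _|].
      by rewrite !mxE eqxx mulr1n.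
    by apply: reg_prod => l.
  apply: (@reg_ext _ _ _ (fun g => \prod_a \prod_l y g l ^ (- A a l))) => [g Gg|].
    rewrite det_diag -prodfV; apply: eq_bigr => a _; rewrite mxE -prodfV.
    by apply: eq_bigr => l _; rewrite invr_expz.
  by apply: reg_prod => a; apply: reg_prod => l.
Qed.

End TorusParametrization.
End CharactersOfTori.

(** * Coordinates on norm-one tori *)

Section Embeddings.
Context (K : fieldType) (C : closedFieldType) (iK : {rmorphism K -> C}).
Context (L : splittingFieldType K) (K0 : has_char0 K).

Lemma galois_top : galois 1%AS {:L}%AS.
Proof.
apply/and3P; split; [exact: subvf| |exact: normalFieldf].
apply/separableP => x _; apply: pcharf0_separable => n.
by rewrite (fmorph_pchar (in_alg L)) K0.
Qed.

Lemma card_gal_top : #|{: gal_of {:L}}| = \dim {:L}.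
Proof.
have := galois_dim galois_top; rewrite dimv1 divn1 => ->.
rewrite -cardsT; apply: eq_card => x; rewrite !inE gal_kAut ?sub1v //.
by rewrite kAut1E subvf.
Qed.

Lemma embedding_ex : exists iota : {rmorphism L -> C}, forall c : K, iota c%:A = iK c.
Proof.
have [_ sepL _] := and3P galois_top.
have [z genz] : exists z : L, <<1; z>>%VS = {:L}%VS.
  exists (separable_generator 1 {:L}); apply/esym.
  by rewrite {1}(eq_adjoin_separable_generator sepL (sub1v _)).
have /polyOver1P[Q EQ] := minPolyOver 1%AS z.
have [z' rz'] : exists z', root (map_poly iK Q) z'.
  apply: closed_rootP; rewrite size_map_poly -(size_map_poly (in_alg L)) -EQ size_minPoly.
  by rewrite /adjoin_degree.
have conj (P : {poly K}) : root (map_poly (in_alg L) P) z -> root (map_poly iK P) z'.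
  move=> rP; have : minPoly 1 z %| map_poly (in_alg L) P.
    by apply: minPoly_dvdp => //; apply/polyOver1P; exists P.
  by rewrite EQ dvdp_map => /dvdpP[A ->]; rewrite rmorphM rootM rz' orbT.
have rep x : exists P : {poly K}, x = (map_poly (in_alg L) P).[z].
  have /polyOver1P[P EP] := Fadjoin_polyOver 1%AS z x.
  by exists P; rewrite -EP Fadjoin_poly_eq // genz memvf.
have ex x : exists w, exists2 P : {poly K}, x = (map_poly (in_alg L) P).[z] & w = (map_poly iK P).[z'].
  by have [P ->] := rep x; exists (map_poly iK P).[z'], P.
have [f hf] := boolp.choice ex.
have E x (P : {poly K}) : x = (map_poly (in_alg L) P).[z] -> f x = (map_poly iK P).[z'].
  have [R -> ->] := hf x => EP; apply/eqP; rewrite -subr_eq0 -hornerN -hornerD -rmorphB.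
  by apply: conj; rewrite /root rmorphB hornerD hornerN EP subrr.
have fB : zmod_morphism f.
  move=> x y; have [[P EP] [R ER]] := (rep x, rep y).
  rewrite (E _ P EP) (E _ R ER) (E _ (P - R)) rmorphB hornerD hornerN //.
  by rewrite -EP -ER.
have fM : monoid_morphism f.
  split=> [|x y]; first by rewrite (E _ 1) rmorph1 hornerC.
  have [[P EP] [R ER]] := (rep x, rep y).
  rewrite (E _ P EP) (E _ R ER) (E _ (P * R)) rmorphM hornerM //.
  by rewrite -EP -ER.
pose iota : {rmorphism L -> C} := HB.pack f
  (GRing.isZmodMorphism.Build L C f fB) (GRing.isMonoidMorphism.Build L C f fM).
exists iota => c; rewrite [LHS](E _ c%:P) map_polyC hornerC //.
Qed.

Section Coordinates.
Context (iota : {rmorphism L -> C}) (iotaK : forall c : K, iota c%:A = iK c).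
Local Notation gal := (gal_of {:L}).
Local Notation d := (\dim {:L}).
Local Notation vb := (vbasis {:L}).

Lemma iota_scal c x : iota (c *: x) = iK c * iota x.
Proof. by rewrite -iotaK -rmorphM mulr_algl. Qed.

Definition emb_col (u : L -> C) : 'cV[C]_d := \col_b u vb`_b.

Lemma emb_inj (rho rho' : gal) : (forall x, iota (rho x) = iota (rho' x)) -> rho = rho'.
Proof. by move=> h; apply/eqP/gal_eqP => x _; apply: (fmorph_inj iota). Qed.

(** The values iota (rho b), for b in a K-basis of L, form a square matrix because L/K is Galois,
    and it is invertible by independence of embeddings. The rows of its inverse are the w. *)
Lemma dual_basis_ex : exists w : gal -> 'rV[C]_d,
  (forall rho rho' : gal, w rho *m emb_col (fun x => iota (rho' x)) = (rho == rho')%:R%:M) /\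
  \sum_(rho : gal) emb_col (fun x => iota (rho x)) *m w rho = 1%:M.
Proof.
pose e (j : 'I_d) : gal := enum_val (cast_ord (esym card_gal_top) j).
pose e' (rho : gal) : 'I_d := cast_ord card_gal_top (enum_rank rho).
have eK : cancel e e' by move=> j; rewrite /e /e' enum_valK cast_ordKV.
have e'K : cancel e' e by move=> rho; rewrite /e /e' cast_ordK enum_rankK.
pose Om : 'M[C]_d := \matrix_(b, j) iota (e j vb`_b).
have OmU : Om \in unitmx.
  rewrite -unitmx_tr -row_free_unit -kermx_eq0; apply: contraT => /rowV0Pn[c].
  move=> /sub_kermxP cO /rV0Pn[j0 cj0].
  have rel x : \sum_j c 0 j * iota (e j x) = 0.
    rewrite (coord_vbasis (memvf x)).
    transitivity (\sum_b iK (coord vb b x) * \sum_j c 0 j * iota (e j vb`_b)).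
      under eq_bigr => j _ do rewrite linear_sum rmorph_sum mulr_sumr.
      rewrite exchange_big; apply: eq_bigr => b _; rewrite mulr_sumr; apply: eq_bigr => j _.
      by rewrite linearZ /= iota_scal mulrCA.
    rewrite big1 // => b _; have /rowP/(_ b) := cO; rewrite !mxE => E.
    by rewrite (eq_bigr (fun j => c 0 j * Om^T j b)) ?E ?mulr0 // => j _; rewrite !mxE.
  have [|||||j] := @mult_function_independent C L (fun=> True) ( *%R) _ 'I_d
    [seq j <- enum 'I_d | j != j0] (fun j => - c 0 j / c 0 j0) (fun j x => iota (e j x))
    (fun x => iota (e j0 x)) 1 I.
  - by [].
  - by rewrite !rmorph1 oner_eq0.
  - by move=> x y _ _; rewrite !rmorphM.
  - by move=> j x y _ _; rewrite !rmorphM.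
  - move=> x _; rewrite big_filter big_enum_cond /=.
    have := rel x; rewrite (bigD1 j0) //= => /eqP; rewrite addr_eq0 => /eqP E.
    apply: (mulfI cj0); rewrite E -sumrN mulr_sumr; apply: eq_bigr => j _.
    by field.
  rewrite mem_filter => /andP[jj0 _] /(_ _ I) E.
  by move: jj0; rewrite -(can_eq eK) (emb_inj E) eqxx.
exists (fun rho => row (e' rho) (invmx Om)); split.
  move=> rho rho'; apply/matrixP => i j; rewrite !ord1.
  have -> : emb_col (fun x => iota (rho' x)) = col (e' rho') Om.
    by apply/colP => b; rewrite !mxE e'K.
  rewrite -row_mul -[in RHS](can_eq e'K).
  have := congr1 (fun A : 'M_d => A (e' rho) (e' rho')) (mulVmx OmU).
  by rewrite !mxE eqxx mulr1n => <-; apply: eq_bigr => k _; rewrite !mxE.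
rewrite -(mulmxV OmU); apply/matrixP => a b; rewrite !mxE summxE (reindex e) /=.
  by apply: eq_bigr => j _; rewrite !mxE big_ord1 !mxE eK.
by exists e'; move=> x _; rewrite ?eK ?e'K.
Qed.

(** The dual basis expands u as a linear combination of the embeddings iota rho; independence forces
    u to be one of them. *)
Lemma embedding_galois (u : {rmorphism L -> C}) : (forall c : K, u c%:A = iK c) ->
  exists rho : gal, forall x, u x = iota (rho x).
Proof.
move=> uK; have [w [_ w1]] := dual_basis_ex.
pose c (rho : gal) := (w rho *m emb_col u) 0 0.
have rel x : u x = \sum_(rho : gal) c rho * iota (rho x).
  have E (b : 'I_d) : u vb`_b = \sum_(rho : gal) c rho * iota (rho vb`_b).
    have /colP/(_ b) := mul1mx (emb_col u); rewrite -w1 mulmx_suml summxE mxE => <-.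
    apply: eq_bigr => rho _; rewrite -mulmxA mxE big_ord1 mxE mulrC.
    by rewrite /c.
  rewrite (coord_vbasis (memvf x)) rmorph_sum.
  transitivity (\sum_b iK (coord vb b x) * u vb`_b).
    by apply: eq_bigr => b _; rewrite -uK -rmorphM mulr_algl.
  under [RHS]eq_bigr => rho _ do rewrite linear_sum rmorph_sum mulr_sumr.
  rewrite exchange_big; apply: eq_bigr => b _; rewrite E mulr_sumr; apply: eq_bigr => rho _.
  by rewrite linearZ /= iota_scal mulrCA.
have [|||||rho _ h] := @mult_function_independent C L (fun=> True) ( *%R) _ gal
    (index_enum gal) c (fun rho x => iota (rho x)) u 1 I.
- by [].
- by rewrite rmorph1 oner_eq0.
- by move=> x y _ _; rewrite !rmorphM.
- by move=> j x y _ _; rewrite !rmorphM.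
- by move=> x _; apply: rel.
by exists rho => x; apply: h.
Qed.

End Coordinates.
End Embeddings.

(** * Frames of projections, their sums and block-diagonal products *)

Section Frames.
Context (C : closedFieldType).

(* Matrices of the projections onto the lines of a decomposition of C^M. *)
Definition is_frame (I : finType) M (B : I -> 'M[C]_M) :=
  [/\ forall i j, B i *m B j = (i == j)%:R *: B i, \sum_i B i = 1%:M & forall i, \tr (B i) = 1].

Definition frame_mx (I : finType) M (B : I -> 'M[C]_M) (y : I -> C) := \sum_i y i *: B i.

Definition frame_group (I : finType) M (B : I -> 'M[C]_M) (Y : (I -> C) -> Prop) h :=
  exists2 y, Y y & h = frame_mx B y.

Lemma frame_mxM (I : finType) M (B : I -> 'M[C]_M) y z : is_frame B ->
  frame_mx B y *m frame_mx B z = frame_mx B (fun i => y i * z i).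
Proof.
move=> [BB _ _]; rewrite mulmx_suml; apply: eq_bigr => i _.
rewrite mulmx_sumr (bigD1 i) //= big1 ?addr0 => [|j ji].
  by rewrite -scalemxAl -scalemxAr BB eqxx scale1r scalerA.
by rewrite -scalemxAl -scalemxAr BB eq_sym (negPf ji) scale0r !scaler0.
Qed.

Lemma frame_coord (I : finType) M (B : I -> 'M[C]_M) y i : is_frame B ->
  \tr (B i *m frame_mx B y) = y i.
Proof.
move=> [BB _ Btr]; rewrite mulmx_sumr (bigD1 i) //= big1 ?addr0 => [|j ji].
  by rewrite -scalemxAr BB eqxx scale1r mxtraceZ Btr mulr1.
by rewrite -scalemxAr BB eq_sym (negPf ji) scale0r scaler0.
Qed.

Lemma frame_mx1 (I : finType) M (B : I -> 'M[C]_M) : is_frame B -> frame_mx B (fun=> 1) = 1%:M.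
Proof. by move=> [_ B1 _]; rewrite -B1; apply: eq_bigr => i _; rewrite scale1r. Qed.

Section Sum.
Context (I1 I2 : finType) (M1 M2 : nat) (B1 : I1 -> 'M[C]_M1) (B2 : I2 -> 'M[C]_M2).

Definition sum_frame (x : I1 + I2) : 'M[C]_(M1 + M2) :=
  match x with inl i => block_mx (B1 i) 0 0 0 | inr i => block_mx 0 0 0 (B2 i) end.

Lemma sum_frame_mx y : frame_mx sum_frame y =
  block_mx (frame_mx B1 (y \o inl)) 0 0 (frame_mx B2 (y \o inr)).
Proof.
have E1 (z : I1 -> C) : \sum_i z i *: block_mx (B1 i) 0 0 (0 : 'M_M2) = block_mx (frame_mx B1 z) 0 0 0.
  rewrite /frame_mx; elim/big_rec2: _ => [|i a b _ ->]; first by rewrite block_mx0.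
  by rewrite scale_block_mx add_block_mx !scaler0 !addr0.
have E2 (z : I2 -> C) : \sum_i z i *: block_mx (0 : 'M_M1) 0 0 (B2 i) = block_mx 0 0 0 (frame_mx B2 z).
  rewrite /frame_mx; elim/big_rec2: _ => [|i a b _ ->]; first by rewrite block_mx0.
  by rewrite scale_block_mx add_block_mx !scaler0 !addr0.
by rewrite /frame_mx big_sumType /= E1 E2 add_block_mx !addr0 !add0r.
Qed.

Lemma sum_frameP : is_frame B1 -> is_frame B2 -> is_frame sum_frame.
Proof.
move=> F1 F2; have [BB1 S1 T1] := F1; have [BB2 S2 T2] := F2; split.
- move=> [i|i] [j|j] /=; rewrite mulmx_block !mulmx0 !mul0mx !addr0 ?add0r ?mul0mx ?mulmx0 ?addr0.
  + by rewrite BB1 scale_block_mx !scaler0.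
  + by rewrite block_mx0 scale0r.
  + by rewrite block_mx0 scale0r.
  + by rewrite BB2 scale_block_mx !scaler0.
- have -> : \sum_i sum_frame i = frame_mx sum_frame (fun=> 1).
    by apply: eq_bigr => i _; rewrite scale1r.
  by rewrite sum_frame_mx /= !frame_mx1 // -scalar_mx_block.
- by move=> [i|i]; rewrite /= mxtrace_block ?T1 ?T2 mxtrace0 ?addr0 ?add0r.
Qed.

Lemma sum_frame_group Y1 Y2 (G1 : 'M[C]_M1 -> Prop) (G2 : 'M[C]_M2 -> Prop) :
  (forall h, G1 h <-> frame_group B1 Y1 h) -> (forall h, G2 h <-> frame_group B2 Y2 h) ->
  forall h, prod_group G1 G2 h <->
    frame_group sum_frame (fun y => Y1 (y \o inl) /\ Y2 (y \o inr)) h.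
Proof.
move=> H1 H2 h; split=> [[a [b [/H1[y hy ->] /H2[z hz ->] ->]]]|[y [hy hz] ->]].
  exists (fun x => match x with inl i => y i | inr i => z i end) => //.
  by rewrite sum_frame_mx.
rewrite sum_frame_mx; exists (frame_mx B1 (y \o inl)), (frame_mx B2 (y \o inr)); split=> //.
  by apply/H1; exists (y \o inl).
by apply/H2; exists (y \o inr).
Qed.

Lemma sum_frame_map (gam : {rmorphism C -> C}) (f1 : I1 -> I1) (f2 : I2 -> I2) :
  (forall i, map_mx gam (B1 i) = B1 (f1 i)) -> (forall i, map_mx gam (B2 i) = B2 (f2 i)) ->
  forall x, map_mx gam (sum_frame x) =
    sum_frame (match x with inl i => inl (f1 i) | inr i => inr (f2 i) end).
Proof. by move=> h1 h2 [i|i]; rewrite /= map_block_mx ?h1 ?h2 !map_mx0. Qed.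

End Sum.

Lemma mul_mxdiag_mxdiag j (N : 'I_j -> nat) (A B : forall k, 'M[C]_(N k)) :
  \mxdiag_k A k *m \mxdiag_k B k = \mxdiag_k (A k *m B k).
Proof.
rewrite {2 3}/mxdiag mul_mxdiag_mxblock; apply/eq_mxblock => i k.
case: eqVneq => [->|_]; rewrite ?mulmx0 ?conform_mx_id; reflexivity.
Qed.

Lemma scale_mxdiag j (N : 'I_j -> nat) a (A : forall k, 'M[C]_(N k)) :
  a *: \mxdiag_k A k = \mxdiag_k (a *: A k).
Proof.
rewrite -mul_scalar_mx -mxdiagZ mul_mxdiag_mxdiag.
by apply: eq_mxdiag => k; rewrite mul_scalar_mx.
Qed.

Lemma map_mxdiag j (N : 'I_j -> nat) (gam : {rmorphism C -> C}) (A : forall k, 'M[C]_(N k)) :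
  map_mx gam (\mxdiag_k A k) = \mxdiag_k map_mx gam (A k).
Proof.
apply/matrixP => a b; rewrite !mxE; case: (_ == _); last by rewrite !mxE rmorph0.
by rewrite -(map_mx0 gam) -map_conform_mx mxE map_mx0.
Qed.

Section BigProd.
Context (j : nat) (N : 'I_j -> nat) (I : 'I_j -> finType) (B : forall k, I k -> 'M[C]_(N k)).

Definition single_block k (A : 'M[C]_(N k)) : 'M[C]_(\sum_k N k) :=
  \mxdiag_l dfwith (fun l => 0 : 'M[C]_(N l)) A l.

Lemma single_blockM k (A A' : 'M[C]_(N k)) :
  single_block A *m single_block A' = single_block (A *m A').
Proof.
rewrite /single_block mul_mxdiag_mxdiag; apply: eq_mxdiag => l.
have [<-|kl] := eqVneq k l; first by rewrite !dfwith_in.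
by rewrite !dfwith_out // mulmx0.
Qed.

Lemma single_blockM0 k l (A : 'M[C]_(N k)) (A' : 'M[C]_(N l)) : k != l ->
  single_block A *m single_block A' = 0.
Proof.
move=> kl; rewrite /single_block mul_mxdiag_mxdiag -[RHS]mxdiag0; apply: eq_mxdiag => i.
have [<-|ki] := eqVneq k i; last by rewrite dfwith_out // mul0mx.
by rewrite [X in _ *m X]dfwith_out ?mulmx0 // eq_sym.
Qed.

Lemma single_block_sum k (J : finType) (y : J -> C) (A : J -> 'M[C]_(N k)) :
  \sum_i y i *: single_block (A i) = single_block (\sum_i y i *: A i).
Proof.
rewrite /single_block; transitivity (\sum_i \mxdiag_l (y i *: dfwith (fun l => 0 : 'M[C]_(N l)) (A i) l)).
  by apply: eq_bigr => i _; rewrite scale_mxdiag.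
rewrite -mxdiag_sum; apply: eq_mxdiag => l.
have [<-|kl] := eqVneq k l.
  by rewrite dfwith_in; apply: eq_bigr => i _; rewrite dfwith_in.
by rewrite dfwith_out // big1 // => i _; rewrite dfwith_out // scaler0.
Qed.

Lemma sum_single_block (A : forall k, 'M[C]_(N k)) :
  \sum_k single_block (A k) = \mxdiag_k A k.
Proof.
rewrite /single_block -mxdiag_sum; apply: eq_mxdiag => l.
rewrite (bigD1 l) //= dfwith_in big1 ?addr0 // => k kl.
by rewrite dfwith_out.
Qed.

Lemma single_block_tr k (A : 'M[C]_(N k)) : \tr (single_block A) = \tr A.
Proof.
rewrite /single_block mxtrace_mxdiag (bigD1 k) //= dfwith_in big1 ?addr0 // => l lk.
by rewrite dfwith_out ?mxtrace0 // eq_sym.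
Qed.

Definition big_frame (x : {k : 'I_j & I k}) : 'M[C]_(\sum_k N k) :=
  single_block (B (tagged x)).

Lemma big_frame_mx y : frame_mx big_frame y =
  \mxdiag_k frame_mx (@B k) (fun i => y (Tagged I i)).
Proof.
rewrite -sum_single_block /frame_mx; apply/esym.
transitivity (\sum_k \sum_(i : I k) y (Tagged I i) *: single_block (B i)).
  by apply: eq_bigr => k _; rewrite single_block_sum.
rewrite sig_big_dep /=; apply: eq_bigr => x _.
by case: x => k i.
Qed.

Lemma big_frameP : (forall k, is_frame (@B k)) -> is_frame big_frame.
Proof.
move=> F; split.
- move=> [k i] [l i']; rewrite /big_frame /=; have [kl|kl] := eqVneq k l.
    case: _ / kl in i' *; rewrite single_blockM; have [-> _ _] := F k.
    rewrite eq_Tagged /=; case: eqVneq => _; rewrite ?scale1r // !scale0r.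
    rewrite /single_block -[RHS]mxdiag0; apply: eq_mxdiag => m.
    by have [<-|km] := eqVneq k m; rewrite ?dfwith_in ?dfwith_out.
  rewrite single_blockM0 // (_ : (_ == _) = false) ?scale0r //.
  by apply/negbTE; apply: contra kl => /eqP/(congr1 tag)/= ->.
- have -> : \sum_i big_frame i = frame_mx big_frame (fun=> 1).
    by apply: eq_bigr => i _; rewrite scale1r.
  rewrite big_frame_mx -mxdiagZ; apply: eq_mxdiag => k.
  by rewrite frame_mx1.
- by move=> [k i]; rewrite /big_frame single_block_tr; have [_ _ ->] := F k.
Qed.

Lemma big_frame_group (Y : forall k, (I k -> C) -> Prop) (G : forall k, 'M[C]_(N k) -> Prop) :
  (forall k h, G k h <-> frame_group (@B k) (Y k) h) ->
  forall h, bigprod_group G h <->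
    frame_group big_frame (fun y => forall k, Y k (fun i => y (Tagged I i))) h.
Proof.
move=> H h; split=> [[g Gg ->]|[y hy ->]].
  have ex k : exists y, Y k y /\ g k = frame_mx (@B k) y.
    by have /H[y hy ->] := Gg k; exists y.
  have yk k := boolp.cid (ex k).
  exists (fun x => sval (yk (tag x)) (tagged x)) => [k|].
    by case: (svalP (yk k)).
  rewrite big_frame_mx; apply: eq_mxdiag => k.
  by case: (svalP (yk k)).
exists (fun k => frame_mx (@B k) (fun i => y (Tagged I i))); last exact: big_frame_mx.
by move=> k; apply/H; exists (fun i => y (Tagged I i)).
Qed.

Lemma big_frame_map (gam : {rmorphism C -> C}) (f : forall k, I k -> I k) :
  (forall k i, map_mx gam (@B k i) = B (f k i)) ->
  forall x, map_mx gam (big_frame x) = big_frame (Tagged I (f _ (tagged x))).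
Proof.
move=> h [k i]; rewrite /big_frame /single_block /= map_mxdiag; apply: eq_mxdiag => l.
have [<-|kl] := eqVneq k l; first by rewrite !dfwith_in h.
by rewrite !dfwith_out // map_mx0.
Qed.

End BigProd.
End Frames.

(** * Norm-one tori in the frame of embeddings *)

Section NormOneFrame.
Context (Qp : fieldType) (K : fieldExtType Qp) (C : closedFieldType) (iK : {rmorphism K -> C}).
Context (L : splittingFieldType K) (K0 : has_char0 K).
Context (iota : {rmorphism L -> C}) (iotaK : forall c : K, iota c%:A = iK c).
Local Notation gal := (gal_of {:L}).
Local Notation d := (\dim {:L}).
Local Notation vb := (vbasis {:L}).
Local Notation omega rho := (emb_col (fun x => iota (rho x))).

(** Consequently the vectors [omega rho] are common eigenvectors of the multiplications of L,
    multiplication by a having eigenvalue iota (rho a), and the matrices of Galois elements permute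
    them. *)
Lemma lin_mat_col (f : 'End(L)) (rho : gal) :
  lin_mat iK f *m omega rho = emb_col (fun x => iota (rho (f x))).
Proof.
apply/colP => b; rewrite !mxE [f vb`_b](coord_vbasis (memvf _)) linear_sum rmorph_sum.
apply: eq_bigr => k _; rewrite !mxE linearZ /= (iota_scal iotaK); congr (iK _ * _).
by rewrite /= passmx.vecof_delta.
Qed.

Context (w : gal -> 'rV[C]_d).
Hypothesis w_dual : forall rho rho' : gal, w rho *m omega rho' = (rho == rho')%:R%:M.
Hypothesis w_sum : \sum_(rho : gal) omega rho *m w rho = 1%:M.

Lemma emb_col_ext m (X Y : 'M[C]_(m, d)) :
  (forall rho : gal, X *m omega rho = Y *m omega rho) -> X = Y.
Proof.
move=> h; rewrite -[X]mulmx1 -[Y]mulmx1 -w_sum !mulmx_sumr.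
by apply: eq_bigr => rho _; rewrite !mulmxA h.
Qed.

Definition emb_proj (rho : gal) : 'M[C]_d := omega rho *m w rho.

Lemma emb_proj_col (rho rho' : gal) :
  emb_proj rho *m omega rho' = (rho == rho')%:R *: omega rho.
Proof. by rewrite -mulmxA w_dual mul_mx_scalar. Qed.

Lemma emb_frameP : is_frame emb_proj.
Proof.
split=> [rho rho'||rho]; last 1 first.
- by rewrite /emb_proj mxtrace_mulC w_dual eqxx mxtrace1.
- rewrite /emb_proj mulmxA -[omega rho *m _ *m _]mulmxA w_dual mul_mx_scalar -scalemxAl.
  by case: eqVneq => [->|_]; rewrite ?scale0r.
- exact: w_sum.
Qed.

Lemma emb_frame_col y (rho : gal) : frame_mx emb_proj y *m omega rho = y rho *: omega rho.
Proof.
rewrite mulmx_suml (bigD1 rho) //= big1 ?addr0 => [|rho' ne].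
  by rewrite -scalemxAl emb_proj_col eqxx scale1r.
by rewrite -scalemxAl emb_proj_col (negPf ne) scale0r scaler0.
Qed.

(** If gam iota = iota t, then gam sends [omega s] to [omega (s * t)]. The projections are
    determined by their values on these vectors, so they are permuted in the same way. *)
Lemma emb_proj_map (gam : {rmorphism C -> C}) (rho rho' : gal) :
  fixes_base iK gam -> (forall x, gam (iota (rho x)) = iota (rho' x)) ->
  map_mx gam (emb_proj rho) = emb_proj rho'.
Proof.
move=> hg hrho.
have colE (s s' : gal) : (forall x, gam (iota (s x)) = iota (s' x)) ->
    map_mx gam (omega s) = omega s' by move=> h; apply/colP => b; rewrite !mxE h.
have [|t ht] := @embedding_galois _ _ _ _ K0 _ iotaK (gam \o iota).
  by move=> c /=; rewrite iotaK hg.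
apply: emb_col_ext => s'; pose s := (s' * t^-1)%g.
have hs x : gam (iota (s x)) = iota (s' x).
  have -> : gam (iota (s x)) = iota (t (s x)) := ht (s x).
  by rewrite -galM ?memvf // /s mulgKV.
rewrite emb_proj_col -(colE s s' hs) -map_mxM emb_proj_col map_mxZ (colE _ _ hrho) rmorph_nat.
have -> // : (rho == s) = (rho' == s').
apply/eqP/eqP => [E|E].
  by apply: (emb_inj (iota := iota)) => x; rewrite -hrho E hs.
apply: (emb_inj (iota := iota)) => x; apply: (fmorph_inj gam).
by rewrite hrho hs E.
Qed.

Lemma gal_mat_conj y (x : gal) : let R := lin_mat iK (gal_repr x) in
  R \in unitmx /\ invmx R *m frame_mx emb_proj y *m R = frame_mx emb_proj (fun rho => y (x * rho)%g).
Proof.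
move=> R; have colR (t rho : gal) : lin_mat iK (gal_repr t) *m omega rho = omega (t * rho)%g.
  by rewrite lin_mat_col; apply/colP => b; rewrite !mxE galM ?memvf.
have RU : R \in unitmx.
  apply: (proj1 (mulmx1_unit (B := lin_mat iK (gal_repr (x^-1)%g)) _)).
  by apply: emb_col_ext => rho; rewrite -mulmxA !colR mulgA mulgV mul1g mul1mx.
split=> //; apply: (can_inj (mulKmx RU)); rewrite -mulmxA mulKVmx //.
apply: emb_col_ext => rho; rewrite -!mulmxA colR !emb_frame_col -scalemxAr colR //.
Qed.

Definition norm_one_coords (M : {subfield L}) (y : gal -> C) : Prop :=
  forall rho : gal, \prod_(x in 'Gal({:L} / M)%g) y (x * rho)%g = 1.

Lemma norm_one_neq0 M y rho : norm_one_coords M y -> y rho != 0.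
Proof.
move=> /(_ rho); rewrite (bigD1 1%g) ?group1 //= mul1g => E.
by apply: contra_eq_neq E => ->; rewrite mul0r eq_sym oner_eq0.
Qed.

(** A matrix commuting with the multiplications is diagonal on their common eigenvectors, because
    distinct embeddings differ at some a. By [gal_mat_conj], the norm equation then says that the
    product of the coordinates over each coset Gal(L/M) rho is 1. *)
Lemma resU1_frame (M : {subfield L}) h :
  resU1 iK M h <-> frame_group emb_proj (norm_one_coords M) h.
Proof.
have frame_inj y z : frame_mx emb_proj y = frame_mx emb_proj z -> y =1 z.
  by move=> E rho; rewrite -(frame_coord y rho emb_frameP) E frame_coord //; apply: emb_frameP.
have normE y : \big[mulmx/1%:M]_(x in ('Gal({:L} / M))%g)
   (invmx (lin_mat iK (gal_repr x)) *m frame_mx emb_proj y *m lin_mat iK (gal_repr x)) =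
   frame_mx emb_proj (fun rho => \prod_(x in 'Gal({:L} / M)%g) y (x * rho)%g).
  elim: (index_enum _) => [|x l IHl].
    rewrite big_nil -(frame_mx1 emb_frameP); apply: eq_bigr => rho _.
    by rewrite big_nil.
  rewrite big_cons; case: ifP => hx.
    rewrite IHl (gal_mat_conj y x).2 frame_mxM; last exact: emb_frameP.
    by apply: eq_bigr => rho _; rewrite big_cons hx.
  by rewrite IHl; apply: eq_bigr => rho _; rewrite big_cons hx.
split=> [[hu hcomm hnorm]|[y hy ->]].
  pose y (rho : gal) := (w rho *m h *m omega rho) 0 0.
  have hcol (rho : gal) : h *m omega rho = y rho *: omega rho.
    have eigen (a : L) (rho' : gal) : (iota (rho a) - iota (rho' a)) * (w rho' *m h *m omega rho) 0 0 = 0.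
      have colA (s : gal) : lin_mat iK (amulr a) *m omega s = iota (s a) *: omega s.
        rewrite lin_mat_col; apply/colP => b; rewrite !mxE lfunE /= !rmorphM mulrC //.
      have rowA (s : gal) : w s *m lin_mat iK (amulr a) = iota (s a) *: w s.
        apply: emb_col_ext => s'; rewrite -mulmxA colA -scalemxAr -scalemxAl w_dual.
        by case: eqVneq => [->//|_]; rewrite scale_scalar_mx mulr0 scale_scalar_mx mulr0.
      have := congr1 (fun X => w rho' *m X *m omega rho) (hcomm a).
      rewrite !mulmxA rowA -!mulmxA colA -!scalemxAr -!scalemxAl !mulmxA.
      by move=> /matrixP/(_ 0 0); rewrite !mxE => E; rewrite mulrBl E subrr.
    rewrite -[h *m _]mul1mx -w_sum mulmx_suml (bigD1 rho) //= big1 ?addr0.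
      rewrite -!mulmxA [w rho *m _]mx11_scalar mul_mx_scalar /y !mulmxA //.
    move=> rho' ne; rewrite -!mulmxA [w rho' *m _]mx11_scalar mul_mx_scalar.
    suff -> : (w rho' *m (h *m omega rho)) 0 0 = 0 by rewrite scale0r.
    have [a na] : exists a : L, iota (rho a) != iota (rho' a).
      apply: boolp.contrapT => na; move/eqP: ne; apply; apply: (emb_inj (iota := iota)) => x.
      by apply/eqP; apply: contraT => nx; case: na; exists x; rewrite eq_sym.
    apply: (mulfI (x := iota (rho a) - iota (rho' a))); first by rewrite subr_eq0.
    by rewrite mulr0 mulmxA eigen.
  have Eh : h = frame_mx emb_proj y.
    by apply: emb_col_ext => rho; rewrite hcol emb_frame_col.
  exists y => //; move: hnorm; rewrite Eh normE -(frame_mx1 emb_frameP) => /frame_inj h1 rho.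
  exact: h1.
split.
- apply: (proj1 (mulmx1_unit (B := frame_mx emb_proj (fun rho => (y rho)^-1)) _)).
  rewrite frame_mxM; last exact: emb_frameP.
  rewrite -(frame_mx1 emb_frameP); apply: eq_bigr => rho _.
  by rewrite divff // (norm_one_neq0 rho hy).
- move=> a; apply: emb_col_ext => rho; rewrite -!mulmxA emb_frame_col.
  have -> : lin_mat iK (amulr a) *m omega rho = iota (rho a) *: omega rho.
    by rewrite lin_mat_col; apply/colP => b; rewrite !mxE lfunE /= !rmorphM mulrC.
  rewrite -!scalemxAr emb_frame_col.
  rewrite lin_mat_col scalerA mulrC -scalerA; congr (_ *: _).
  by apply/colP => b; rewrite !mxE lfunE /= !rmorphM mulrC.
- rewrite normE -(frame_mx1 emb_frameP); apply: eq_bigr => rho _.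
  by rewrite hy.
Qed.

End NormOneFrame.

(** * Comparison of tori by their Galois actions *)

Section TorusFrameIso.
Context (K : fieldType) (C : closedFieldType) (iK : {rmorphism K -> C}).
Hypotheses (K_alg : forall x : C, algebraicOver iK x) (K0 : has_char0 K).
Local Notation rat := (fun x : C => exists c, x = iK c).
Context (D : {rmorphism C -> C} -> Prop).
Hypothesis D_base : forall gam, D gam -> fixes_base iK gam.
Hypothesis D_fixed : forall x, (forall gam, D gam -> gam x = x) -> exists c, x = iK c.
Context (N : nat) (T : 'M[C]_N -> Prop) (n : nat) (psi : 'I_n -> 'M[C]_N -> C).
Hypotheses (T_closed : closed_group rat T) (T_torus : exists d, group_iso (@anyC C) T (@Gm C d)).
Hypothesis psi_basis : character_basis T psi.
Context (I : finType) (M : nat) (B : I -> 'M[C]_M) (Y : (I -> C) -> Prop) (H : 'M[C]_M -> Prop).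
Hypotheses (B_frame : is_frame B) (HE : forall h, H h <-> frame_group B Y h).
Context (idx : I -> 'I_n) (sgn : I -> bool) (sec : 'I_n -> I).

(** A frame has more coordinates than the torus has dimensions: for T_s there are 4r coordinates in
    dimension 2r, each character occurring once as itself and once inverted. [sec] picks an
    uninverted occurrence. *)
Definition signed_coords (z : 'I_n -> C) (i : I) : C :=
  if sgn i then (z (idx i))^-1 else z (idx i).

Hypothesis Y_signed : forall z, (forall l, z l != 0) -> Y (signed_coords z).
Hypothesis Y_neq0 : forall y i, Y y -> y i != 0.
Hypothesis Y_sec : forall y i, Y y -> y i = signed_coords (y \o sec) i.
Hypothesis sec_idx : forall l, idx (sec l) = l.
Hypothesis sec_sgn : forall l, sgn (sec l) = false.
Hypothesis D_perm : forall gam, D gam -> exists pi : I -> I,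
  (forall i, map_mx gam (B i) = B (pi i)) /\
  forall i t, T t -> gam (signed_coords (psi^~ t) i) = signed_coords (psi^~ (map_mx gam t)) (pi i).

(** The framed matrix with coordinates psi_l(t) or their inverses depends regularly on t, and
    [torus_parametrization] inverts this map. By [D_perm] it commutes with D, so [regular_descent]
    applies in both directions. *)
Lemma torus_frame_iso : group_iso rat T H.
Proof.
have [T_sub _] := T_closed; have [Tu T1 TM TV] := T_sub.
have [psi_char _] := psi_basis.
have psi0 l t : T t -> psi l t != 0 by have [_ h _] := psi_char l; apply: h.
have psiM l t u : T t -> T u -> psi l (t *m u) = psi l t * psi l u.
  by have [_ _ h] := psi_char l; apply: h.
have psi_reg l : regular (@anyC C) T (psi l) by have [h _ _] := psi_char l.
have psi1 l : psi l 1%:M = 1.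
  by apply: (mulfI (psi0 l _ T1)); rewrite -psiM // mul1mx mulr1.
have psiV_reg l : regular (@anyC C) T (fun t => (psi l t)^-1).
  apply: (@reg_ext _ _ _ (fun t => psi l (invmx t))) => [t Tt|].
    have p0 := psi0 l _ Tt; apply: (mulfI p0); rewrite divff //.
    by rewrite -psiM //; [rewrite mulmxV ?psi1 //; apply: Tu | apply: TV].
  apply: (reg_comp (H := T)) => //; first exact: regmx_inv.
  apply: (@reg_ext _ _ _ (fun t => \det t)) => [t Tt|]; first by rewrite det_inv invrK.
  by apply: reg_det; apply: regmx_id.
have [theta [thetaP thetaK theta_reg]] := torus_parametrization T_sub T_torus psi_basis.
pose f t := frame_mx B (signed_coords (psi^~ t)).
pose y h l := \tr (B (sec l) *m h).
pose f' h := theta (y h).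
have fT t : T t -> H (f t).
  by move=> Tt; apply/HE; eexists; last by []; apply: Y_signed => l; apply: psi0.
have yE z l : y (frame_mx B z) l = z (sec l) by rewrite /y frame_coord.
have y0 h l : H h -> y h l != 0.
  by move=> /HE[z hz ->]; rewrite yE Y_neq0.
have f'H h : H h -> T (f' h) by move=> Hh; have [] := thetaP (y h) (y0 h ^~ Hh).
have fK t : T t -> f' (f t) = t.
  move=> Tt; rewrite /f' -[RHS]thetaK //; congr theta; apply: boolp.funext => l.
  by rewrite yE /signed_coords sec_sgn sec_idx.
have f'K h : H h -> f (f' h) = h.
  move=> Hh; have [_ hth] := thetaP (y h) (y0 h ^~ Hh).
  have [z hz Ez] := (HE h).1 Hh; rewrite /f /f' [RHS]Ez; apply: eq_bigr => i _.
  congr (_ *: _); rewrite (Y_sec i hz) /signed_coords /= hth Ez.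
  by rewrite yE.
have fM t u : T t -> T u -> f (t *m u) = f t *m f u.
  move=> Tt Tu'; rewrite frame_mxM //; apply: eq_bigr => i _; congr (_ *: _).
  by rewrite /signed_coords !psiM //; case: (sgn i); rewrite ?invfM.
have HM h h' : H h -> H h' -> f' (h *m h') = f' h *m f' h'.
  move=> Hh Hh'; rewrite -[in LHS](f'K h) // -[in LHS](f'K h') // -fM ?fK //; try exact: f'H.
  by apply: TM; apply: f'H.
have HVinv z : Y z -> frame_mx B z *m frame_mx B (fun i => (z i)^-1) = 1%:M.
  move=> hz; rewrite frame_mxM // -(frame_mx1 B_frame); apply: eq_bigr => i _.
  by rewrite divff // Y_neq0.
have Hu h : H h -> h \in unitmx.
  by move=> /HE[z hz ->]; apply: (proj1 (mulmx1_unit (HVinv z hz))).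
have f_reg : regular_mx T f.
  apply: regmx_sum => i; apply: regmx_scale; last exact: regmx_const.
  by rewrite /signed_coords; case: (sgn i).
have f'_reg : regular_mx H f'.
  have lin_reg l : regular (@anyC C) H (y^~ l).
    by apply: reg_tr; apply: regmx_mul; [apply: regmx_const | apply: regmx_id].
  apply: theta_reg => // l.
  apply: (@reg_ext _ _ _ (fun h => \tr (B (sec l) *m invmx h))) => [h Hh|]; last first.
    by apply: reg_tr; apply: regmx_mul; [apply: regmx_const | apply: regmx_inv].
  have [z hz Ez] := (HE h).1 Hh.
  have -> : invmx h = frame_mx B (fun i => (z i)^-1).
    apply: (can_inj (mulKmx (Hu _ Hh))).
    by rewrite mulmxV ?Hu // Ez HVinv.
  by rewrite frame_coord // Ez yE.
have T_map gam : D gam -> forall t, T t <-> T (map_mx gam t).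
  by move=> hgam; apply: closed_group_map T_closed (D_base hgam).
have f_map gam t : D gam -> T t -> f (map_mx gam t) = map_mx gam (f t).
  move=> hgam Tt; have [pi [hB hX]] := D_perm hgam.
  have pi_inj : injective pi.
    move=> i i' E; have /map_mx_inj EB : map_mx gam (B i) = map_mx gam (B i').
      by rewrite !hB E.
    have [BB _ Btr] := B_frame; apply/eqP; apply: contraT => ne.
    have := congr1 (fun X => \tr (B i *m X)) EB.
    rewrite /= !BB eqxx scale1r Btr (negPf ne) scale0r mxtrace0 => /eqP.
    by rewrite oner_eq0.
  rewrite /f /frame_mx map_mx_sum (reindex_inj pi_inj); apply: eq_bigr => i _.
  by rewrite map_mxZ hB hX.
(* H is given only by its frame, without equations over K; its stability under D is transported from
   T through f. *)
have H_map gam : D gam -> forall h, H h <-> H (map_mx gam h).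
  move=> hgam h; split=> [Hh|Hh].
    rewrite -(f'K h) // -f_map //; last exact: f'H.
    by apply: fT; apply: (T_map _ hgam _).1; apply: f'H.
  have [del [_ Kgam]] := rmorph_inverse (auto_bij K_alg (D_base hgam)).
  pose t := map_mx del (f' (map_mx gam h)).
  have Et : map_mx gam t = f' (map_mx gam h) by apply/matrixP => i j; rewrite !mxE Kgam.
  have Tt : T t by apply: (T_map _ hgam _).2; rewrite Et; apply: f'H.
  suff -> : h = f t by apply: fT.
  by apply: (map_mx_inj (f := gam)); rewrite -f_map // Et f'K.
exists f, f'; split=> //; split=> // i j.
  apply: (regular_descent K_alg K0 D_fixed D_base T_map) => // gam hgam t Tt.
  by rewrite f_map // mxE.
apply: (regular_descent K_alg K0 D_fixed D_base H_map) => // gam hgam h Hh.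
rewrite -{1}(f'K h) // -f_map ?fK ?mxE //; last exact: f'H.
exact: (T_map _ hgam _).1 (f'H _ Hh).
Qed.

End TorusFrameIso.

Lemma conj_character_basis (C : closedFieldType) N (S T : 'M[C]_N -> Prop) n
    (chi : 'I_n -> 'M[C]_N -> C) (g : 'M[C]_N) :
  g \in unitmx -> (forall t, T t <-> S (invmx g *m t *m g)) ->
  character_basis S chi -> character_basis T (fun i t => chi i (invmx g *m t *m g)).
Proof.
move=> gu TS [chi_char chi_span].
have ST s : S s <-> T (g *m s *m invmx g).
  by rewrite TS !mulmxA mulVmx // mul1mx -mulmxA mulVmx // mulmx1.
have conj_reg (h : 'M[C]_N) (G G' : 'M[C]_N -> Prop) phi : h \in unitmx ->
    (forall s, G s -> G' (invmx h *m s *m h)) -> regular (@anyC C) G' phi ->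
    regular (@anyC C) G (fun s => phi (invmx h *m s *m h)).
  move=> hu GG'; apply: reg_comp => //.
    apply: regmx_mul; last exact: regmx_const.
    by apply: regmx_mul; [exact: regmx_const | exact: regmx_id].
  apply: reg_ext (reg_detV G) => s _; rewrite !det_mulmx mulrAC det_inv.
  by rewrite mulVf ?mul1r // -unitfE -unitmxE.
split=> [i|om [om_reg om0 omM]].
  have [chi_reg chi0 chiM] := chi_char i; split=> [|t /TS Tt|t u /TS Tt /TS Tu].
  - by apply: (conj_reg _ _ S) => // t /TS.
  - exact: chi0.
  rewrite -chiM //; congr (chi i _); rewrite !mulmxA.
  by rewrite -[_ *m g *m invmx g]mulmxA mulmxV // mulmx1.
have [|a [ha ua]] := chi_span (fun s => om (g *m s *m invmx g)).
  split=> [|s /ST Ss|s u /ST Ss /ST Su]; [|exact: om0|].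
    have := conj_reg (invmx g) S T om; rewrite invmxK unitmx_inv; apply=> // s.
    by move/ST.
  rewrite -omM //; congr om; rewrite !mulmxA.
  by rewrite -[_ *m invmx g *m g]mulmxA mulVmx // mulmx1.
exists a; split=> [t /TS Tt|b hb].
  by rewrite -ha // !mulmxA mulmxV // mul1mx -mulmxA mulmxV // mulmx1.
apply: ua => s Ss; rewrite hb; last by apply/ST.
by apply: eq_bigr => i _; rewrite !mulmxA mulVmx // mul1mx -mulmxA mulVmx // mulmx1.
Qed.

(** * Factors of a framed torus and their products *)

Section CoordFactors.
Context (C : closedFieldType) (D : {rmorphism C -> C} -> Prop) (N : nat) (T : 'M[C]_N -> Prop).
Context (n : nat) (psi : 'I_n -> 'M[C]_N -> C).

(* The group framed by Y is the torus whose characters are the psi_l with l in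
   the image of idx: its coordinate i is psi_(idx i), inverted if sgn i. *)
Record coord_factor (I : finType) M (B : I -> 'M[C]_M) (Y : (I -> C) -> Prop)
    (idx : I -> 'I_n) (sgn : I -> bool) : Prop := CoordFactor {
  cf_frame : is_frame B;
  cf_signed : forall z, (forall l, z l != 0) -> Y (signed_coords idx sgn z);
  cf_neq0 : forall y i, Y y -> y i != 0;
  cf_eq : forall y i i', Y y -> idx i = idx i' ->
    y i = if sgn i == sgn i' then y i' else (y i')^-1;
  cf_pos : forall i, exists i', idx i' = idx i /\ sgn i' = false;
  cf_perm : forall gam, D gam -> exists pi : I -> I,
    (forall i, map_mx gam (B i) = B (pi i)) /\
    forall i t, T t -> gam (signed_coords idx sgn (psi^~ t) i) =
      signed_coords idx sgn (psi^~ (map_mx gam t)) (pi i)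
}.

Definition sum_rect (I1 I2 A : Type) (f1 : I1 -> A) (f2 : I2 -> A) (x : I1 + I2) : A :=
  match x with inl i => f1 i | inr i => f2 i end.

Lemma coord_factor_sum (I1 I2 : finType) M1 M2 (B1 : I1 -> 'M[C]_M1) (B2 : I2 -> 'M[C]_M2)
    Y1 Y2 idx1 idx2 sgn1 sgn2 :
  coord_factor B1 Y1 idx1 sgn1 -> coord_factor B2 Y2 idx2 sgn2 ->
  (forall i i', idx1 i <> idx2 i') ->
  coord_factor (sum_frame B1 B2) (fun y => Y1 (y \o inl) /\ Y2 (y \o inr))
    (sum_rect idx1 idx2) (sum_rect sgn1 sgn2).
Proof.
move=> F1 F2 ne; split.
- exact: sum_frameP (cf_frame F1) (cf_frame F2).
- by move=> z z0; split; [apply: (cf_signed F1) | apply: (cf_signed F2)].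
- by move=> y [i|i] [h1 h2]; [exact: (cf_neq0 F1 i h1) | exact: (cf_neq0 F2 i h2)].
- move=> y [i|i] [i'|i'] [h1 h2] /= E; [|by case: (ne i i')|by case: (ne i' i)|].
    exact: (cf_eq F1 h1 E).
  exact: (cf_eq F2 h2 E).
- move=> [i|i] /=.
    by have [i' ?] := cf_pos F1 i; exists (inl i').
  by have [i' ?] := cf_pos F2 i; exists (inr i').
- move=> gam hg; have [pi1 [h1 k1]] := cf_perm F1 hg; have [pi2 [h2 k2]] := cf_perm F2 hg.
  exists (fun x => match x with inl i => inl (pi1 i) | inr i => inr (pi2 i) end); split.
    exact: sum_frame_map.
  by move=> [i|i] t Tt; [apply: k1 | apply: k2].
Qed.

Lemma coord_factor_big j (M : 'I_j -> nat) (I : 'I_j -> finType) (B : forall k, I k -> 'M[C]_(M k))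
    (Y : forall k, (I k -> C) -> Prop) (idx : forall k, I k -> 'I_n) (sgn : forall k, I k -> bool) :
  (forall k, coord_factor (@B k) (Y k) (@idx k) (@sgn k)) ->
  (forall k l (i : I k) (i' : I l), idx k i = idx l i' -> k = l) ->
  coord_factor (big_frame B) (fun y => forall k, Y k (fun i => y (Tagged I i)))
    (fun x => idx (tag x) (tagged x)) (fun x => sgn (tag x) (tagged x)).
Proof.
move=> F inj; split.
- by apply: big_frameP => k; exact: (cf_frame (F k)).
- by move=> z z0 k; exact: (cf_signed (F k) z0).
- by move=> y [k i] hy; exact: (@cf_neq0 _ _ _ _ _ _ (F k) (fun i => y (Tagged I i)) i (hy k)).
- move=> y [k i] [l i'] hy /= E; have kl := inj _ _ _ _ E.
  case: _ / kl in i' E *.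
  exact: (cf_eq (F k) (hy k) E).
- move=> [k i] /=; have [i' ?] := cf_pos (F k) i.
  by exists (Tagged I i').
- move=> gam hg; have pk k := boolp.cid (cf_perm (F k) hg).
  exists (fun x => Tagged I (sval (pk (tag x)) (tagged x))); split.
    apply: (big_frame_map (f := fun k => sval (pk k))) => k i.
    by have [h _] := svalP (pk k); apply: h.
  by move=> [k i] t Tt; have [_ h] := svalP (pk k); apply: h.
Qed.

Section IsoOfFactor.
Context (K : fieldType) (iK : {rmorphism K -> C}).
Hypotheses (K_alg : forall x : C, algebraicOver iK x) (K0 : has_char0 K).
Local Notation rat := (fun x : C => exists c, x = iK c).
Hypothesis D_base : forall gam, D gam -> fixes_base iK gam.
Hypothesis D_fixed : forall x, (forall gam, D gam -> gam x = x) -> exists c, x = iK c.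
Hypotheses (T_closed : closed_group rat T) (T_torus : exists d, group_iso (@anyC C) T (@Gm C d)).
Hypothesis psi_basis : character_basis T psi.

Lemma coord_factor_iso (I : finType) M (B : I -> 'M[C]_M) Y idx sgn (H : 'M[C]_M -> Prop) :
  coord_factor B Y idx sgn -> (forall l, exists i, idx i = l) ->
  (forall h, H h <-> frame_group B Y h) -> group_iso rat T H.
Proof.
move=> F surj HE.
have ex l : exists i, idx i = l /\ sgn i = false.
  by have [i <-] := surj l; have [i' ?] := cf_pos F i; exists i'.
have [sec hsec] := boolp.choice ex.
apply: (torus_frame_iso K_alg K0 D_base D_fixed T_closed T_torus psi_basis (cf_frame F) HE
  (idx := idx) (sgn := sgn) (sec := sec)).
- exact: cf_signed F.
- exact: cf_neq0 F.
- move=> y i hy; have [E s0] := hsec (idx i).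
  rewrite (cf_eq F hy (esym E)) s0 /signed_coords /=.
  by case: (sgn i).
- by move=> l; have [] := hsec l.
- by move=> l; have [] := hsec l.
- exact: cf_perm F.
Qed.

End IsoOfFactor.
End CoordFactors.

Lemma in_WI_exp n (sg : 'S_n) a i : in_WI sg -> (sg ^+ a)%g (rev_ord i) = rev_ord ((sg ^+ a)%g i).
Proof.
move=> hsg; elim: a i => [|a IHa] i; first by rewrite !expg0 !perm1.
by rewrite expgS !permM hsg IHa.
Qed.

(** * One factor: a Galois group generated by s and an involution t commuting with s *)

Section GaloisFactor.
Context (Qp : fieldType) (K : fieldExtType Qp) (C : closedFieldType) (iK : {rmorphism K -> C}).
Context (L : splittingFieldType K) (K0 : has_char0 K).
Context (iota : {rmorphism L -> C}) (iotaK : forall c : K, iota c%:A = iK c).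
Local Notation gal := (gal_of {:L}).
Local Notation d := (\dim {:L}).
Context (w : gal -> 'rV[C]_d).
Hypothesis w_dual : forall rho rho' : gal,
  w rho *m emb_col (fun x => iota (rho' x)) = (rho == rho')%:R%:M.
Hypothesis w_sum : \sum_(rho : gal) emb_col (fun x => iota (rho x)) *m w rho = 1%:M.
Context (D : {rmorphism C -> C} -> Prop) (N : nat) (T : 'M[C]_N -> Prop).
Context (n : nat) (psi : 'I_n -> 'M[C]_N -> C) (sg : 'S_n) (sg_WI : in_WI sg).
Context (M : {subfield L}) (s t : gal) (r : nat) (i0 : 'I_n).
Hypothesis gal_gen : forall rho : gal, exists b (e : bool), rho = (s ^+ b * t ^+ e)%g.
Hypotheses (tt : (t * t = 1)%g) (st : commute s t) (ts : t \notin <[s]>%g).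
Hypothesis orbit : forall b b', (s ^+ b = s ^+ b')%g <-> (sg ^+ b)%g i0 = (sg ^+ b')%g i0.
Hypothesis sg_r : (sg ^+ r)%g i0 = rev_ord i0.
Hypothesis galM_E : 'Gal({:L} / M)%g = [set 1%g; (t * s ^+ r)%g].
Hypothesis D_act : forall gam, D gam -> fixes_base iK gam /\
  exists a (e : bool), (forall x, gam (iota x) = iota ((s ^+ a * t ^+ e)%g x)) /\
    forall l u, T u -> gam (psi l u) =
      if e then (psi (rev_ord ((sg ^+ a)%g l)) (map_mx gam u))^-1
      else psi ((sg ^+ a)%g l) (map_mx gam u).

(* The coordinate s^b t^e of T_s is the character sigma^b(i0) if e = 0, and the
   inverse of the character - sigma^b(i0) if e = 1. *)
Lemma gal_coord_factor : exists idx sgn,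
  coord_factor D T psi (emb_proj iota w) (norm_one_coords M) idx sgn /\
  forall i, (exists rho, idx rho = i) <-> exists b, i = (sg ^+ b)%g i0.
Proof.
have [f hf] : exists f : gal -> nat * bool, forall rho, rho = (s ^+ (f rho).1 * t ^+ (f rho).2)%g.
  have ex rho : exists x : nat * bool, rho = (s ^+ x.1 * t ^+ x.2)%g.
    by have [b [e ->]] := gal_gen rho; exists (b, e).
  by have [f hf] := boolp.choice ex; exists f.
have rev_inj : injective (@rev_ord n) := rev_ord_inj.
have t_exp (e : bool) : (t * t ^+ e = t ^+ ~~ e)%g by case: e; rewrite ?expg1 ?expg0 ?mulg1.
(* Since t is not a power of s, e is determined by rho. The exponent b is determined only modulo the
   order of s, which by [orbit] is all that [idx] sees. *)
have uniq_rep b (e : bool) b' (e' : bool) : (s ^+ b * t ^+ e = s ^+ b' * t ^+ e')%g ->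
    e = e' /\ (s ^+ b = s ^+ b')%g.
  case: e; case: e' => /=; rewrite ?expg1 ?expg0 ?mulg1 => E; split=> //.
  - exact: mulIg E.
  - by case/negP: ts; rewrite -(mulKg (s ^+ b)%g t) E groupM ?groupV ?mem_cycle.
  - by case/negP: ts; rewrite -(mulKg (s ^+ b)%g t) E groupM ?groupV ?mem_cycle.
  - by case/negP: ts; rewrite -(mulKg (s ^+ b')%g t) -E groupM ?groupV ?mem_cycle.
  - by case/negP: ts; rewrite -(mulKg (s ^+ b')%g t) -E groupM ?groupV ?mem_cycle.
pose revb (e : bool) (i : 'I_n) := if e then rev_ord i else i.
pose idx rho := revb (f rho).2 ((sg ^+ (f rho).1)%g i0).
pose sgn rho := (f rho).2.
have idxE b (e : bool) : idx (s ^+ b * t ^+ e)%g = revb e ((sg ^+ b)%g i0) /\ sgn (s ^+ b * t ^+ e)%g = e.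
  have [E1 E2] := uniq_rep _ _ _ _ (hf (s ^+ b * t ^+ e)%g).
  by rewrite /idx /sgn -E1; split=> //; congr revb; apply/orbit.
pose eta := (t * s ^+ r)%g.
have etaE b (e : bool) : (eta * (s ^+ b * t ^+ e) = s ^+ (b + r) * t ^+ ~~ e)%g.
  rewrite /eta -mulgA (mulgA (s ^+ r)%g) -expgD mulgA (commuteX _ (commute_sym st)).
  by rewrite -mulgA t_exp addnC.
have sgr b : (sg ^+ (b + r))%g i0 = rev_ord ((sg ^+ b)%g i0).
  by rewrite addnC expgD permM sg_r in_WI_exp.
have eta1 : eta != 1%g.
  apply: contraNneq ts => E; have -> : t = (s ^- r)%g by rewrite -[LHS](mulgK (s ^+ r)%g) -/eta E mul1g.
  by rewrite groupV mem_cycle.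
have normE (y : gal -> C) rho : \prod_(x in 'Gal({:L} / M)%g) y (x * rho)%g = y rho * y (eta * rho)%g.
  by rewrite galM_E big_setU1 ?big_set1 ?mul1g // inE eq_sym.
exists idx, sgn; split; first split.
- exact: emb_frameP w_dual w_sum.
- move=> z z0 rho; rewrite normE; have [b [e ->]] := gal_gen rho.
  rewrite etaE /signed_coords; have [-> ->] := idxE b e; have [-> ->] := idxE (b + r)%N (~~ e).
  rewrite sgr; case: e => /=; rewrite ?rev_ordK; first by rewrite mulVf.
  by rewrite mulfV.
- by move=> y rho hy; apply: norm_one_neq0 hy.
- move=> y rho rho' hy; have [b [e ->]] := gal_gen rho; have [b' [e' ->]] := gal_gen rho'.
  have [-> ->] := idxE b e; have [-> ->] := idxE b' e'.
  have inv_eq b1 (e1 : bool) b2 : (s ^+ b2 = s ^+ (b1 + r))%g ->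
      y (s ^+ b1 * t ^+ e1)%g * y (s ^+ b2 * t ^+ ~~ e1)%g = 1.
    by move=> ->; rewrite -etaE -normE hy.
  have inv_of (a b1 : C) : a * b1 = 1 -> a = b1^-1.
    move=> E; have b10 : b1 != 0 by apply: contra_eq_neq E => ->; rewrite mulr0 eq_sym oner_eq0.
    by apply: (mulIf b10); rewrite E mulVf.
  case: e; case: e' => /= E.
  + by have /orbit -> := rev_inj _ _ E.
  + by apply/inv_of/(inv_eq b true b')/orbit; rewrite sgr -E.
  + apply/inv_of; rewrite mulrC; apply: (inv_eq b' true b); apply/orbit.
    by rewrite sgr E.
  + by have /orbit -> := E.
- move=> rho; have [b [e ->]] := gal_gen rho; have [-> _] := idxE b e.
  case: e => /=; last by exists (s ^+ b * t ^+ false)%g; apply: idxE.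
  exists (s ^+ (b + r) * t ^+ false)%g; have [-> ->] := idxE (b + r)%N false.
  by rewrite /= sgr.
- move=> gam /D_act[hg [a [e [hiota hpsi]]]].
  (* The coordinate rho belongs to the embedding iota rho, so applying gam after it multiplies rho
     on the right. *)
  exists (fun rho => rho * (s ^+ a * t ^+ e))%g; split=> [rho|rho u Tu].
    apply: (emb_proj_map K0 iotaK w_dual w_sum hg) => x.
    by rewrite hiota [in RHS]galM ?memvf.
  have [b [e' ->]] := gal_gen rho.
  have -> : (s ^+ b * t ^+ e' * (s ^+ a * t ^+ e) = s ^+ (b + a) * t ^+ (e' (+) e))%g.
    have cta : (t ^+ e' * s ^+ a = s ^+ a * t ^+ e')%g by apply/commute_sym/commuteX2.
    rewrite -mulgA (mulgA (t ^+ e')%g) cta expgD -!mulgA; congr (_ * (_ * _))%g.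
    by case: (e'); case: (e); rewrite /= ?expg0 ?expg1 ?mulg1 ?mul1g.
  rewrite /signed_coords; have [-> ->] := idxE b e'; have [-> ->] := idxE (b + a)%N (e' (+) e).
  have sga : (sg ^+ (b + a))%g i0 = (sg ^+ a)%g ((sg ^+ b)%g i0) by rewrite expgD permM.
  rewrite sga; case: e' => /=; rewrite ?fmorphV hpsi //; case: e {hiota hpsi} => //=.
    by rewrite in_WI_exp // rev_ordK invrK.
  by rewrite in_WI_exp.
move=> i; split=> [[rho <-]|[b ->]]; last first.
  by exists (s ^+ b * t ^+ false)%g; have [-> _] := idxE b false.
have [b [e ->]] := gal_gen rho; have [-> _] := idxE b e.
by case: e => /=; [exists (b + r)%N; rewrite sgr | exists b].
Qed.

End GaloisFactor.

Lemma quadratic_gal (K : fieldType) (E : splittingFieldType K) (tau : gal_of {:E}) :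
  has_char0 K -> \dim {:E} = 2%N -> tau != 1%g ->
  (forall rho : gal_of {:E}, rho = 1%g \/ rho = tau) /\ (tau * tau = 1)%g.
Proof.
move=> K0 dE t1; have card := card_gal_top E K0; rewrite dE in card.
have two (rho : gal_of {:E}) : rho = 1%g \/ rho = tau.
  have : rho \in [set 1%g; tau].
    suff -> : [set 1%g; tau] = [set: gal_of {:E}] by rewrite inE.
    by apply/eqP; rewrite eqEcard subsetT cardsT card cards2 eq_sym t1.
  by rewrite !inE => /orP[]/eqP; [left | right].
split=> //; have [//|E1] := two (tau * tau)%g.
by case/eqP: t1; apply: (mulgI tau); rewrite mulg1.
Qed.

(** * The Galois group of E_s / K *)

Section TsDatum.
Context (p : nat) (p_prime : prime p) (Qp : fieldType) (v : padic_abs p Qp) (K : fieldExtType Qp).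
Context (C : closedFieldType) (iK : {rmorphism K -> C}).
Hypothesis C_alg : forall x : C, algebraicOver iK x.
Context (E : splittingFieldType K) (iE : {rmorphism E -> C}).
Hypothesis iE_K : forall c : K, iE c%:A = iK c.
Hypothesis E_quadratic : \dim {:E} = 2%N.
Hypothesis E_ramified : ~ unramified v 1%AS {:E}%AS.
Context (tau : gal_of {:E}) (tau_neq1 : tau != 1%g).
Context (r : nat) (r_gt0 : (0 < r)%N) (D : Ts_datum v E r).

Local Notation L := (Es D).
Local Notation s := (sigma_s D).
Local Notation t := (tau_s D).
Local Notation emb := (Es_emb D).
Local Notation embE := (emb @: {:E})%AS.
Local Notation vr := (vring v iK).
Local Notation vm := (vmax v iK).
Let K0 : has_char0 K := base_char0 p_prime v K.

Lemma Es_galois (F : {subfield L}) : galois F {:L}%AS.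
Proof. by apply: galoisS (galois_top L K0); rewrite sub1v subvf. Qed.

Lemma dim_embE : \dim embE = 2%N.
Proof. by rewrite limg_dim_eq ?E_quadratic // (eqP (AHom_lker0 emb)) capv0. Qed.

Lemma dim_Es : \dim {:L} = (r.*2 * 2)%N.
Proof. by rewrite -dim_embE -(Es_deg D) divnK // field_dimS // subvf. Qed.

Lemma gal_embE : 'Gal({:L} / embE)%g = <[s]>%g.
Proof.
apply/esym/eqP; rewrite eqEcard cycle_subG (sigma_s_gal D) /=.
by rewrite -(galois_dim (Es_galois embE)) (Es_deg D) -orderE (sigma_s_order D).
Qed.

Lemma gal_Ks : 'Gal({:L} / Ks D)%g = [set 1%g; t].
Proof.
apply/esym/eqP; rewrite eqEcard cards2 eq_sym (tau_s_neq1 D) -(galois_dim (Es_galois (Ks D))).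
rewrite (Ks_deg D) dim_Es mulKn ?double_gt0 // andbT.
by apply/subsetP => x; rewrite !inE => /orP[]/eqP->; rewrite ?group1 ?(tau_s_gal D).
Qed.

Lemma tau_s2 : (t * t = 1)%g.
Proof.
have : (t * t)%g \in 'Gal({:L} / Ks D)%g by rewrite groupM // (tau_s_gal D).
rewrite gal_Ks !inE => /orP[/eqP //|/eqP E1].
by case/eqP: (tau_s_neq1 D); apply: (mulgI t); rewrite mulg1.
Qed.

(* Otherwise E lies in the unramified field K_s. *)
Lemma tau_s_notin : t \notin <[s]>%g.
Proof.
rewrite -gal_embE; apply/negP => t_fix; apply: E_ramified => x _ mx.
have emb_c (c : K) : emb c%:A = c%:A by rewrite linearZ /= rmorph1.
have x_Ks : emb x \in Ks D.
  rewrite -(galois_fixedField (Es_galois (Ks D))); apply/fixedFieldP; first exact: memvf.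
  move=> y; rewrite gal_Ks !inE => /orP[]/eqP ->; first by rewrite gal_id.
  by apply: (fixed_gal _ t_fix); rewrite ?subvf // memv_img ?memvf.
have mx' : vmax v (in_alg L) (emb x).
  by apply/(@vmax_mor p Qp v K E L (in_alg E) (in_alg L) emb emb_c).
have [a [y [/vlineP[c ->] mc yKs hy Exy]]] := @Ks_unr _ _ _ _ _ _ D (emb x) x_Ks mx'.
have [c0|c0] := eqVneq c 0.
  have x0 : x = 0.
    apply: (fmorph_inj emb); rewrite rmorph0.
    by apply: (etrans Exy); rewrite c0 scale0r mul0r.
  exists 0, 0; rewrite mulr0 x0 !mem0v; split=> //.
    by rewrite -x0.
  by have [h _] := mx; rewrite -x0.
(* The cofactor y found in K_s is the image of c^-1 x, so the factorization of x already takes place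
   in E. *)
exists c%:A, (c^-1 *: x); split.
- by rewrite memvZ // mem1v.
- have mc' : vmax v (in_alg L) (emb c%:A) by rewrite emb_c.
  exact: (@vmax_mor p Qp v K E L (in_alg E) (in_alg L) emb emb_c _).2 mc'.
- exact: memvf.
- have hy' : vring v (in_alg L) (emb (c^-1 *: x)).
    by rewrite linearZ /= Exy mulr_algl scalerA mulVf // scale1r.
  exact: (@vring_mor p Qp v K E L (in_alg E) (in_alg L) emb emb_c _).2 hy'.
- by rewrite mulr_algl scalerA divff // scale1r.
Qed.

Lemma gal_gen_Es (rho : gal_of {:L}) : exists b (e : bool), rho = (s ^+ b * t ^+ e)%g.
Proof.
have : rho \in <[s]>%g :|: (<[s]> :* t)%g.
  suff -> : <[s]>%g :|: (<[s]> :* t)%g = [set: gal_of {:L}] by rewrite inE.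
  apply/eqP; rewrite eqEcard subsetT cardsT (card_gal_top L K0) dim_Es cardsU.
  have -> : <[s]>%g :&: (<[s]> :* t)%g = set0.
    apply/setP => x; rewrite !inE mem_rcoset; apply/negbTE/negP => /andP[xs xt].
    by case/negP: tau_s_notin; rewrite -[t]invgK groupV -(mulKg x t^-1%g) groupM ?groupV.
  by rewrite cards0 subn0 card_rcoset -orderE (sigma_s_order D) muln2 addnn /=.
rewrite inE mem_rcoset => /orP[] /cycleP[b Eb].
  by exists b, false; rewrite mulg1.
by exists b, true; rewrite -Eb expg1 mulgKV.
Qed.

Section Residue.
Context (q : nat) (hq : residue_card v K q).
Context (iota : {rmorphism L -> C}) (iotaK : forall c : K, iota c%:A = iK c).

Lemma gal_fix_Ks (rho : gal_of {:L}) : (forall x, x \in Ks D -> rho x = x) -> rho = 1%g \/ rho = t.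
Proof.
move=> h; have : rho \in 'Gal({:L} / Ks D)%g.
  rewrite gal_kHom ?subvf //; apply/kHomP_tmp; split=> [x xK|x y _ _]; first exact: h.
  exact: rmorphM.
by rewrite gal_Ks !inE => /orP[]/eqP; [left | right].
Qed.

Lemma sigma_s_res x : x \in Ks D -> vring v (in_alg L) x -> vm (iota (s x) - iota x ^+ q).
Proof.
move=> xK hx; have [q' hq' h] := sigma_s_frob D.
rewrite (residue_card_inj p_prime C_alg hq hq') -rmorphXn -rmorphB.
by apply/(@vmax_mor p Qp v K L C (in_alg L) iK iota iotaK); apply: h.
Qed.

(* Both t s and s induce the Frobenius on the residue field of K_s. *)
Lemma commute_st : commute s t.
Proof.
have tsx x : x \in Ks D -> t (s x) = s x.
  move=> xK; apply: (fmorph_inj iota).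
  have t_c (c : K) : t c%:A = c%:A by rewrite linearZ /= rmorph1.
  have s_c (c : K) : s c%:A = c%:A by rewrite linearZ /= rmorph1.
  apply: (unramified_rigid p_prime C_alg hq (u := iota \o s) (u' := iota \o (t \o s)) _ _ (Ks_unr (t := D))) => //.
  - by move=> c /=; rewrite s_c iotaK.
  - by move=> c /=; rewrite s_c t_c iotaK.
  move=> y yK hy /=; have hs := sigma_s_res yK hy.
  have -> : iota (t (s y)) - iota (s y) = (iota (t (s y)) - iota y ^+ q) - (iota (s y) - iota y ^+ q) by ring.
  apply: (vmaxB p_prime C_alg) => //.
  have ty : t y = y by apply: (fixed_gal _ (tau_s_gal D)); rewrite ?subvf.
  have -> : iota (t (s y)) - iota y ^+ q = iota (t (s y - y ^+ q)).
    by rewrite [in RHS]rmorphB rmorphXn /= ty rmorphB rmorphXn.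
  apply: (@vmax_mor p Qp v K L C (in_alg L) iK iota iotaK _).1.
  apply: (@vmax_mor p Qp v K L L (in_alg L) (in_alg L) t t_c _).1.
  apply: (@vmax_mor p Qp v K L C (in_alg L) iK iota iotaK _).2.
  by rewrite rmorphB rmorphXn.
have [|E1|E1] := @gal_fix_Ks (s * t * s^-1)%g.
- move=> x xK; rewrite !galM ?memvf // tsx //.
  by rewrite -galM ?memvf // mulgV gal_id.
- case/eqP: (tau_s_neq1 D).
  by rewrite -(mulKg s t) -[(s * t)%g](mulgKV s) E1 mul1g mulVg.
- by rewrite /commute -{2}E1 mulgKV.
Qed.

Lemma gal_L_r : 'Gal({:L} / L_r D)%g = [set 1%g; (t * s ^+ r)%g].
Proof.
rewrite /L_r (gal_fixedField <[eta_s D]>%G) /= /eta_s; set eta := (t * s ^+ r)%g.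
have eta2 : (eta * eta = 1)%g.
  rewrite /eta -mulgA (mulgA (s ^+ r)%g) -(commuteX r (commute_sym commute_st)).
  by rewrite -mulgA -expgD addnn -(sigma_s_order D) expg_order mulg1 tau_s2.
have eta1 : eta != 1%g.
  apply: contraNneq tau_s_notin => E1.
  have -> : t = (s ^- r)%g by rewrite -[LHS](mulgK (s ^+ r)%g) -/eta E1 mul1g.
  by rewrite groupV mem_cycle.
apply/eqP; rewrite eq_sym eqEcard cards2 eq_sym eta1 -orderE; apply/andP; split.
  by apply/subsetP => x; rewrite !inE => /orP[]/eqP->; rewrite ?group1 ?cycle_id.
by apply: dvdn_leq => //; rewrite order_dvdn expgS expg1 eta2.
Qed.

(** Agreement with s^a on K_s leaves only s^a and s^a t as candidates, and these differ on the image
    of E, where s is trivial and t is not. *)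
Lemma embedding_act (gam : {rmorphism C -> C}) a (e : bool) :
  fixes_base iK gam -> (forall x, iota (emb x) = iE x) ->
  e = ~~ boolp.asbool (forall x, gam (iE x) = iE x) ->
  (forall x, x \in Ks D -> gam (iota x) = iota ((s ^+ a)%g x)) ->
  forall x, gam (iota x) = iota ((s ^+ a * t ^+ e)%g x).
Proof.
move=> hg iota_emb Ee hKs.
have [|rho hrho] := @embedding_galois _ _ _ _ K0 _ iotaK (gam \o iota).
  by move=> c /=; rewrite iotaK hg.
suff -> : (s ^+ a * t ^+ e)%g = rho by move=> x; apply: hrho.
have s_fix y : emb y \in embE by rewrite memv_img ?memvf.
have st_E (e' : bool) y : (s ^+ a * t ^+ e')%g (emb y) = (t ^+ e')%g (emb y).
  rewrite galM ?memvf //; congr ((t ^+ e')%g _); apply: (fixed_gal (K := embE)) => //.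
    by rewrite subvf.
  by rewrite groupX // (sigma_s_gal D).
have [e' Erho] : exists e' : bool, rho = (s ^+ a * t ^+ e')%g.
  have [|E1|E1] := @gal_fix_Ks (rho * (s ^+ a)^-1)%g.
  - move=> x xK; rewrite galM ?memvf //.
    have -> : rho x = (s ^+ a)%g x by apply: (fmorph_inj iota); rewrite -hrho -hKs.
    by rewrite -galM ?memvf // mulgV gal_id.
  - by exists false; rewrite mulg1 -[LHS](mulgKV (s ^+ a)%g) E1 mul1g.
  - by exists true; rewrite -(commuteX _ (commute_sym commute_st)) -E1 mulgKV.
suff -> : e = e' by [].
rewrite Ee; case: boolp.asboolP => h; case: e' Erho => //= Erho; last first.
  case: h => y; rewrite -iota_emb; have -> : gam (iota (emb y)) = iota (rho (emb y)) := hrho _.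
  by rewrite Erho (st_E false) expg0 gal_id.
case/negP: tau_s_notin; rewrite -gal_embE gal_kHom ?subvf //.
apply/kHomP_tmp; split=> [_ /memv_imgP[y _ ->]|x y _ _]; last exact: rmorphM.
have Ey := h y; rewrite -iota_emb in Ey; apply: (fmorph_inj iota); rewrite -[RHS]Ey.
have -> : gam (iota (emb y)) = iota (rho (emb y)) := hrho _.
rewrite Erho; apply/esym; apply: etrans (congr1 iota (st_E true y)) _.
by rewrite expg1.
Qed.

End Residue.
End TsDatum.

Section EmbeddingExtension.
Context (p : nat) (p_prime : prime p) (Qp : fieldType) (v : padic_abs p Qp) (K : fieldExtType Qp).
Context (C : closedFieldType) (iK : {rmorphism K -> C}).
Context (E : splittingFieldType K) (iE : {rmorphism E -> C}).
Hypothesis iE_K : forall c : K, iE c%:A = iK c.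
Hypothesis E_quadratic : \dim {:E} = 2%N.
Hypothesis E_ramified : ~ unramified v 1%AS {:E}%AS.
Context (tau : gal_of {:E}) (tau_neq1 : tau != 1%g).
Context (r : nat) (r_gt0 : (0 < r)%N) (D : Ts_datum v E r).

(** An arbitrary embedding of E_s restricts to E as iE or as its composite with tau; in the second
    case tau_s, which moves E, corrects it. *)
Lemma embedding_over_E : exists iota : {rmorphism Es D -> C},
  (forall c : K, iota c%:A = iK c) /\ forall x, iota (Es_emb D x) = iE x.
Proof.
have K0 := base_char0 p_prime v K.
have [two _] := quadratic_gal K0 E_quadratic tau_neq1.
have [iota0 iota0K] := embedding_ex iK (Es D) K0.
have emb_c (c : K) : Es_emb D c%:A = c%:A by rewrite linearZ /= rmorph1.
have t_c (c : K) : tau_s D c%:A = c%:A by rewrite linearZ /= rmorph1.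
have [|rho h] := @embedding_galois _ _ _ _ K0 iE iE_K (iota0 \o Es_emb D).
  by move=> c /=; rewrite emb_c iota0K.
have [|rho' h'] := @embedding_galois _ _ _ _ K0 iE iE_K (iota0 \o (tau_s D \o Es_emb D)).
  by move=> c /=; rewrite emb_c t_c iota0K.
have [E1|E1] := two rho; first by exists iota0; split=> // x; apply: etrans (h x) _; rewrite E1 gal_id.
exists (iota0 \o tau_s D); split=> [c|x]; first by rewrite /= t_c iota0K.
have [E2|E2] := two rho'; first by apply: etrans (h' x) _; rewrite E2 gal_id.
case/negP: (tau_s_notin p_prime E_quadratic E_ramified r_gt0 D).
rewrite -(gal_embE p_prime D) gal_kHom ?subvf //.
apply/kHomP_tmp; split=> [_ /memv_imgP[y _ ->]|a b _ _]; last exact: rmorphM.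
apply: (fmorph_inj iota0); apply: etrans (h' y) _.
by rewrite E2 -E1; apply/esym/h.
Qed.

End EmbeddingExtension.

(** * Negative cycles and the Galois action on T *)

Section Cycles.
Context (n : nat) (sg : 'S_n) (sg_WI : in_WI sg).
Context (j : nat) (c : 'I_j -> 'S_n) (r : 'I_j -> nat).
Hypothesis dec : negative_cycle_decomposition sg c r.

Lemma cycle_factor k x : c k x != x -> sg x = c k x.
Proof.
have [-> _ disj _] := dec; move=> hx.
have fix_l l y : l != k -> c k y != y -> c l y = y.
  by move=> lk hy; have [//|E] := disj l k lk y; rewrite E eqxx in hy.
have hy : c k (c k x) != c k x by rewrite (inj_eq perm_inj).
have : k \in index_enum 'I_j by rewrite mem_index_enum.
have : uniq (index_enum 'I_j) by rewrite index_enum_uniq.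
elim: (index_enum _) => // l s IHs /=; rewrite inE big_cons permM => /andP[ls us].
case: (eqVneq k l) ls => [<- ls _|lk ls] /=.
  elim: s ls {IHs us} => [|m s IHs]; first by rewrite big_nil perm1.
  rewrite inE negb_or big_cons permM => /andP[lm ls].
  have mk : m != k by rewrite eq_sym.
  by rewrite (fix_l m _ mk hy); apply: IHs.
move=> ks; have lk' : l != k by rewrite eq_sym.
by rewrite (fix_l l _ lk' hx); apply: IHs.
Qed.

(** The orbit of a negative cycle has exactly 2r elements: r steps change the sign, and no smaller
    positive number of steps leads back to i0 or -i0. Disjointness of the c k separates the orbits,
    which exhaust the nonzero indices. *)
Lemma cycle_bases : exists i0 : 'I_j -> 'I_n,
  [/\ forall k, (0 < r k)%N /\ (sg ^+ r k)%g (i0 k) = rev_ord (i0 k),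
      forall k b b', (sg ^+ b)%g (i0 k) = (sg ^+ b')%g (i0 k) <-> (b = b' %[mod (r k).*2])%N,
      forall k l b b', (sg ^+ b)%g (i0 k) = (sg ^+ b')%g (i0 l) -> k = l,
      forall x, rev_ord x != x -> exists k b, x = (sg ^+ b)%g (i0 k) &
      forall k b, rev_ord ((sg ^+ b)%g (i0 k)) != (sg ^+ b)%g (i0 k)].
Proof.
have [_ neg disj cov] := dec.
have [i0 hi] := boolp.choice neg; exists i0.
have iter_inj (s : 'S_n) b : injective (iter b s).
  by move=> x y; rewrite -!permX; apply: perm_inj.
have moved k b : c k (iter b (c k) (i0 k)) != iter b (c k) (i0 k).
  have [[r0 rev0] _ hr _ _] := hi k; apply/eqP => E.
  have E0 : c k (i0 k) = i0 k by apply: (iter_inj (c k) b); rewrite -iterSr.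
  case/eqP: rev0; rewrite -hr.
  by elim: (r k) => //= m ->.
have iterE k b : (sg ^+ b)%g (i0 k) = iter b (c k) (i0 k).
  rewrite permX; elim: b => //= b ->.
  by apply: cycle_factor; apply: moved.
have sgr k : (sg ^+ r k)%g (i0 k) = rev_ord (i0 k) by rewrite iterE; case: (hi k).
have sg2r k : (sg ^+ (r k).*2)%g (i0 k) = i0 k.
  by rewrite -addnn expgD permM sgr in_WI_exp // sgr rev_ordK.
have rev_moved k b : rev_ord ((sg ^+ b)%g (i0 k)) != (sg ^+ b)%g (i0 k).
  have [[_ h] _ _ _ _] := hi k.
  by rewrite -in_WI_exp // (inj_eq perm_inj).
have period k m : (sg ^+ m)%g (i0 k) = i0 k -> ((r k).*2 %| m)%N.
  have [[r0 rev0] small _ _ _] := hi k.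
  have d0 : (0 < (r k).*2)%N by rewrite double_gt0.
  have pow_2r q : (sg ^+ (q * (r k).*2))%g (i0 k) = i0 k.
    by elim: q => [|q IHq]; rewrite ?mul0n ?expg0 ?perm1 // mulSn expgD permM sg2r.
  rewrite {1}(divn_eq m (r k).*2) expgD permM pow_2r /dvdn.
  set a := (m %% _)%N; have ha : (a < (r k).*2)%N by rewrite ltn_mod.
  have [ar|ra] := ltnP a (r k).
    by rewrite iterE => E; rewrite (small a 0%N ar r0 (or_introl E)).
  (* For r <= a < 2r, sigma^a i0 is the opposite of sigma^(a-r) i0. A return to i0 would force a = r
     by distinctness of the |i_a|, and then i0 = -i0. *)
  have hb : (a - r k < r k)%N by move: ha; rewrite -addnn; lia.
  rewrite -(subnKC ra) expgD permM sgr in_WI_exp // iterE => E.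
  have E1 : iter 0 (c k) (i0 k) = rev_ord (iter (a - r k) (c k) (i0 k)) by [].
  have b0 := small 0%N _ r0 hb (or_intror E1).
  by case/eqP: rev0; rewrite -b0 /= in E.
split=> //.
- by move=> k; split=> //; have [[]] := hi k.
- move=> k; suff main b b' : (b <= b')%N ->
      (sg ^+ b)%g (i0 k) = (sg ^+ b')%g (i0 k) <-> (b = b' %[mod (r k).*2])%N.
    move=> b b'; have [/main//|/ltnW/main h] := leqP b b'.
    by split=> [/esym/h/esym|/esym/h/esym].
  move=> bb'; split=> [E|/eqP E].
    apply/esym/eqP; rewrite eqn_mod_dvd //; apply: period.
    by apply: (@perm_inj _ (sg ^+ b)%g); rewrite -permM -expgD subnK.
  have : ((r k).*2 %| b' - b)%N by rewrite -eqn_mod_dvd // eq_sym.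
  move=> /dvdnP[q Eq]; rewrite -(subnK bb') Eq expgD permM; congr ((sg ^+ b)%g _).
  by elim: q {Eq} => [|q IHq]; rewrite ?mul0n ?expg0 ?perm1 // mulSn expgD permM sg2r.
- move=> k l b b' E; apply/eqP; apply: contraT => kl.
  have mk := moved k b; have ml := moved l b'; rewrite -iterE in mk; rewrite -iterE in ml.
  have [E1|E1] := disj k l kl ((sg ^+ b)%g (i0 k)); first by rewrite E1 eqxx in mk.
  by rewrite E in E1; rewrite E1 eqxx in ml.
- move=> x /cov[k hx]; exists k; have [_ _ _ _ fixed] := hi k.
  apply: boolp.contrapT => nx; case/eqP: hx; apply: fixed => a ar; split=> E; apply: nx.
    by exists a; rewrite iterE.
  exists (a + r k)%N; rewrite addnC expgD permM sgr in_WI_exp //.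
  by rewrite iterE.
Qed.

End Cycles.

(** * Commutativity when dim V = 1, and the Galois action on the characters of T *)

Section LineCommute.
Context (Qp : fieldType) (K : fieldExtType Qp) (E : splittingFieldType K).
Context (C : closedFieldType) (iK : {rmorphism K -> C}).
Context (V : vectType E) (N : nat) (w : 'I_N -> V) (w_basis : Kbasis w).

(* With w_j = f_j v0 for a generator v0 of V over E, an E-linear X is the
   combination of the multiplications by the f_j with coefficients X v0. *)
Lemma E_linear_commute : \dim {:V} = 1%N -> forall X Y : 'M[C]_N,
  E_linear iK w X -> E_linear iK w Y -> X *m Y = Y *m X.
Proof.
move=> dV X Y hX hY.
pose toV (c : 'cV[K]_N) := \sum_i (c i 0)%:A *: w i.
have toV_inj c c' : toV c = toV c' -> c = c'.
  move=> h; have [d [_ hd]] := w_basis (toV c).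
  by rewrite -(hd c) // -(hd c') // h.
have toV_surj x : exists c, x = toV c by have [c [hc _]] := w_basis x; exists c.
have exA e : exists A : 'M[K]_N, scal_mat w e A.
  have [f hf] := boolp.choice (fun j => toV_surj (e *: w j)).
  exists (\matrix_(i, j) f j i 0) => j; rewrite hf; apply: eq_bigr => i _.
  by rewrite mxE.
have [A hA] := boolp.choice exA.
have A_toV e c : toV (A e *m c) = e *: toV c.
  rewrite /toV scaler_sumr; under [RHS]eq_bigr => l _ do rewrite scalerA mulrC -scalerA hA scaler_sumr.
  rewrite exchange_big; apply: eq_bigr => i _ /=.
  under [RHS]eq_bigr => l _ do rewrite scalerA.
  rewrite -scaler_suml; congr (_ *: _); rewrite mxE scaler_suml; apply: eq_bigr => l _.
  by rewrite mulr_algl scalerA mulrC.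
have AC e e' : A e *m A e' = A e' *m A e.
  apply/matrixP => a b.
  have h : A e *m (A e' *m delta_mx b (0 : 'I_1)) = A e' *m (A e *m delta_mx b 0).
    by apply: toV_inj; rewrite !A_toV scalerA mulrC -scalerA.
  by move/colP/(_ a): h; rewrite !mulmxA -!colE !mxE.
have [v0 hv0] : exists v0, forall x : V, exists f : E, x = f *: v0.
  have b0 : (0 < \dim {:V})%N by rewrite dV.
  exists (vbasis {:V})`_0 => x; rewrite {1}(coord_vbasis (memvf x)).
  exists (coord (vbasis {:V}) (Ordinal b0) x).
  rewrite (bigD1 (Ordinal b0)) //= big1 ?addr0 // => i ne.
  by case/eqP: ne; apply: val_inj; apply/eqP; rewrite -leqn0 -ltnS -dV; exact: ltn_ord.
have [f hf] := boolp.choice (fun i => hv0 (w i)).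
have [a ha] := toV_surj v0.
have Aa i : A (f i) *m a = delta_mx i 0.
  apply: toV_inj; rewrite A_toV -ha -hf /toV (bigD1 i) //= big1 ?addr0.
    by rewrite mxE !eqxx scale1r scale1r.
  by move=> l li; rewrite mxE (negPf li) scale0r scale0r.
pose M i := map_mx iK (A (f i)); pose a' := map_mx iK a.
have Ma i : M i *m a' = delta_mx i 0 by rewrite -map_mxM Aa map_delta_mx.
have MC i l : M i *m M l = M l *m M i by rewrite -!map_mxM AC.
have XM Z : E_linear iK w Z -> forall i, Z *m M i = M i *m Z by move=> hZ i; apply: hZ (hA _).
have mx_ext (P Q : 'M[C]_N) : (forall i : 'I_N, P *m delta_mx i (0 : 'I_1) = Q *m delta_mx i 0) -> P = Q.
  move=> h; apply/matrixP => k i; move/colP/(_ k): (h i).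
  by rewrite -!colE !mxE.
have EX : X = \sum_i (X *m a') i 0 *: M i.
  apply: mx_ext => l; rewrite -Ma mulmxA XM // -mulmxA.
  have {1}-> : X *m a' = \sum_i (X *m a') i 0 *: (M i *m a').
    rewrite [LHS]matrix_sum_delta; apply: eq_bigr => i _.
    by rewrite big_ord1 Ma.
  rewrite mulmx_sumr mulmx_suml; apply: eq_bigr => i _.
  by rewrite -scalemxAr -scalemxAl !mulmxA MC.
rewrite EX mulmx_suml mulmx_sumr; apply: eq_bigr => i _.
by rewrite -scalemxAl -scalemxAr XM.
Qed.

End LineCommute.

(** With m the cocycle value g^-1 gam(g), gam takes g^-1 t g to m^-1 (g^-1 gam(t) g) m. So the
    action on the psi is that on the chi, twisted by the Weyl element f of m; [in_WI f] moves f past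
    the index reversal. *)
Lemma weyl_conj_act (Qp : fieldType) (K : fieldExtType Qp) (E : splittingFieldType K)
    (C : closedFieldType) (iK : {rmorphism K -> C}) (iE : {rmorphism E -> C})
    N (S T : 'M[C]_N -> Prop) n (chi : 'I_n -> 'M[C]_N -> C) (g : 'M[C]_N)
    (gam : {rmorphism C -> C}) (f : 'S_n) (e : bool) :
  (forall gam : {rmorphism C -> C}, in_GalK iK gam -> (forall x, gam (iE x) = iE x) ->
     forall i s, S s -> gam (chi i s) = chi i (map_mx gam s)) ->
  (forall gam : {rmorphism C -> C}, in_GalK iK gam -> ~ (forall x, gam (iE x) = iE x) ->
     forall i s, S s -> gam (chi i s) = (chi (rev_ord i) (map_mx gam s))^-1) ->
  g \in unitmx -> (forall t, T t <-> S (invmx g *m t *m g)) ->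
  (forall t, T t -> T (map_mx gam t)) -> in_GalK iK gam -> in_WI f ->
  e = ~~ boolp.asbool (forall x, gam (iE x) = iE x) ->
  (let m := invmx g *m map_mx gam g in
   forall l s, S s -> chi l (invmx m *m s *m m) = chi (f l) s) ->
  forall l t, T t -> gam (chi l (invmx g *m t *m g)) =
    if e then (chi (rev_ord (f l)) (invmx g *m map_mx gam t *m g))^-1
    else chi (f l) (invmx g *m map_mx gam t *m g).
Proof.
move=> chiE chiNE gu TS T_map hg f_WI -> hm l t Tt.
set m := invmx g *m map_mx gam g in hm.
have mu : m \in unitmx by rewrite unitmx_mul unitmx_inv gu map_unitmx.
have E1 : map_mx gam (invmx g *m t *m g) = invmx m *m (invmx g *m map_mx gam t *m g) *m m.
  have Eg : map_mx gam g = g *m m by rewrite /m mulKVmx.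
  have gmu : g *m m \in unitmx by rewrite unitmx_mul gu mu.
  have Ei : invmx m *m invmx g = invmx (g *m m).
    apply: (can_inj (mulKmx gmu)).
    by rewrite mulmxV // -mulmxA (mulKVmx mu) mulmxV.
  by rewrite !map_mxM map_invmx Eg -Ei !mulmxA.
have Sgt : S (invmx g *m map_mx gam t *m g) by apply/TS/T_map.
case: boolp.asboolP => h /=.
  by rewrite chiE // ?E1 ?hm //; apply/TS.
by rewrite chiNE // ?E1 ?hm ?f_WI //; apply/TS.
Qed.

Lemma unitary_group_map (Qp : fieldType) (K : fieldExtType Qp) (E : splittingFieldType K)
    (C : closedFieldType) (iK : {rmorphism K -> C}) (V : vectType E) (h : V -> V -> E)
    N (w : 'I_N -> V) (gam : {rmorphism C -> C}) g :
  fixes_base iK gam -> unitary_group iK h w g -> unitary_group iK h w (map_mx gam g).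
Proof.
move=> hg [gu gE gh].
have mapK m n (A : 'M[K]_(m, n)) : map_mx gam (map_mx iK A) = map_mx iK A.
  by apply/matrixP => i j; rewrite !mxE hg.
split; first by rewrite map_unitmx.
  by move=> e A hA; rewrite -(mapK _ _ A) -!map_mxM (gE e A hA).
move=> l; have form_map : map_mx gam (form_mat iK h w l) = form_mat iK h w l.
  by apply/matrixP => i j; rewrite !mxE hg.
by rewrite -{1 2}form_map map_trmx -!map_mxM gh.
Qed.

Theorem theorem3p10
  (* K is a finite extension of Q_p, p odd, with algebraic closure Kbar *)
  (p : nat) (p_prime : prime p) (p_odd : p <> 2%N)
  (Qp : fieldType) (v : padic_abs p Qp) (K : fieldExtType Qp)
  (Kbar : closedFieldType) (iK : {rmorphism K -> Kbar})
  (Kbar_alg : forall x : Kbar, algebraicOver iK x)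
  (* E / K is a ramified quadratic extension inside Kbar *)
  (E : splittingFieldType K) (iE : {rmorphism E -> Kbar})
  (iE_K : forall c : K, iE c%:A = iK c)
  (E_quadratic : \dim {:E} = 2%N)
  (E_ramified : ~ unramified v 1%AS {:E}%AS)
  (tau : gal_of {:E}) (tau_gal : tau \in 'Gal({:E} / 1)%g)
  (tau_neq1 : tau != 1%g)
  (* V is a Hermitian space over E, G = U(V) is quasi-split *)
  (V : vectType E) (h : {hermitian V for false & tau})
  (h_nondeg : nondegenerate h)
  (N : nat) (w : 'I_N -> V) (w_basis : Kbasis w)
  (G : 'M[Kbar]_N -> Prop) (G_def : G = unitary_group iK h w)
  (G_qs : quasi_split (rat_over iK) G)
  (* S is the centralizer of a maximal K-split torus *)
  (A S : 'M[Kbar]_N -> Prop)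
  (A_max : maximal_split_torus (rat_over iK) G A)
  (S_def : S = centralizer G A)
  (S_max : maximal_torus (rat_over iK) G S)
  (chi : 'I_(\dim {:V}) -> 'M[Kbar]_N -> Kbar)
  (chi_basis : weight_basis iK h w iE S chi)
  (* T is a maximal, relatively unramified, anisotropic torus in the stable
     class of sigma *)
  (T : 'M[Kbar]_N -> Prop)
  (T_max : maximal_torus (rat_over iK) G T)
  (T_unr : group_iso (Kur v iK) T S)
  (T_anis : anisotropic (rat_over iK) T)
  (sigma : 'S_(\dim {:V})) (sigma_WI : in_WI sigma)
  (T_sigma : stable_class_of v iK G S chi T sigma)
  (j : nat) (c : 'I_j -> 'S_(\dim {:V})) (r : 'I_j -> nat)
  (sigma_cycles : negative_cycle_decomposition sigma c r)
  (D : forall k : 'I_j, Ts_datum v E (r k)) :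
  (forall m : nat, \dim {:V} = m.*2.+1 ->
     group_iso (rat_over iK) T
       (prod_group (bigprod_group (fun k => Ts (D k) iK))
                   (resU1 iK (1%AS : {subfield E})))) /\
  (forall m : nat, \dim {:V} = m.*2 ->
     group_iso (rat_over iK) T (bigprod_group (fun k => Ts (D k) iK))).
Proof.
have K0 := base_char0 p_prime v K.
have [[T_closed T_torus] _ _] := T_max.
have [[S_closed S_torus] _ _] := S_max.
have [S_sub _] := S_closed; have [Su S1 SM SV] := S_sub.
have [chi_span _ chiE chiNE] := chi_basis.
have [chi_char _] := chi_span.
have [g [Gg TS g_inert g_frob]] := T_sigma.
have gu : g \in unitmx by move: Gg; rewrite G_def => -[].
pose psi i t := chi i (invmx g *m t *m g).
have psi_basis : character_basis T psi := conj_character_basis gu TS chi_span.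
have [i0 [hr period disj cover rev_moved]] := cycle_bases sigma_WI sigma_cycles.
have [two tau2] := quadratic_gal K0 E_quadratic tau_neq1.
have iota_ex k := boolp.cid (embedding_over_E p_prime iE_K E_quadratic E_ramified tau_neq1 (hr k).1 (D k)).
pose iota k := sval (iota_ex k).
have iotaK k : forall c : K, iota k c%:A = iK c := (svalP (iota_ex k)).1.
have iota_emb k : forall x, iota k (Es_emb (D k) x) = iE x := (svalP (iota_ex k)).2.
pose cocycle (gam : {rmorphism Kbar -> Kbar}) := invmx g *m map_mx gam g.
(* What follows uses only that [D0] has fixed field K and that for each member one exponent a
   describes both the Weyl action of the cocycle and the action on every K_s: 1 for a Frobenius, 0
   for a residue-trivial automorphism. *)
have [D0 [D0_fixed D0_act]] : exists D0 : {rmorphism Kbar -> Kbar} -> Prop,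
    (forall x, (forall gam, D0 gam -> gam x = x) -> exists c, x = iK c) /\
    (forall gam, D0 gam -> in_GalK iK gam /\ exists a,
      (forall l s, S s -> chi l (invmx (cocycle gam) *m s *m cocycle gam) = chi ((sigma ^+ a)%g l) s) /\
      forall k x, x \in Ks (D k) -> gam (iota k x) = iota k ((sigma_s (D k) ^+ a)%g x)).
  (* Only a Ts_datum provides the residue cardinality of K; without any cycle,
     dim V = 1 and G is commutative. *)
  have [j0|[k0]] : (j = 0)%N \/ exists k0 : 'I_j, True.
  - by case: (posnP j) => [|j0]; [left | right; exists (Ordinal j0)].
  - exists (in_GalK iK); split=> [x hx|gam hg].
      by apply: (fixed_in_base Kbar_alg K0) => gam hgam; apply: hx; split=> //; apply: auto_bij hgam.
    split=> //; exists 0%N; split=> [l s Ss|k]; last by have := ltn_ord k; rewrite {2}j0.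
    rewrite expg0 perm1; congr (chi l _).
    have dV : \dim {:V} = 1%N.
      have all_center (x : 'I_(\dim {:V})) : rev_ord x = x.
        apply/eqP; apply: contraT => /cover[k _]; by have := ltn_ord k; rewrite {2}j0.
      have l0 : (0 < \dim {:V})%N by apply: leq_ltn_trans (ltn_ord l).
      have := congr1 val (all_center (Ordinal l0)) => /=; lia.
    have Gs : E_linear iK w s.
      have : G s by have [_ SG _] := S_max; apply: SG.
      by rewrite G_def => -[].
    have Gc : E_linear iK w (cocycle gam).
      have Gmg : unitary_group iK h w (map_mx gam g).
        by apply: unitary_group_map hg.2 _; rewrite -G_def.
      have gE : E_linear iK w g by move: Gg; rewrite G_def => -[].
      have mE : E_linear iK w (map_mx gam g) by case: Gmg.
      move=> e A' hA; rewrite /cocycle.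
      have gVE : invmx g *m map_mx iK A' = map_mx iK A' *m invmx g.
        apply: (can_inj (mulKmx gu)); rewrite mulKVmx // mulmxA (gE e A' hA) -mulmxA mulmxV // mulmx1.
        by [].
      by rewrite -mulmxA (mE e A' hA) !mulmxA gVE.
    have cu : cocycle gam \in unitmx by rewrite unitmx_mul unitmx_inv gu map_unitmx.
    by rewrite -mulmxA (E_linear_commute w_basis dV Gs Gc) mulKmx.
  - move=> _; have [q hq _] := sigma_s_frob (D k0).
    exists (fun gam => frobenius v iK gam \/ residue_trivial v iK gam); split.
      exact: (frob_inertia_fixed p_prime Kbar_alg hq).
    have scal k (y : gal_of {:Es (D k)}) (c1 : K) : y c1%:A = c1%:A by rewrite linearZ /= rmorph1.
    have rigid k (gam : {rmorphism Kbar -> Kbar}) (y : gal_of {:Es (D k)}) : in_GalK iK gam ->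
        (forall x, x \in Ks (D k) -> vring v (in_alg (Es (D k))) x ->
           vmax v iK (gam (iota k x) - iota k (y x))) ->
        forall x, x \in Ks (D k) -> gam (iota k x) = iota k (y x).
      move=> hg hx x xK.
      apply: (unramified_rigid p_prime Kbar_alg hq (u := iota k \o y) (u' := gam \o iota k)
        _ _ (Ks_unr (t := D k)) hx xK) => c' /=.
        by rewrite scal iotaK.
      by rewrite iotaK hg.2.
    have to_vring k x : vring v (in_alg (Es (D k))) x -> vring v iK (iota k x).
      exact: (@vring_mor p Qp v K _ Kbar (in_alg (Es (D k))) iK (iota k) (iotaK k) _).1.
    move=> gam [hf|hi].
      have [hg [q' hq' hq'']] := hf; split=> //; exists 1%N; split=> [l s Ss|k].
        by have [_ ->] := g_frob gam hf; rewrite ?expg1.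
      rewrite expg1; apply: rigid => // x xK hx.
      have hs := sigma_s_res p_prime Kbar_alg hq (iotaK k) xK hx.
      rewrite -(residue_card_inj p_prime Kbar_alg hq hq') in hq''.
      have -> : gam (iota k x) - iota k (sigma_s (D k) x) =
        (gam (iota k x) - iota k x ^+ q) - (iota k (sigma_s (D k) x) - iota k x ^+ q) by ring.
      by apply: (vmaxB p_prime Kbar_alg) hs; apply: hq''; apply: to_vring.
    have [hg hres] := hi; split=> //; exists 0%N; split=> [l s Ss|k].
      (* For an inertial automorphism the cocycle lies in S itself, and a character of S is
         invariant under conjugation by S. *)
      have Sc : S (cocycle gam) := g_inert gam (residue_trivial_inertia p_prime Kbar_alg hq hi).
      have SVc := SV _ Sc; have [_ chi0 chiM] := chi_char l.
      rewrite expg0 perm1 (chiM _ _ (SM _ _ SVc Ss) Sc) (chiM _ _ SVc Ss) mulrAC.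
      rewrite -(chiM _ _ SVc Sc) mulVmx; last exact: Su.
      suff -> : chi l 1%:M = 1 by rewrite mul1r.
      by apply: (mulfI (chi0 _ S1)); rewrite -chiM // mulr1 mul1mx.
    rewrite expg0; apply: rigid => // x xK hx; rewrite gal_id.
    by apply: hres; apply: to_vring.
have D0_base gam : D0 gam -> fixes_base iK gam by move=> /D0_act[[]].
have T_map gam : D0 gam -> forall t, T t -> T (map_mx gam t).
  by move=> /D0_base hg t; apply: (closed_group_map T_closed hg _).1.
have fix_or gam : exists e, e = ~~ boolp.asbool (forall x, gam (iE x) = iE x) by eexists.
have psi_act gam a e : D0 gam -> e = ~~ boolp.asbool (forall x, gam (iE x) = iE x) ->
    (forall l s, S s -> chi l (invmx (cocycle gam) *m s *m cocycle gam) = chi ((sigma ^+ a)%g l) s) ->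
    forall l t, T t -> gam (psi l t) =
      if e then (psi (rev_ord ((sigma ^+ a)%g l)) (map_mx gam t))^-1
      else psi ((sigma ^+ a)%g l) (map_mx gam t).
  move=> hgam he ha; apply: (weyl_conj_act chiE chiNE gu TS) => //.
  - exact: T_map.
  - by have [] := D0_act _ hgam.
  - by move=> i; apply: in_WI_exp.
have Ts_factor k : exists x : (gal_of {:Es (D k)} -> 'M[Kbar]_(\dim {:Es (D k)})) *
    ((gal_of {:Es (D k)} -> Kbar) -> Prop) * (gal_of {:Es (D k)} -> 'I_(\dim {:V})) * (gal_of {:Es (D k)} -> bool),
    [/\ coord_factor D0 T psi x.1.1.1 x.1.1.2 x.1.2 x.2,
        forall h', Ts (D k) iK h' <-> frame_group x.1.1.1 x.1.1.2 h' &
        forall i, (exists rho, x.1.2 rho = i) <-> exists b, i = (sigma ^+ b)%g (i0 k)].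
  have [q hq _] := sigma_s_frob (D k); have [r0 sgr] := hr k.
  have [wk [w_dual w_sum]] := dual_basis_ex K0 (iotaK k).
  have orbit b b' : (sigma_s (D k) ^+ b = sigma_s (D k) ^+ b')%g <->
      (sigma ^+ b)%g (i0 k) = (sigma ^+ b')%g (i0 k).
    rewrite period; split=> [/eqP|/eqP]; rewrite -(sigma_s_order (D k)).
      by rewrite eq_expg_mod_order => /eqP.
    by rewrite -eq_expg_mod_order => /eqP.
  have [||idx [sgn [F hidx]]] := @gal_coord_factor _ _ _ _ _ K0 _ (iotaK k) _ w_dual w_sum D0 _ T _ psi sigma sigma_WI
     (L_r (D k)) (sigma_s (D k)) (tau_s (D k)) (r k) (i0 k)
     (gal_gen_Es p_prime E_quadratic E_ramified r0 (D := D k)) (tau_s2 p_prime E_quadratic r0 (D k))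
     (commute_st p_prime Kbar_alg E_quadratic r0 hq (iotaK k))
     (tau_s_notin p_prime E_quadratic E_ramified r0 (D k)) orbit sgr.
  - exact: (gal_L_r p_prime Kbar_alg E_quadratic E_ramified r0 hq (iotaK k)).
  - move=> gam hgam; split; first exact: D0_base.
    have [hg [a [ha hK]]] := D0_act _ hgam; have [e he] := fix_or gam.
    exists a, e; split; last exact: psi_act.
    exact: (embedding_act p_prime Kbar_alg E_quadratic E_ramified r0 hq (iotaK k) hg.2 (iota_emb k) he (hK k)).
  exists (emb_proj (iota k) wk, norm_one_coords (L_r (D k)), idx, sgn); split=> //= h'.
  exact: (resU1_frame (iotaK k) w_dual w_sum).
pose fk k := boolp.cid (Ts_factor k).
pose B k := (sval (fk k)).1.1.1; pose Y k := (sval (fk k)).1.1.2.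
pose idx k := (sval (fk k)).1.2; pose sgn k := (sval (fk k)).2.
have F k : coord_factor D0 T psi (B k) (Y k) (idx k) (sgn k) by have [] := svalP (fk k).
have HE k : forall h', Ts (D k) iK h' <-> frame_group (B k) (Y k) h' by have [] := svalP (fk k).
have hidx k : forall i, (exists rho, idx k rho = i) <-> exists b, i = (sigma ^+ b)%g (i0 k) by have [] := svalP (fk k).
have idx_disj k l i i' : idx k i = idx l i' -> k = l.
  have /hidx[b ->] : exists rho, idx k rho = idx k i by exists i.
  have /hidx[b' ->] : exists rho, idx l rho = idx l i' by exists i'.
  exact: disj.
have Fbig := coord_factor_big F idx_disj.
have HEbig := big_frame_group HE.
have surj l : rev_ord l != l -> exists x : {k : 'I_j & gal_of {:Es (D k)}}, idx (tag x) (tagged x) = l.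
  by move=> /cover[k [b Eb]]; have [|rho <-] := (hidx k l).2; [exists b | exists (existT _ k rho)].
split=> m dV; last first.
  apply: (coord_factor_iso Kbar_alg K0 D0_base D0_fixed T_closed T_torus psi_basis Fbig _ HEbig) => l.
  (* In even dimension [rev_ord] has no fixed point, so the orbits of the cycles already reach every
     index. *)
  apply: surj; apply/eqP => /(congr1 val) /=; have := ltn_ord l; lia.
have x0_lt : (m < \dim {:V})%N by rewrite dV; lia.
pose x0 := Ordinal x0_lt.
have center l : rev_ord l = l <-> l = x0.
  split=> [/(congr1 val) /= E_l|->]; apply/val_inj => /=; last by rewrite dV; lia.
  by have := ltn_ord l; lia.
have rev_x0 : rev_ord x0 = x0 by apply/center.
have sigma_x0 b : (sigma ^+ b)%g x0 = x0 by apply/center; rewrite -(in_WI_exp b x0 sigma_WI) rev_x0.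
have [wE [w_dual w_sum]] := dual_basis_ex K0 iE_K.
(* U_1(E/K) is the degenerate case L = E, M = K, s = 1, t = tau, r = 0 of [gal_coord_factor]: the
   orbit is the single index [x0], and t s^r = tau generates Gal(E/K). *)
have gal_gen (rho : gal_of {:E}) : exists b (e : bool), rho = (1%g ^+ b * tau ^+ e)%g.
  by have [->|->] := two rho; exists 0%N; [exists false | exists true];
     rewrite ?expg0 ?expg1 ?mulg1 ?mul1g.
have tau_notin : tau \notin <[1%g]>%g by rewrite cycle1 inE.
have orbit b b' : (1%g ^+ b = 1%g ^+ b' :> gal_of {:E})%g <-> (sigma ^+ b)%g x0 = (sigma ^+ b')%g x0.
  by rewrite !sigma_x0 !expg1n.
have sigma_x0_rev : (sigma ^+ 0)%g x0 = rev_ord x0 by rewrite sigma_x0 rev_x0.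
have gal_E : 'Gal({:E} / 1)%g = [set 1%g; (tau * 1 ^+ 0)%g] :> {set gal_of {:E}}.
  apply/setP => rho; rewrite !inE expg0 mulg1.
  by have [->|->] := two rho; rewrite ?group1 ?tau_gal eqxx ?orbT.
have D_act gam : D0 gam -> fixes_base iK gam /\
    exists a (e : bool), (forall x, gam (iE x) = iE ((1%g ^+ a * tau ^+ e)%g x)) /\
      forall l u, T u -> gam (psi l u) =
        if e then (psi (rev_ord ((sigma ^+ a)%g l)) (map_mx gam u))^-1
        else psi ((sigma ^+ a)%g l) (map_mx gam u).
  move=> hgam; split; first exact: D0_base.
  have [hg [a [ha _]]] := D0_act _ hgam; have [e he] := fix_or gam.
  exists a, e; split; last exact: psi_act.
  move=> x; rewrite expg1n mul1g.
  have [|rho hrho] := embedding_galois K0 iE_K (u := gam \o iE); first by move=> c1 /=; rewrite iE_K hg.2.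
  have {}hrho y : gam (iE y) = iE (rho y) := hrho y.
  move: he; case: boolp.asboolP => [fix_E|move_E] -> /=; first by rewrite expg0 gal_id.
  have [E_rho|E_rho] := two rho; last by rewrite expg1 -E_rho.
  by case: move_E => y; rewrite hrho E_rho gal_id.
have [idxE [sgnE [FE hidxE]]] := gal_coord_factor K0 iE_K w_dual w_sum sigma_WI gal_gen tau2
  (commute_sym (commute1 tau)) tau_notin orbit sigma_x0_rev gal_E D_act.
have idxE_x0 rho : idxE rho = x0.
  by have /hidxE[b ->] : exists rho', idxE rho' = idxE rho by exists rho.
have HEE := resU1_frame iE_K w_dual w_sum 1%AS.
have Fsum := coord_factor_sum Fbig FE.
apply: (coord_factor_iso Kbar_alg K0 D0_base D0_fixed T_closed T_torus psi_basis (Fsum _) _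
  (sum_frame_group HEbig HEE)) => [x rho E_x|l].
  (* The two families of indices are disjoint: an index on the orbit of a negative cycle is never
     its own opposite, while [idxE] is constantly the central index. *)
  have [b Eb] := (hidx (tag x) (idx (tag x) (tagged x))).1 (ex_intro _ (tagged x) erefl).
  by have := rev_moved (tag x) b; rewrite -Eb E_x idxE_x0 rev_x0 eqxx.
have [/center->|/eqP] := eqVneq (rev_ord l) l; first by exists (inr 1%g) => /=.
by move=> /eqP/surj[x <-]; exists (inl x).
Qed.
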